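(* Let $0<\alpha,\beta<1$, $n\in\mathbb{N}$, and let $f\in\mathcal{D}_{\max}^{n}$. Then, for $j\in\mathbb{N}$ with $j\le n$, the representation $$[f,u_j^{\pm}]_n(\pm 1)=\lim_{x\to\pm 1^{\mp}}\left((\mp 1)^{j-1}\frac{f^{(j-1)}(x)}{(j-1)!}+\left\{\sum_{k=j}^{2n-1}h_{j,k}(x)f^{(k)}(x)\right\}\right)$$ holds for some functions $h_{j,k}(x)$. (Upper signs refer to the endpoint $x=1$ and the functions $u_j^+$, lower signs to the endpoint $x=-1$ and the functions $u_j^-$.)
   Context: Fix $0<\alpha,\beta<1$ and $n\in\mathbb{N}$. Let $L^2_{\alpha,\beta}:=L^2\big((-1,1),(1-x)^\alpha(1+x)^\beta dx\big)$. The Jacobi expression is $\ell[f](x)=-\frac{1}{(1-x)^{\alpha}(1+x)^{\beta}}\big[(1-x)^{\alpha+1}(1+x)^{\beta+1}f'(x)\big]'$, and $\ell^n$ is its $n$-fold composition. Maximal domain: $\mathcal{D}_{\max}^{n}=\{f\in L^2_{\alpha,\beta}: f,f',\dots,f^{(2n-1)}\in AC_{\rm loc}(-1,1),\ \ell^n[f]\in L^2_{\alpha,\beta}\}$. Sesquilinear form associated with $\ell^n$, in explicit form: for $f,g\in\mathcal{D}^n_{\max}$ and $x\in(-1,1)$, $$[f,g]_n(x)=\sum_{k=1}^n\sum_{j=1}^k(-1)^{k+j}\Big\{\big[a_k(x)\overline{g}^{(k)}(x)\big]^{(k-j)}f^{(j-1)}(x)-\big[a_k(x)f^{(k)}(x)\big]^{(k-j)}\overline{g}^{(j-1)}(x)\Big\},$$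 where $a_k(x)=(1-x)^{\alpha+k}(1+x)^{\beta+k}$, and $[f,g]_n(\pm1):=\lim_{x\to\pm1^{\mp}}[f,g]_n(x)$; these limits exist and are finite. For $1\le j\le n$ fix $C^\infty(-1,1)$ functions $\varphi_j^{\pm}$ and $v_j^\pm$ with: $\varphi_j^+(x)=(1-x)^{j-1}$ and $v_j^+(x)=(1-x)^{-\alpha+n-j}$ for $x$ near $1$, both $0$ for $x$ near $-1$; $\varphi_j^-(x)=(1+x)^{j-1}$ and $v_j^-(x)=(1+x)^{-\beta+n-j}$ for $x$ near $-1$, both $0$ for $x$ near $1$. All of these belong to $\mathcal{D}_{\max}^n$. The functions $u_k^\pm$ are defined recursively by a modified Gram–Schmidt procedure: for $k=1,\dots,n$, $$u_k^{\pm}:=\Big\{v_k^{\pm}-\sum_{j=1}^{k-1}\frac{[\varphi_j^{\pm},v_k^{\pm}]_n(\pm1)}{[\varphi_j^{\pm},u_j^{\pm}]_n(\pm1)}u_j^{\pm}\Big\}\Big/[\varphi_k^{\pm},v_k^{\pm}]_n(\pm1).$$ *)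

(* Defs.v *)
From HB Require Import structures.
From mathcomp Require Export all_boot all_order all_algebra.
From mathcomp Require Export all_classical all_reals all_analysis.
From mathcomp Require Export complex.

Set Implicit Arguments.
Unset Strict Implicit.
Unset Printing Implicit Defensive.

Export Order.TTheory GRing.Theory Num.Theory numFieldNormedType.Exports.

Local Open Scope classical_set_scope.
Local Open Scope ring_scope.
Local Open Scope complex_scope.

(* Functions on (-1, 1) are total functions on R; only their values on (-1, 1)
   are ever used. *)

Section ComplexValuedFunctions.
Context {R : realType}.
Implicit Types f g : R -> R[i].

(* The library has no R-normed-module structure on R[i], so derivatives of
   complex-valued functions of a real variable are taken componentwise. *)
Definition cderivable f (x : R) : Prop :=
  derivable (fun y => complex.Re (f y)) x 1 /\
  derivable (fun y => complex.Im (f y)) x 1.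

(* Like [derive1], [cderive k f] is total: it is meaningful at [x] only where
   the derivatives up to order k exist. *)
Definition cderive (k : nat) f : R -> R[i] :=
  iter k (fun g x => derive1 (fun y => complex.Re (g y)) x +i*
                     derive1 (fun y => complex.Im (g y)) x) f.

Definition smooth f : Prop :=
  forall (k : nat) (x : R), -1 < x < 1 -> cderivable (cderive k f) x.

Definition abs_continuous (a b : R) f : Prop :=
  forall e : R, 0 < e -> exists2 d : R, 0 < d &
    forall (m : nat) (s t : 'I_m -> R),
      (forall i, a <= s i /\ s i <= t i /\ t i <= b) ->
      (forall i j, i != j -> t i <= s j \/ t j <= s i) ->
      \sum_(i < m) (t i - s i) < d ->
      \sum_(i < m) Normc.normc (f (t i) - f (s i)) < e.

Definition AC_loc f : Prop :=
  forall a b : R, -1 < a -> a <= b -> b < 1 -> abs_continuous a b f.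

End ComplexValuedFunctions.

Section Jacobi.
Context {R : realType}.
Variables (alpha beta : R).
Implicit Types f g : R -> R[i].

(* [jacobi_a 0] is the weight and [jacobi_a 1] the leading coefficient of the
   Jacobi expression. *)
Definition jacobi_a (k : nat) (x : R) : R :=
  (1 - x) `^ (alpha + k%:R) * (1 + x) `^ (beta + k%:R).

Definition jacobi_itv : set R := `]-1, 1[.

Definition in_L2 f : Prop :=
  [/\ measurable_fun jacobi_itv (fun x => complex.Re (f x)),
      measurable_fun jacobi_itv (fun x => complex.Im (f x)) &
      (\int[lebesgue_measure]_(x in jacobi_itv)
         (Normc.normc (f x) ^+ 2 * jacobi_a 0 x)%:E < +oo)%E].

Definition jacobi_expr f : R -> R[i] := fun x =>
  - ((jacobi_a 0 x)%:C)^-1 *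
    cderive 1 (fun y => (jacobi_a 1 y)%:C * cderive 1 f y) x.

Definition Dmax (n : nat) f : Prop :=
  [/\ in_L2 f,
      forall (k : nat) (x : R), (k.+1 < 2 * n)%N -> -1 < x < 1 ->
        cderivable (cderive k f) x,
      forall k : nat, (k < 2 * n)%N -> AC_loc (cderive k f) &
      in_L2 (iter n jacobi_expr f)].

Definition bracket (n : nat) f g (x : R) : R[i] :=
  let gbar := fun y => (g y)^* in
  \sum_(1 <= k < n.+1) \sum_(1 <= j < k.+1) (-1) ^+ (k + j) *
    (cderive (k - j) (fun y => (jacobi_a k y)%:C * cderive k gbar y) x
       * cderive (j - 1) f x
     - cderive (k - j) (fun y => (jacobi_a k y)%:C * cderive k f y) x
       * cderive (j - 1) gbar x).

(* [right_end] is x = 1 (upper signs), [left_end] is x = -1 (lower signs). *)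
Variant endpoint := left_end | right_end.

Definition opposite (s : endpoint) : endpoint :=
  match s with left_end => right_end | right_end => left_end end.

Definition endval (s : endpoint) : R :=
  match s with left_end => -1 | right_end => 1 end.

Definition at_end (s : endpoint) : set_system R :=
  match s with left_end => (-1 : R)^'+ | right_end => (1 : R)^'- end.

Definition end_exponent (s : endpoint) : R :=
  match s with left_end => beta | right_end => alpha end.

(* The regular algebra R[i]^o carries the topology of the modulus. *)
Definition bracket_end (n : nat) (s : endpoint) f g : R[i] :=
  lim ((bracket n f g x : R[i]^o) @[x --> at_end s]).

(* 1 - endval s * x is 1 - x at the right endpoint and 1 + x at the left. *)
Definition is_phi (s : endpoint) (j : nat) f : Prop :=
  [/\ smooth f,
      \forall x \near at_end s, f x = ((1 - endval s * x) ^+ (j - 1))%:C &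
      \forall x \near at_end (opposite s), f x = 0].

Definition is_v (n : nat) (s : endpoint) (j : nat) f : Prop :=
  [/\ smooth f,
      \forall x \near at_end s,
        f x = ((1 - endval s * x) `^ (- end_exponent s + n%:R - j%:R))%:C &
      \forall x \near at_end (opposite s), f x = 0].

Definition is_gram_schmidt (n : nat) (s : endpoint)
    (phi v u : nat -> R -> R[i]) : Prop :=
  forall (k : nat) (x : R), (1 <= k <= n)%N -> -1 < x < 1 ->
    u k x =
    (v k x - \sum_(1 <= j < k)
       bracket_end n s (phi j) (v k) / bracket_end n s (phi j) (u j) * u j x)
    / bracket_end n s (phi k) (v k).

End Jacobi.

(* Main.v *)
(* Near an endpoint let t be the distance to it and gam the exponent of the
   weight there.  Integrating ell F = G twice and using the Cauchy-Schwarz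
   inequality for the L^2 right-hand side shows, by induction on n, that every
   f in the maximal domain is a combination of the 2n powers t^p,
   p = 0, -gam, 1, 1 - gam, ..., n - 1, n - 1 - gam, up to a remainder r with
   r^(k) = O(t^(n - 1/2 - gam/2 - k)) for k < 2n.  The u_j are combinations of
   the powers t^(m - gam), m < n; they pair to 0 with remainders, and
   Gram-Schmidt makes them dual to the powers 1, t, ..., t^(n-1).

   The coefficients of sum_k h_k f^(k) are chosen, at each point, so that this
   sum takes on each of the 2n powers t^p exactly the limit value [t^p, u_j].
   This is a linear system whose matrix consists of falling factorials of
   distinct numbers p, hence is invertible, and its solution satisfies
   h_k = O(t^(k - n + 1)), so the sum tends to 0 on remainders.  The equations
   for p = 0, ..., j - 1 are triangular and force h_k = 0 for k < j - 1 and
   the stated value of h_(j-1). *)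

From HB Require Import structures.
From mathcomp Require Import finmap.
Require Import Defs.
From mathcomp Require Import measurable_realfun.
From mathcomp Require Import ring lra zify.

Set Implicit Arguments.
Unset Strict Implicit.
Unset Printing Implicit Defensive.

Local Open Scope classical_set_scope.
Local Open Scope ring_scope.

(** * Absolutely continuous functions *)

Section AbsoluteContinuity.
Context {R : realType}.
Implicit Types (p : R -> R) (a b : R).

(** In the maximal domain the derivative of order 2n - 1 is only absolutely continuous, so [ell^n f]
    exists merely almost everywhere and the first integration must bound increments by the integral
    of a derivative defined almost everywhere. This rests on total variation, Lebesgue-Stieltjes
    measures and Radon-Nikodym. Later integrations concern functions differentiable near the
    endpoint and use monotone comparison. The weight and the u_j are real near the endpoint, so the
    analysis is done for real functions. Since 0 < gam < 1, the indicial roots 0 and -gam do not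
    differ by an integer and no logarithm arises. The single limits of f^(k) need not exist, which
    is why the coefficients must vary with x. On remainders, the pairing with u_j and the sum of the
    h_k f^(k) are both O(t^((1 - gam)/2)), by the same count of exponents. The limits [t^p, u_j]
    cannot be read off from sizes, since single terms may blow up; Green's formula shows that the
    derivative of the form is integrable. *)

Definition nonoverlapping (I : finType) (s t : I -> R) :=
  (forall i, s i <= t i) /\ (forall i j, i != j -> t i <= s j \/ t j <= s i).

(* Absolute continuity on [a, b] is expressed as [gAC] of the function composed
   with [clamp a b]. *)
Definition gAC p := forall e, 0 < e -> exists2 d : R, 0 < d &
  forall (I : finType) (s t : I -> R), nonoverlapping s t ->
    \sum_i (t i - s i) < d -> \sum_i `|p (t i) - p (s i)| < e.

Definition clamp a b x : R := if x <= a then a else if b <= x then b else x.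

Ltac clamp_cases := rewrite /clamp;
  repeat match goal with |- context[if ?u <= ?v then _ else _] =>
    case: (leP u v) => ? end; lra.

Lemma le_clamp a b x y : a <= b -> x <= y -> clamp a b x <= clamp a b y.
Proof. by move=> ab xy; clamp_cases. Qed.

Lemma clamp_in a b x : a <= b -> a <= clamp a b x <= b.
Proof. by move=> ab; clamp_cases. Qed.

Lemma clamp_id a b x : a <= x <= b -> clamp a b x = x.
Proof. by move=> ab; clamp_cases. Qed.

Lemma clamp_lip a b x y : a <= b -> x <= y -> clamp a b y - clamp a b x <= y - x.
Proof. by move=> ab xy; clamp_cases. Qed.

Lemma nonoverlapping_clamp a b (I : finType) (s t : I -> R) : a <= b ->
  nonoverlapping s t ->
  nonoverlapping (clamp a b \o s) (clamp a b \o t).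
Proof.
move=> ab [st dis]; split=> [i|i j /dis[]]; first exact: le_clamp.
- by left; exact: le_clamp.
- by right; exact: le_clamp.
Qed.

(** Reindexing by [enum_val] passes from ordinals to arbitrary finite types; the families met below
    are indexed by products and by finite sets of intervals. *)
Lemma gAC_clamp a b p : a <= b ->
  (forall e, 0 < e -> exists2 d : R, 0 < d &
    forall (m : nat) (s t : 'I_m -> R),
      (forall i, a <= s i /\ s i <= t i /\ t i <= b) ->
      (forall i j, i != j -> t i <= s j \/ t j <= s i) ->
      \sum_(i < m) (t i - s i) < d ->
      \sum_(i < m) `|p (t i) - p (s i)| < e) ->
  gAC (p \o clamp a b).
Proof.
move=> ab acp e e0; have [d d0 H] := acp e e0; exists d => // I s t st std.
have [st' dis'] := nonoverlapping_clamp ab st.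
have := H #|I| (clamp a b \o s \o enum_val) (clamp a b \o t \o enum_val).
rewrite -(big_enum_val (fun i => clamp a b (t i) - clamp a b (s i))).
rewrite -(big_enum_val (fun i => `|p (clamp a b (t i)) - p (clamp a b (s i))|)).
apply.
- move=> i /=; have /andP[-> _] := clamp_in (s (enum_val i)) ab.
  by have /andP[_ ->] := clamp_in (t (enum_val i)) ab; rewrite st'.
- by move=> i j ij; apply: dis'; apply: contra ij => /eqP/enum_val_inj ->.
- apply: le_lt_trans std; apply: ler_sum => i _; apply: clamp_lip => //.
  exact: st.1.
Qed.

Lemma gAC_continuous p : gAC p -> continuous p.
Proof.
move=> acp x; apply/cvgrPdist_lt => e e0; have [d d0 H] := acp e e0.
near=> y.
have xyd : `|x - y| < d by near: y; apply: (@cvgr_dist_lt _ _ _ _ _ id) => //.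
have [xy|yx] := leP x y.
- have := H unit (fun=> x) (fun=> y); rewrite !big_const !card_unit /= !addr0.
  rewrite distrC; apply; last by rewrite distrC ger0_norm ?subr_ge0 in xyd.
  by split=> [//|[] []].
- have := H unit (fun=> y) (fun=> x); rewrite !big_const !card_unit /= !addr0.
  apply; last by rewrite ger0_norm ?subr_ge0 ?ltW in xyd.
  by split=> [|[] []]//; rewrite ltW.
Unshelve. all: by end_near. Qed.

Lemma gACB p q : gAC p -> gAC q -> gAC (p \- q).
Proof.
move=> acp acq e e0.
have [d1 d10 H1] := acp (e / 2) ltac:(lra).
have [d2 d20 H2] := acq (e / 2) ltac:(lra).
exists (Num.min d1 d2); first by rewrite lt_min d10.
move=> I s t st; rewrite lt_min => /andP[/(H1 _ _ _ st) h1 /(H2 _ _ _ st) h2].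
apply: (@le_lt_trans _ _ (\sum_i (`|p (t i) - p (s i)| + `|q (t i) - q (s i)|))).
  apply: ler_sum => i _ /=.
  have := ler_normB (p (t i) - p (s i)) (q (t i) - q (s i)).
  by congr (`|_| <= _); rewrite /=; ring.
by rewrite big_split /=; lra.
Qed.

Notation TV := (@total_variation R).

(** Padding with the right endpoint adds only zero increments. Partitions of different lengths thus
    get a common number of terms, and a sum over intervals and partition points becomes a sum over a
    product type. *)
Lemma variation_nth a b f s N : itv_partition a b s -> (size s <= N)%N ->
  variation a b f s =
  \sum_(k < N) `|f (nth b (a :: s) k.+1) - f (nth b (a :: s) k)|.
Proof.
move=> abs sN; rewrite /variation /= (big_mkord _ (fun n => `|f (nth b s n) - f (nth b (a :: s) n)|)).
rewrite (big_ord_widen _ (fun n => `|f (nth b s n) - f (nth b (a :: s) n)|) sN).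
rewrite big_mkcond /=; apply: eq_bigr => i _; case: ltnP => // si.
rewrite (nth_default _ si); move: si; rewrite leq_eqVlt => /predU1P[si|si].
  by rewrite -si (itv_partition_nth_size b abs) subrr normr0.
by rewrite nth_default// subrr normr0.
Qed.

Lemma itv_partition_homo a b s m n : itv_partition a b s -> (m <= n)%N ->
  nth b (a :: s) m <= nth b (a :: s) n.
Proof.
move=> abs mn; elim: n mn => [|n ih]; first by rewrite leqn0 => /eqP ->.
rewrite leq_eqVlt => /predU1P[->//|]; rewrite ltnS => /ih mn.
apply: (le_trans mn); have [ns|sn] := ltnP n (size s).
  by have [/(pathP b)/(_ n ns)/ltW] := abs.
move: sn; rewrite /= leq_eqVlt => /predU1P[si|si].
  by rewrite -si (itv_partition_nth_size b abs) nth_default// si.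
by rewrite !nth_default ?lexx// ltnW.
Qed.

(* Refining each of finitely many nonoverlapping intervals by a partition keeps the total length. *)
Lemma gAC_partitions p (e : R) : gAC p -> 0 < e -> exists2 d : R, 0 < d &
  forall (I : finType) (s t : I -> R) (l : I -> seq R), nonoverlapping s t ->
    \sum_i (t i - s i) < d -> (forall i, itv_partition (s i) (t i) (l i)) ->
    \sum_i variation (s i) (t i) p (l i) < e.
Proof.
move=> acp e0; have [d d0 H] := acp e e0; exists d => // I s t l [st dis] std lp.
pose N := (\sum_i size (l i))%N.
have lN i : (size (l i) <= N)%N by rewrite /N (bigD1 i)//= leq_addr.
pose q i k := nth (t i) (s i :: l i) k.
under eq_bigr => i _ do rewrite (@variation_nth _ _ p _ N)//.
rewrite pair_big /=.
have qs i k : s i <= q i k by rewrite /q; exact: (itv_partition_homo (lp i) (leq0n k)).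
have qt i k : q i k <= t i.
  have := itv_partition_homo (lp i) (leq_addl (size (l i)).+1 k).
  have h : (size (s i :: l i) <= (size (l i)).+1 + k)%N by exact: leq_addr.
  by rewrite (nth_default _ h).
apply: (H (I * 'I_N)%type (fun x => q x.1 x.2) (fun x => q x.1 x.2.+1)).
  split=> [[i k]|[i k] [j k']]/=; first exact: itv_partition_homo.
  have [->|ij _] := eqVneq i j; last first.
    case: (dis _ _ ij) => h; [left|right].
      by rewrite (le_trans (qt _ _))// (le_trans h).
    by rewrite (le_trans (qt _ _))// (le_trans h).
  rewrite xpair_eqE eqxx /= => kk'; have {kk'} : (k < k' \/ k' < k)%N.
    by apply/orP; rewrite -neq_ltn.
  by move=> [h|h]; [left|right]; exact: itv_partition_homo.
rewrite -(pair_big xpredT xpredT (fun i (k : 'I_N) => q i k.+1 - q i k)) /=.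
apply: le_lt_trans std; apply: ler_sum => i _.
rewrite -(big_mkord xpredT (fun k => q i k.+1 - q i k)) telescope_sumr//.
by rewrite lerB.
Qed.

(** Each total variation is attained up to [eta / #|I|] by a partition, and [gAC_partitions]
    controls all these partitions at once. *)
Lemma gAC_total_variation p (e : R) : gAC p -> 0 < e -> exists2 d : R, 0 < d &
  forall (I : finType) (s t : I -> R), nonoverlapping s t ->
    \sum_i (t i - s i) < d -> (\sum_i TV (s i) (t i) p <= e%:E)%E.
Proof.
move=> acp e0; have [d d0 H] := gAC_partitions acp e0; exists d => // I s t [st dis] std.
apply/lee_addgt0Pr => eta eta0.
have [I0|I0] := posnP #|I|.
  rewrite big1 ?lee_fin; first lra.
  by move=> i _; have := card0_eq I0 i.
have : forall i, exists l, itv_partition (s i) (t i) l /\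
    (TV (s i) (t i) p <= (variation (s i) (t i) p l + eta / #|I|%:R)%:E)%E.
  move=> i.
  have ep : 0 < eta / #|I|%:R by rewrite divr_gt0 // ltr0n.
  have bv l : itv_partition (s i) (t i) l -> variation (s i) (t i) p l <= e.
    move=> lp.
    have := H unit (fun=> s i) (fun=> t i) (fun=> l).
    rewrite !big_const !card_unit /= !addr0 => h; apply: ltW; apply: h => //.
    apply: le_lt_trans std; rewrite (bigD1 i) //= lerDl sumr_ge0// => j _.
    by rewrite subr_ge0.
  have fTV : TV (s i) (t i) p \is a fin_num.
    apply/bounded_variationP => //; exists e => _ [l lp <-]; exact: bv.
  have [x [_ [l lp <-] <-] h] := ub_ereal_sup_adherent ep fTV.
  exists l; split=> //; move: h; rewrite -/(total_variation _ _ _) -(fineK fTV) -EFinB lte_fin lee_fin; lra.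
move=> /choice[l] /all_and2[lp lv].
apply: (@le_trans _ _ (\sum_i (variation (s i) (t i) p (l i) + eta / #|I|%:R)%:E)%E).
  exact: lee_sum.
rewrite sumEFin -EFinD lee_fin big_split /= sumr_const.
have -> : (eta / #|I|%:R) *+ #|I| = eta.
  by rewrite -[LHS]mulr_natr divfK// pnatr_eq0 -lt0n.
by rewrite lerD2r ltW// H.
Qed.

End AbsoluteContinuity.

(** * The variation function and finite unions of intervals *)

Section BoundedVariation.
Context {R : realType}.
Implicit Types (p : R -> R) (a b : R).
Notation TV := (@total_variation R).

(** The interval is cut into [N] pieces shorter than the [d] that belongs to the bound 1; each piece
    contributes variation at most 1. *)
Lemma gAC_bounded_variation a b p : a <= b -> gAC p -> bounded_variation a b p.
Proof.
move=> ab acp; have [d d0 H] := gAC_total_variation acp ltr01.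
pose N := (Num.truncn ((b - a) / d)).+1.
have Nd : (b - a) / N%:R < d.
  by rewrite ltr_pdivrMr ?ltr0n// mulrC -ltr_pdivrMr// truncnS_gt.
pose c k : R := a + k%:R * ((b - a) / N%:R).
have h0 : 0 <= (b - a) / N%:R by rewrite divr_ge0// subr_ge0.
have cS k : c k.+1 - c k = (b - a) / N%:R.
  by rewrite /c -[k.+1]addn1 natrD; ring.
have cle k : c k <= c k.+1 by rewrite -subr_ge0 cS.
have ca k : a <= c k by rewrite /c lerDl mulr_ge0.
have cN : c N = b by rewrite /c mulrCA mulfV ?mulr1 ?pnatr_eq0//; ring.
have tv k : (TV a (c k) p <= k%:R%:E)%E.
  elim: k => [|k ih]; first by rewrite /c mul0r addr0 total_variationxx.
  rewrite (total_variationD p (ca k) (cle k)) -natr1 EFinD.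
  apply: leeD => //.
  have := H unit (fun=> c k) (fun=> c k.+1).
  rewrite !big_const !card_unit /= addr0 adde0 cS; apply.
  - by split=> // -[] [].
  - exact: Nd.
apply/bounded_variationP => //; rewrite ge0_fin_numE ?total_variation_ge0//.
by rewrite -cN (le_lt_trans (tv N))// ltry.
Qed.

(** The increasing part of the Jordan decomposition of [p] on [[a, b]], continued by constants. *)
Definition variation_fun a b p (x : R) : R := fine (TV a (clamp a b x) p).

Lemma variation_funB a b p s t : a <= b -> gAC p -> s <= t ->
  (variation_fun a b p t - variation_fun a b p s)%:E =
  TV (clamp a b s) (clamp a b t) p.
Proof.
move=> ab acp st; have [as_ sb] := andP (clamp_in s ab).
have [at_ tb] := andP (clamp_in t ab).
have fin u : a <= u -> TV a u p \is a fin_num.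
  by move=> au; apply/bounded_variationP => //; exact: gAC_bounded_variation.
rewrite EFinB /variation_fun !fineK ?fin//.
rewrite (total_variationD p as_ (le_clamp ab st)) addeAC subee ?add0e// fin//.
Qed.

Lemma variation_fun_nd a b p s t : a <= b -> gAC p -> s <= t ->
  `|p (clamp a b t) - p (clamp a b s)| <= variation_fun a b p t - variation_fun a b p s.
Proof.
move=> ab acp st; rewrite -lee_fin variation_funB//.
by apply: total_variation_ge; exact: le_clamp.
Qed.

Lemma gAC_variation_fun a b p : a <= b -> gAC p -> gAC (variation_fun a b p).
Proof.
(* Half of [e], because the bound on the variations is not strict. *)
move=> ab acp e e0; have [|d d0 H] := gAC_total_variation acp (_ : 0 < e / 2); first lra.
exists d => // I s t st std.
have st' := nonoverlapping_clamp ab st.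
have h i : (`|variation_fun a b p (t i) - variation_fun a b p (s i)|%:E =
    TV (clamp a b (s i)) (clamp a b (t i)) p)%E.
  rewrite -variation_funB ?st.1// ger0_norm//.
  by apply: le_trans (variation_fun_nd _ _ _); rewrite ?st.1.
have := H _ _ _ st'; rewrite /= => h'.
rewrite -lte_fin -sumEFin; under eq_bigr => i _ do rewrite h.
apply: (@le_lt_trans _ _ (e / 2)%:E); last by rewrite lte_fin; lra.
apply: h'; apply: le_lt_trans std; apply: ler_sum => i _.
by apply: clamp_lip => //; exact: st.1.
Qed.

(** This links the two descriptions of a finite union: the sets of the ring generated by half-open
    intervals, where measures are computed, and the families of endpoints on which absolute
    continuity is stated. *)
Lemma finite_ocitv_family (B : set (set R)) :
  finite_set B -> (forall X, X \in B -> ocitv X) -> (forall X, B X -> X !=set0) ->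
  trivIset B id ->
  exists (I : finType) (s t : I -> R),
    nonoverlapping s t /\
    (forall mu : {measure set (measurableTypeR R) -> \bar R},
       mu (\bigcup_(X in B) X) = \sum_i mu `]s i, t i]%classic)%E.
Proof.
move=> /finite_fsetP[F ->] oc ne triv.
have : forall X : fset_sub_type F, exists x : R * R, x.1 < x.2 /\ val X = `]x.1, x.2]%classic.
  move=> X; have /ocitvP[X0|[x x12 ->]] := oc (val X) (mem_set (fsvalP X)).
    by case: (ne _ (fsvalP X)) => y; rewrite -[fsval X]/(val X) X0.
  by exists x.
move=> /choice[x] /all_and2[x12 xE].
exists (fset_sub_type F), (fun X => (x X).1), (fun X => (x X).2); split; [split|].
- by move=> X; rewrite ltW.
- move=> X Y XY; apply: contrapT => /not_orP[/negP h1 /negP h2].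
  move: h1 h2; rewrite -!ltNge => h1 h2.
  have : val X = val Y.
    apply: (triv _ _ (fsvalP X) (fsvalP Y)) => /=.
    (* Two overlapping half-open intervals share the smaller of their right endpoints. *)
    rewrite !xE; exists (Num.min (x X).2 (x Y).2) => /=.
    by rewrite !in_itv/= !lt_min !ge_min !lexx !x12 h1 h2 orbT.
  by move=> /val_inj XYE; rewrite XYE eqxx in XY.
move=> mu; transitivity (mu (\big[setU/set0]_(X <- F) X)); first by rewrite bigcup_fset.
rewrite (measure_fbigsetU mu (F := id))//.
  rewrite big_seq_fsetE/=; apply: eq_bigr => X _; congr (mu _); exact: xE.
by move=> X XF; have /ocitvP[->|[y _ ->]]// := oc X (mem_set XF).
Qed.

End BoundedVariation.

(** * Absolute continuity of the Stieltjes measure *)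

Section Domination.
Context {R : realType}.

Lemma lebesgue_stieltjes_ocitv (V : cumulative R R) (x y : R) : x <= y ->
  lebesgue_stieltjes_measure V `]x, y]%classic = (V y - V x)%:E.
Proof.
move=> xy; rewrite /lebesgue_stieltjes_measure /measure_extension.
by rewrite measurable_mu_extE/=; [rewrite wlength_itv_bnd|exact: is_ocitv].
Qed.

Lemma gAC_finite_union (V : cumulative R R) (e d : R) :
  (forall (I : finType) (s t : I -> R), nonoverlapping s t ->
    \sum_i (t i - s i) < d -> \sum_i `|V (t i) - V (s i)| < e) ->
  forall (A : nat -> set R) m, (forall k, ocitv (A k)) ->
  (lebesgue_measure (\big[setU/set0]_(k < m) A k) < d%:E)%E ->
  (lebesgue_stieltjes_measure V (\big[setU/set0]_(k < m) A k) <= e%:E)%E.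
Proof.
move=> H A m oc.
have mU : measurable (\big[setU/set0]_(k < m) A k : set (SetRing.type (ocitv_type R))).
  by apply: bigsetU_measurable => k _; apply: SetRing.measurable_subring; exact: oc.
(* The intervals [A k] may overlap; their union is rewritten as a disjoint union of half-open
   intervals. *)
have [B [finB neB trivB mB ->]] := SetRing.ring_finite_set mU.
have [I [s [t [st muE]]]] := finite_ocitv_family finB mB neB trivB.
rewrite !muE.
have -> : (\sum_i lebesgue_measure `]s i, t i]%classic = (\sum_i (t i - s i))%:E)%E.
  rewrite -sumEFin; apply: eq_bigr => i _.
  exact: (lebesgue_stieltjes_ocitv _ (st.1 i)).
rewrite lte_fin => /(H _ _ _ st) h.
rewrite (eq_bigr (fun i => (V (t i) - V (s i))%:E)); last first.
  by move=> i _; exact: (lebesgue_stieltjes_ocitv _ (st.1 i)).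
rewrite sumEFin lee_fin; apply: le_trans (ltW h); apply: ler_sum => i _.
exact: ler_norm.
Qed.

(** A null set is covered by countably many half-open intervals of total length below [d]. Every
    finite partial union has Stieltjes measure at most [e], and continuity from below extends this
    to the whole cover. *)
Lemma gAC_dominates (V : cumulative R R) : gAC V ->
  content_dominates (@lebesgue_measure R) (lebesgue_stieltjes_measure V).
Proof.
move=> acV N mN N0; apply/eqP; rewrite eq_le measure_ge0 andbT.
apply/lee_addgt0Pr => e e0; rewrite add0e.
have [d d0 H] := acV e e0.
have : (lebesgue_measure N < d%:E)%E by rewrite N0 lte_fin.
move=> /ereal_inf_lt[_ [A [mA NA] <-] Ad].
pose mu : {measure set (measurableTypeR R) -> \bar R} := lebesgue_stieltjes_measure V.
pose U (m : nat) : set (measurableTypeR R) := \big[setU/set0]_(k < m.+1) A k.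
have mU m : measurable (U m).
  by apply: bigsetU_measurable => k _; apply: sub_sigma_algebra; exact: mA.
have cv : mu (U m) @[m --> \oo] --> mu (\bigcup_m U m).
  apply: nondecreasing_cvg_mu => //; first exact: bigcup_measurable.
  by move=> m n mn; apply/subsetPset; exact: subset_bigsetU.
apply: (@le_trans _ _ (mu (\bigcup_m U m))).
  apply: le_measure; rewrite ?inE//; first exact: bigcup_measurable.
  by rewrite /U bigcup_bigsetU_bigcup.
rewrite -(cvg_lim (@ereal_hausdorff R) cv); apply: lime_le; first by apply/cvg_ex; eexists; exact: cv.
apply: nearW => m /=; apply: (gAC_finite_union H) => //.
apply: le_lt_trans Ad.
have mA' k : measurable (A k : set (measurableTypeR R)).
  by apply: sub_sigma_algebra; exact: mA.
apply: le_trans (_ : \sum_(k < m.+1) lebesgue_measure (A k) <= _)%E.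
  by apply: (Boole_inequality (@lebesgue_measure R)) => k _; exact: mA'.
have -> : (\sum_(k < m.+1) lebesgue_measure (A k) = \sum_(0 <= k < m.+1) wlength idfun (A k))%E.
  rewrite big_mkord; apply: eq_bigr => k _.
  by rewrite /lebesgue_measure /lebesgue_stieltjes_measure /measure_extension measurable_mu_extE//; exact: mA.
exact: nneseries_lim_ge.
Qed.

Lemma gAC_density (V : R -> R) : nondecreasing V -> gAC V -> forall a b : R, a <= b ->
  exists d : R -> R, [/\ forall x, 0 <= d x,
    (@lebesgue_measure R).-integrable setT (EFin \o d) &
    forall x y, a <= x -> x <= y -> y <= b ->
      ((V y - V x)%:E = \int[lebesgue_measure]_(z in `]x, y]%classic) (d z)%:E)%E].
Proof.
move=> nd ac a b ab.
have rc : right_continuous V by apply: right_continuousW; exact: gAC_continuous.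
pose Vc : cumulative R R := HB.pack V (isCumulative.Build R _ R V nd rc).
have mab : measurable (`]a, b]%classic : set (measurableTypeR R)) by exact: measurable_itv.
have muab : (lebesgue_stieltjes_measure Vc `]a, b]%classic < +oo)%E.
  by apply: le_lt_trans (ltry (V b - V a)); rewrite -(lebesgue_stieltjes_ocitv Vc ab).
(* Restricting to []a, b]] makes the Stieltjes measure finite, as the Radon-Nikodym theorem
   requires. *)
pose nu : {finite_measure set (measurableTypeR R) -> \bar R} := mfrestr mab muab.
have dom : nu `<< (@lebesgue_measure R).
  apply/null_content_dominatesP => N mN N0.
  apply: (@gAC_dominates Vc ac); first exact: measurableI.
  by apply: (subset_measure0 _ _ _ N0) => //; exact: measurableI.
have [d [d0 dfin dint dE]] := radon_nikodym_sigma_finite dom.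
have fE : EFin \o (fine \o d) = d by apply/funext => z /=; rewrite fineK.
exists (fine \o d); split => [x||x y ax xy yb].
- by rewrite /= fine_ge0.
- by rewrite fE.
under eq_integral => z _ do rewrite -[(_)%:E]/((EFin \o (fine \o d)) z) fE.
rewrite -dE ; last exact: measurable_itv.
rewrite /nu /= /mfrestr /mrestr setIidl; last by apply: subset_itv; rewrite bnd_simp.
by rewrite -(lebesgue_stieltjes_ocitv Vc xy).
Qed.

End Domination.

(** * Increments of absolutely continuous functions as integrals *)

Section FundamentalTheorem.
Context {R : realType}.
Notation mu := (@lebesgue_measure R).

(** [P] is the difference of [V] and [V - P], both nondecreasing and absolutely continuous; their
    densities are subtracted. *)
Lemma gAC_integral (P : R -> R) (a b : R) : a <= b -> gAC P ->
  (forall x, P (clamp a b x) = P x) ->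
  exists D : R -> R, mu.-integrable setT (EFin \o D) /\
    forall x y, a <= x -> x <= y -> y <= b ->
      ((P y - P x)%:E = \int[mu]_(z in `]x, y]%classic) (D z)%:E)%E.
Proof.
move=> ab acP Pcl.
pose V := variation_fun a b P.
have acV : gAC V := gAC_variation_fun ab acP.
have ndV : nondecreasing V.
  move=> x y xy; rewrite -subr_ge0.
  by apply: le_trans (variation_fun_nd ab acP xy).
have ndW : nondecreasing (V \- P).
  move=> x y xy /=; have := variation_fun_nd ab acP xy.
  rewrite !Pcl -/V => h; have := ler_norm (P y - P x); lra.
have [d1 [_ int1 E1]] := gAC_density ndV acV ab.
have [d2 [_ int2 E2]] := gAC_density ndW (gACB acV acP) ab.
exists (d1 \- d2); split; first exact: (integrableB measurableT int1 int2).
move=> x y ax xy yb; under eq_integral => z _ do rewrite /= EFinB.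
rewrite integralB; [|exact: measurable_itv| |]; last 2 first.
- by apply: (integrableS measurableT) int1 => //; exact: measurable_itv.
- by apply: (integrableS measurableT) int2 => //; exact: measurable_itv.
by rewrite -E1// -E2// -EFinB /=; congr (_%:E); ring.
Qed.

(** By Lebesgue differentiation the density [D] is the derivative of [p] almost everywhere. A bound
    on the derivative at the points where it exists is therefore enough, which suits a highest
    derivative that is only absolutely continuous. *)
Lemma gAC_le_integral (p G : R -> R) (a b : R) : a < b -> gAC (p \o clamp a b) ->
  measurable_fun `]a, b[ G -> (forall x, 0 <= G x) ->
  (forall x, a < x < b -> derivable p x 1 -> `|derive1 p x| <= G x) ->
  (`|p b - p a|%:E <= \int[mu]_(x in `]a, b[%classic) (G x)%:E)%E.
Proof.
move=> ab acp mG G0 pG; have leab := ltW ab.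
have [|D [iD DE]] := gAC_integral leab acp.
  by move=> x /=; rewrite [clamp a b (clamp _ _ _)]clamp_id// clamp_in.
have ftc := @FTC1 R D (BRight a) _ _.
have : {ae mu, forall x, a < x < b -> `|D x| <= G x}.
  have /ftc := open_integrable_locally openT iD.
  have iDy y : mu.-integrable `]a, y] (EFin \o D).
    by apply: (integrableS measurableT) iD => //; exact: measurable_itv.
  move=> /(_ iDy).
  apply: filterS; first exact: (ae_filter_ringOfSetsType mu).
  move=> x + /andP[ax xb]; move=> /(_ ax)[dF FD].
  have pF : \forall y \near x, p y = p a + (\int[mu]_(t in `]a, y]) D t)%R.
    near=> y; have ya : a < y by near: y; exact: lt_nbhsr.
    have yb : y < b by near: y; exact: lt_nbhsl.
    have := DE a y (lexx _) (ltW ya) (ltW yb).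
    rewrite /= !clamp_id ?lexx ?ltW// /Rintegral => <- /=; ring.
  have dF1 : is_derive x 1 (fun y => \int[mu]_(t in `]a, y]) D t)%R (D x).
    by split; [exact: dF|rewrite -derive1E; exact: FD].
  have dF2 := is_deriveD (is_derive_cst (p a) x 1) dF1.
  have pF' : \near x, (cst (p a) + (fun y => \int[mu]_(t in `]a, y]) D t)%R) x = p x.
    by apply: filterS pF => y ->.
  have dp : derivable p x 1 := near_eq_derivable pF' (@ex_derive _ _ _ _ _ _ _ dF2).
  have <- : derive1 p x = D x.
    by rewrite derive1E -(near_eq_derive _ pF') (@derive_val _ _ _ _ _ _ _ dF2) add0r.
  by apply: pG => //; rewrite ax xb.
move=> DG; have /integrableP[mD _] := iD.
have := DE a b (lexx _) leab (lexx _); rewrite /= !clamp_id ?lexx ?leab//.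
rewrite -integral_itv_bndo_bndc; last by apply: measurable_funS mD.
move=> pE; rewrite -abse_EFin pE.
apply: le_trans (le_abse_integral _ _ _) _; first exact: measurable_itv.
  by apply: measurable_funS mD.
apply: ae_ge0_le_integral => //.
- apply/measurable_EFinP; apply: measurableT_comp; first exact: normr_measurable.
  by apply/measurable_EFinP; apply: measurable_funS mD.
- by move=> x _; rewrite lee_fin.
- by apply/measurable_EFinP.
Unshelve. all: by end_near. Qed.

End FundamentalTheorem.

(** * Derivatives and orders of growth at an endpoint *)

Section RealDerivatives.
Context {R : realType}.
Implicit Types f g : R -> R.

Lemma near_eq_deriv f g (x : R) : (\forall y \near x, f y = g y) ->
  (derivable g x 1 -> derivable f x 1) /\ derive1 f x = derive1 g x.
Proof.
move=> fg; split; last by rewrite !derive1E; exact: near_eq_derive.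
by apply: near_eq_derivable; apply: filterS fg => y ->.
Qed.

Lemma is_derive_derive1 f (x l : R) : is_derive x 1 f l ->
  derivable f x 1 /\ derive1 f x = l.
Proof. by move=> [df <-]; rewrite derive1E. Qed.

Lemma derivable_is_derive f (x : R) : derivable f x 1 -> is_derive x 1 f (derive1 f x).
Proof. by move=> df; split=> //; rewrite derive1E. Qed.

Lemma derive1D f g (x : R) : derivable f x 1 -> derivable g x 1 ->
  derivable (fun y => f y + g y) x 1 /\
  derive1 (fun y => f y + g y) x = derive1 f x + derive1 g x.
Proof.
move=> /derivable_is_derive df /derivable_is_derive dg.
exact: is_derive_derive1 (is_deriveD df dg).
Qed.

Lemma derive1M f g (x : R) : derivable f x 1 -> derivable g x 1 ->
  derivable (fun y => f y * g y) x 1 /\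
  derive1 (fun y => f y * g y) x = derive1 f x * g x + f x * derive1 g x.
Proof.
move=> /derivable_is_derive df /derivable_is_derive dg.
have [d1 ->] := is_derive_derive1 (is_deriveM df dg); split=> //.
by rewrite /GRing.scale /= addrC mulrC.
Qed.

Lemma derivable_derive1_cst (c x : R) : derivable (fun=> c) x 1 /\ derive1 (fun=> c) x = 0.
Proof. exact: is_derive_derive1 (is_derive_cst c x 1). Qed.

Lemma derive1Z (c : R) f (x : R) : derivable f x 1 ->
  derivable (fun y => c * f y) x 1 /\ derive1 (fun y => c * f y) x = c * derive1 f x.
Proof.
have [d1 e1] := derivable_derive1_cst c x.
by move=> df; have [d ->] := derive1M d1 df; rewrite e1 mul0r add0r.
Qed.

Lemma derive1_affine (c k x : R) :
  derivable (fun y => c + k * y) x 1 /\ derive1 (fun y => c + k * y) x = k.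
Proof.
have [d2 e2] := derive1Z k (@derivable_id _ _ x 1).
have [d1 e1] := derivable_derive1_cst c x.
have [d ->] := derive1D d1 d2; split => //.
by rewrite e1 e2 derive1E derive_id mulr1 add0r.
Qed.

Lemma derive1_affine_powR (c k a x : R) : 0 < c + k * x ->
  derivable (fun y => (c + k * y) `^ a) x 1 /\
  derive1 (fun y => (c + k * y) `^ a) x = k * a * (c + k * x) `^ (a - 1).
Proof.
move=> x0; have [d1 e1] := derive1_affine c k x.
have dp := is_derive1_powR a x0.
have [d ->] := is_derive_derive1 (@is_derive1_comp R (@powR R ^~ a) (fun y => c + k * y) _ _ _ dp (derivable_is_derive d1)).
by split=> //; rewrite e1; ring.
Qed.

Lemma derive1_MVT f (u v : R) : u <= v -> (forall z, u <= z <= v -> derivable f z 1) ->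
  exists2 z, u <= z <= v & f v - f u = derive1 f z * (v - u).
Proof.
move=> uv df.
have df' z : z \in `[u, v] -> derivable f z 1 by rewrite in_itv /=; exact: df.
have [z zuv fE] := MVT_segment uv
  (fun z zuv => derivable_is_derive (df' z (subset_itv_oo_cc zuv)))
  (derivable_within_continuous df').
by exists z => //; move: zuv; rewrite in_itv.
Qed.

End RealDerivatives.

(** * One-sided neighbourhoods of an endpoint *)

Section EndpointFilter.
Context {R : realType}.
Variable s : endpoint.

(** The shape [1 + k * x], shared with [ecodist], the distance to the other endpoint, lets
    [derive1_affine_powR] apply to powers of both by conversion. *)
Definition edist (x : R) : R := 1 + (- endval s) * x.

Definition ecodist (x : R) : R := 1 + endval s * x.

Lemma edistE (x : R) : edist x = 1 - endval s * x.
Proof. by rewrite /edist mulNr. Qed.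

Lemma ecodistE (x : R) : ecodist x = 2 - edist x.
Proof. by rewrite /ecodist /edist; ring. Qed.

Lemma endval_sqr : endval s * endval s = 1 :> R.
Proof. by case: s => /=; ring. Qed.

Lemma endval_neq0 : endval s != 0 :> R.
Proof. by case: s; rewrite /= ?oppr_eq0 oner_eq0. Qed.

Lemma edist_itv (x : R) : (0 < edist x < 2) = (-1 < x < 1).
Proof. by rewrite /edist; case: s => /=; apply/idP/idP; lra. Qed.

#[global] Instance at_end_proper : ProperFilter (at_end s : set_system R).
Proof. by case: s => /=; exact: _. Qed.

(** A common description of the two one-sided filters, after which one argument serves both
    endpoints. *)
Lemma near_endP (P : R -> Prop) :
  (\forall x \near at_end s, P x) <-> exists2 d : R, 0 < d & forall x, 0 < edist x < d -> P x.
Proof.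
rewrite /edist; case: s => /=; split.
- move=> [d /= d0 h]; exists d => // x xd; apply: h; last by lra.
  by rewrite /= ltr_norml; lra.
- move=> [d d0 h]; exists d => // x /=; rewrite ltr_norml => xd x1; apply: h.
  lra.
- move=> [d /= d0 h]; exists d => // x xd; apply: h; last by lra.
  by rewrite /= ltr_norml; lra.
- move=> [d d0 h]; exists d => // x /=; rewrite ltr_norml => xd x1; apply: h.
  lra.
Qed.

Lemma near_end_lt (d : R) : 0 < d -> \forall x \near at_end s, 0 < edist x < d.
Proof. by move=> d0; apply/near_endP; exists d. Qed.

Lemma near_end_itv : \forall x \near (at_end s : set_system R), -1 < x < 1.
Proof.
have h : (0 : R) < 2 by lra.
by apply: filterS (near_end_lt h) => x; rewrite edist_itv.
Qed.

Lemma edist_near (x : R) (a b : R) : a < edist x < b -> \forall y \near x, a < edist y < b.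
Proof.
move=> xab; pose d := Num.min (edist x - a) (b - edist x).
have d0 : 0 < d by rewrite lt_min; lra.
exists d => // y; rewrite /ball_ /= lt_min !ltr_norml /edist; move: xab.
by rewrite /edist; case: s => /=; lra.
Qed.

(** An identity valid near the endpoint thus holds in a full neighbourhood of each nearby point and
    may be differentiated there. *)
Lemma near_end_open (P : R -> Prop) : (\forall x \near at_end s, P x) ->
  \forall x \near at_end s, \forall y \near x, P y.
Proof.
move=> /near_endP[d d0 h]; apply/near_endP; exists d => // x xd.
by apply: filterS (edist_near xd) => y; exact: h.
Qed.

Lemma near_end_deriv (f g : R -> R) : (\forall x \near at_end s, f x = g x) ->
  \forall x \near at_end s, (derivable g x 1 -> derivable f x 1) /\ derive1 f x = derive1 g x.
Proof. by move=> /near_end_open; apply: filterS => x; exact: near_eq_deriv. Qed.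

End EndpointFilter.

Section SymbolClasses.
Context {R : realType}.
Variable s : endpoint.
Implicit Types (f g : R -> R) (r a b C : R).
Notation tt := (@edist R s).

Definition bigO r f := exists C, \forall x \near at_end s, `|f x| <= C * tt x `^ r.

(* [cls d N r f]: f^(k) = O(t^(r - d k)) for k <= N; d = 1 describes multiples of
   powers of t, and d = 0 factors that are smooth up to the endpoint. *)
Fixpoint cls (d : R) (N : nat) r f : Prop := bigO r f /\
  match N with
  | 0 => True
  | N'.+1 => (\forall x \near at_end s, derivable f x 1) /\ cls d N' (r - d) (derive1 f)
  end.

Lemma bigO_ge0 r f : bigO r f -> exists2 C, 0 <= C & \forall x \near at_end s, `|f x| <= C * tt x `^ r.
Proof.
move=> [C h]; exists `|C| => //; apply: filterS h => x /le_trans; apply.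
by rewrite ler_wpM2r ?powR_ge0 ?ler_norm.
Qed.

Lemma near_powR_le a b : a <= b -> \forall x \near at_end s, tt x `^ b <= tt x `^ a.
Proof.
move=> ab; apply: filterS (near_end_lt s (ltr01 : 0 < 1 :> R)) => x x01.
by apply: ger_powR => //; lra.
Qed.

Lemma bigO_le a b f : a <= b -> bigO b f -> bigO a f.
Proof.
move=> ab /bigO_ge0[C C0 h]; exists C; apply: filterS2 h (near_powR_le ab) => x h1 h2.
by apply: (le_trans h1); rewrite ler_wpM2l.
Qed.

Lemma bigO_ext r f g : (\forall x \near at_end s, f x = g x) -> bigO r g -> bigO r f.
Proof. by move=> fg [C h]; exists C; apply: filterS2 fg h => x ->. Qed.

Lemma bigOD r f g : bigO r f -> bigO r g -> bigO r (fun x => f x + g x).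
Proof.
move=> [C hC] [D hD]; exists (C + D); apply: filterS2 hC hD => x h1 h2.
by rewrite mulrDl (le_trans (ler_normD _ _))// lerD.
Qed.

Lemma powRDt (x : R) a b : 0 < x -> x `^ (a + b) = x `^ a * x `^ b.
Proof. by move=> x0; rewrite powRD// (gt_eqF x0) implybT. Qed.

Lemma bigOM a b f g : bigO a f -> bigO b g -> bigO (a + b) (fun x => f x * g x).
Proof.
move=> [C hC] [D hD]; exists (C * D).
apply: filterS3 hC hD (near_end_lt s (ltr01 : 0 < 1 :> R)) => x h1 h2 /andP[x0 _].
by rewrite powRDt// mulrACA normrM ler_pM.
Qed.

Lemma bigO_tt a : bigO a (fun x => tt x `^ a).
Proof. by exists 1; near=> x; rewrite mul1r ger0_norm ?powR_ge0. Unshelve. all: by end_near. Qed.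

Lemma bigO0 r : bigO r (fun=> 0).
Proof. by exists 0; near=> x; rewrite mul0r normr0. Unshelve. all: by end_near. Qed.

Lemma cls_bigO d N r f : cls d N r f -> bigO r f.
Proof. by case: N => [|N] []. Qed.

Lemma cls_derivable d N r f : cls d N.+1 r f -> \forall x \near at_end s, derivable f x 1.
Proof. by move=> [_ []]. Qed.

Lemma cls_derive1 d N r f : cls d N.+1 r f -> cls d N (r - d) (derive1 f).
Proof. by move=> [_ []]. Qed.

Lemma cls_ext d N r f g : (\forall x \near at_end s, f x = g x) -> cls d N r g -> cls d N r f.
Proof.
elim: N r f g => [|N ih] r f g fg /=; first by move=> [h _]; split=> //; exact: bigO_ext h.
move=> [h [dg cg]]; split; first exact: bigO_ext h.
have fg' := near_end_deriv fg; split; first by apply: filterS2 fg' dg => x [].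
by apply: ih cg; apply: filterS fg' => x [].
Qed.

Lemma cls_le d N a b f : a <= b -> cls d N b f -> cls d N a f.
Proof.
elim: N a b f => [|N ih] a b f ab /= [h]; first by split => //; exact: bigO_le h.
move=> [df cf]; split; first exact: bigO_le h.
by split => //; apply: ih cf; rewrite lerD2r.
Qed.

Lemma clsS d N r f : cls d N.+1 r f -> cls d N r f.
Proof.
elim: N r f => [|N ih] r f [h [df cf]]; first by split.
by split => //; split => //; exact: ih.
Qed.

Lemma clsW d N M r f : (M <= N)%N -> cls d N r f -> cls d M r f.
Proof.
move=> /subnK <-; elim: (N - M)%N => [//|k ih]; rewrite addSn => /clsS; exact: ih.
Qed.

Lemma clsD d N r f g : cls d N r f -> cls d N r g -> cls d N r (fun x => f x + g x).
Proof.
elim: N r f g => [|N ih] r f g /= [hf] => [_ [hg _]|[df cf] [hg [dg cg]]].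
  by split => //; exact: bigOD.
split; first exact: bigOD.
have h : \forall x \near at_end s, derivable (fun x => f x + g x) x 1 /\
    derive1 (fun x => f x + g x) x = derive1 f x + derive1 g x.
  by apply: filterS2 df dg => x; exact: derive1D.
split; first by apply: filterS h => x [].
by apply: cls_ext (ih _ _ _ cf cg); apply: filterS h => x [].
Qed.

Lemma clsM d N a b f g : 0 <= d -> cls d N a f -> cls d N b g ->
  cls d N (a + b) (fun x => f x * g x).
Proof.
move=> d0; elim: N a b f g => [|N ih] a b f g.
  by move=> /= [hf _] [hg _]; split => //; exact: bigOM.
move=> cf cg; have [hf [df df']] := cf; have [hg [dg dg']] := cg.
split; first exact: bigOM.
have h : \forall x \near at_end s, derivable (fun x => f x * g x) x 1 /\
    derive1 (fun x => f x * g x) x = derive1 f x * g x + f x * derive1 g x.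
  by apply: filterS2 df dg => x; exact: derive1M.
split; first by apply: filterS h => x [].
apply: (@cls_ext _ _ _ _ (fun x => derive1 f x * g x + f x * derive1 g x)).
  by apply: filterS h => x [].
apply: clsD.
  by have := ih _ _ _ _ df' (clsS cg); rewrite addrAC.
by have := ih _ _ _ _ (clsS cf) dg'; rewrite addrA.
Qed.

Lemma cls0 d N r : cls d N r (fun=> 0).
Proof.
elim: N r => [|N ih] r; first by split => //; exact: bigO0.
split; first exact: bigO0.
split; first by near=> x; exact: (derivable_derive1_cst 0 x).1.
by apply: cls_ext (ih _); near=> x; exact: (derivable_derive1_cst 0 x).2.
Unshelve. all: by end_near. Qed.

Lemma cls_cst d N c : cls d N 0 (fun=> c).
Proof.
have hb : bigO 0 (fun=> c).
  by exists `|c|; near=> x; rewrite powRr0 mulr1.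
case: N => [|N]; split => //; split; first by near=> x; exact: (derivable_derive1_cst c x).1.
by apply: cls_ext (cls0 _ _ _); near=> x; exact: (derivable_derive1_cst c x).2.
Unshelve. all: by end_near. Qed.

Lemma clsZ d N r c f : 0 <= d -> cls d N r f -> cls d N r (fun x => c * f x).
Proof. by move=> d0 cf; have := clsM d0 (cls_cst d N c) cf; rewrite add0r. Qed.

Lemma clsB d N r f g : 0 <= d -> cls d N r f -> cls d N r g -> cls d N r (fun x => f x - g x).
Proof.
move=> d0 cf cg; have := clsD cf (clsZ (-1) d0 cg).
by apply: cls_ext; near=> x; rewrite mulN1r.
Unshelve. all: by end_near. Qed.

Lemma cls_sum d N r (I : Type) (l : seq I) (f : I -> R -> R) :
  (forall i, cls d N r (f i)) -> cls d N r (fun x => \sum_(i <- l) f i x).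
Proof.
move=> h; elim: l => [|i l ih].
  by apply: cls_ext (cls0 _ _ _); near=> x; rewrite big_nil.
by apply: cls_ext (clsD (h i) ih); near=> x; rewrite big_cons.
Unshelve. all: by end_near. Qed.

Lemma cls_tt N a : cls 1 N a (fun x => tt x `^ a).
Proof.
elim: N a => [|N ih] a; first by split => //; exact: bigO_tt.
split; first exact: bigO_tt.
have h : \forall x \near at_end s, derivable (fun x => tt x `^ a) x 1 /\
    derive1 (fun x => tt x `^ a) x = - endval s * a * tt x `^ (a - 1).
  apply: filterS (near_end_lt s (ltr01 : 0 < 1 :> R)) => x /andP[x0 _].
  exact: derive1_affine_powR.
split; first by apply: filterS h => x [].
apply: cls_ext (clsZ (- endval s * a) ler01 (ih _)).
by apply: filterS h => x [].
Qed.

(** Near the endpoint [ecodist s] lies between 1 and 2, so all derivatives of its powers are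
    bounded. This is the case [d = 0]; larger [d] only weakens the claim. *)
Lemma cls_codist d N c : 0 <= d -> cls d N 0 (fun x => ecodist s x `^ c).
Proof.
move=> d0; have hb b : bigO 0 (fun x => @ecodist R s x `^ b).
  exists (2 `^ `|b|); apply: filterS (near_end_lt s (ltr01 : 0 < 1 :> R)) => x x01.
  rewrite powRr0 mulr1 ger0_norm ?powR_ge0//.
  have x12 : 1 <= ecodist s x <= 2 by rewrite ecodistE; lra.
  apply: (@le_trans _ _ (ecodist s x `^ `|b|)).
    by apply: ler_powR; [lra|exact: ler_norm].
  by apply: ge0_ler_powR => //; rewrite ?nnegrE; lra.
elim: N c => [|N ih] c; split => //.
have h : \forall x \near at_end s, derivable (fun x => @ecodist R s x `^ c) x 1 /\
    derive1 (fun x => @ecodist R s x `^ c) x = endval s * c * ecodist s x `^ (c - 1).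
  apply: filterS (near_end_lt s (ltr01 : 0 < 1 :> R)) => x x01.
  by apply: derive1_affine_powR; rewrite -/(ecodist s x) ecodistE; lra.
split; first by apply: filterS h => x [].
apply: cls_ext (clsZ (endval s * c) d0 (cls_le _ (ih (c - 1)))); last by lra.
by apply: filterS h => x [].
Qed.

Lemma cls_iter d N r f k : (k <= N)%N -> cls d N r f ->
  cls d (N - k) (r - d * k%:R) (iter k (@derive1 R R) f).
Proof.
elim: k N r f => [|k ih] N r f; first by rewrite mulr0 subr0 subn0.
case: N => // N; rewrite ltnS => kN /cls_derive1 /(ih _ _ _ kN).
by rewrite iterSr subSS -natr1; congr cls; ring.
Qed.

Lemma cls_iter_derivable d N r f k : (k < N)%N -> cls d N r f ->
  \forall x \near at_end s, derivable (iter k (@derive1 R R) f) x 1.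
Proof.
move=> kN /(cls_iter (ltnW kN)); have -> : (N - k)%N = (N - k).-1.+1 by rewrite prednK// subn_gt0.
exact: cls_derivable.
Qed.

Lemma bigO_cvg0 r f : 0 < r -> bigO r f -> f x @[x --> at_end s] --> 0.
Proof.
move=> r0 /bigO_ge0[C C0 h]; apply/cvgr0Pnorm_lt => e e0.
have d0 : 0 < (e / (C + 1)) `^ r^-1 by rewrite powR_gt0// divr_gt0//; lra.
apply: filterS2 h (near_end_lt s d0) => x h /andP[x0 xd].
apply: (le_lt_trans h).
have : tt x `^ r < e / (C + 1).
  have /(gt0_ltr_powR r0) : tt x < (e / (C + 1)) `^ r^-1 by [].
  rewrite -powRrM mulVf ?gt_eqF// powRr1; last by rewrite divr_ge0//; lra.
  by apply; rewrite nnegrE ltW.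
rewrite ltr_pdivlMr; last lra.
have := powR_ge0 (tt x) r; nra.
Qed.

End SymbolClasses.

(** * Integration of growth estimates *)

Section Integration.
Context {R : realType}.
Variable s : endpoint.
Notation tt := (@edist R s).

Lemma tt_powR_cvg0 (r : R) : 0 < r -> tt x `^ r @[x --> at_end s] --> 0.
Proof. by move=> r0; apply: (bigO_cvg0 r0); exact: bigO_tt. Qed.

(** The hypothesis is a Cauchy estimate, so the limit [c] exists; letting [y] tend to the endpoint
    keeps the constant [K]. *)
Lemma bigO_cauchy (r K d : R) (f : R -> R) : 0 < r -> 0 < d ->
  (forall x y, 0 < tt y -> tt y <= tt x -> tt x < d -> `|f x - f y| <= K * tt x `^ r) ->
  exists c, bigO s r (fun x => f x - c).
Proof.
move=> r0 d0 H.
have K0 : 0 <= K.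
  have [x /andP[x0 xd]] := filter_ex (near_end_lt s d0).
  have := H x x x0 (lexx _) xd; rewrite subrr normr0.
  by rewrite pmulr_lge0// powR_gt0.
have cv : cvg (f x @[x --> at_end s]).
  apply: cauchy_cvg; apply/cauchyP => e /= e0.
  have h0 : 0 < e / (K + 1) by rewrite divr_gt0//; lra.
  have /cvgr0Pnorm_lt/(_ _ h0) small := tt_powR_cvg0 r0.
  have [x [/andP[x0 xd] hx]] := filter_ex (filterI (near_end_lt s d0) small).
  exists (f x); apply: filterS (near_end_lt s x0) => y /andP[y0 yx].
  rewrite /ball /=; apply: le_lt_trans (H _ _ y0 (ltW yx) xd) _.
  move: hx; rewrite ger0_norm ?powR_ge0// ltr_pdivlMr; last lra.
  have := powR_ge0 (tt x) r; nra.
exists (lim (f x @[x --> at_end s])), K.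
apply: filterS (near_end_lt s d0) => x /andP[x0 xd].
have cv' : `|f x - f y| @[y --> at_end s] --> `|f x - lim (f x @[x --> at_end s])|.
  by apply: cvg_norm; apply: cvgB => //; exact: cvg_cst.
rewrite -(cvg_lim (@Rhausdorff R) cv'); apply: limr_le; first by apply/cvg_ex; eexists; exact: cv'.
by apply: filterS (near_end_lt s x0) => y /andP[y0 yx]; apply: H => //; exact: ltW.
Qed.

(** No integral is involved: [g] is a primitive of [C * tt ^ r], so [g + f] and [g - f] are both
    nondecreasing and the increments of [f] are dominated by those of [g]. The condition on [r]
    makes the exponent of [g] positive. *)
Lemma bigO_primitive (r : R) (f : R -> R) : -1 < r ->
  (\forall x \near at_end s, derivable f x 1) -> bigO s r (derive1 f) ->
  exists c, bigO s (r + 1) (fun x => f x - c).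
Proof.
move=> r1 df /bigO_ge0[C C0 hC].
have [d d0 H] := (near_endP s _).1 (filterI df hC).
pose K := C / (r + 1).
have rp : 0 < r + 1 by lra.
apply: (@bigO_cauchy (r + 1) K d) => // x y y0 yx xd.
have dom z : tt y <= tt z <= tt x -> 0 < tt z < d by lra.
(* The sign [- endval s] makes [g] increasing in [x] at either endpoint. *)
pose g z : R := (- endval s * K) * tt z `^ (r + 1).
have dg z : 0 < tt z -> derivable g z 1 /\ derive1 g z = C * tt z `^ r.
  move=> z0; have [d1 e1] := derive1_affine_powR (r + 1) (z0 : 0 < 1 + (- endval s) * z).
  have [d2 e2] := derive1Z (- endval s * K) d1; split => //.
  rewrite /g /edist e2 e1 addrK.
  have KE : K * (r + 1) = C by rewrite /K divfK// gt_eqF.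
  by rewrite -KE -[in RHS](mul1r K) -(endval_sqr s); ring.
have mono (eta : R) (u v : R) : eta * eta = 1 -> u <= v ->
    (forall z, u <= z <= v -> 0 < tt z < d) -> g u + eta * f u <= g v + eta * f v.
  move=> eta1 uv dz.
  have dh z : u <= z <= v -> derivable (fun z => g z + eta * f z) z 1 /\
      0 <= derive1 (fun z => g z + eta * f z) z.
    move=> /dz zd; have [dgz egz] := dg z ltac:(lra).
    have [dfz bz] := H z zd.
    have [d1 e1] := derive1Z eta dfz.
    have [d2 ->] := derive1D dgz d1; split => //; rewrite egz e1.
    by move: bz; rewrite ler_norml; nra.
  have [z zuv] := derive1_MVT uv (fun z zuv => (dh z zuv).1).
  have [_ hz] := dh z zuv; nra.
have K0 : 0 <= K by rewrite /K divr_ge0// ltW.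
have sq1 : 1 * 1 = 1 :> R by rewrite mulr1.
have sqN1 : (-1) * (-1) = 1 :> R by rewrite mulrNN mulr1.
have hg : `|g x - g y| <= K * tt x `^ (r + 1).
  rewrite /g -mulrBr normrM normrM normrN (ger0_norm K0).
  have -> : `|endval s| = 1 :> R by case: (s); rewrite /= ?normrN normr1.
  have := powR_ge0 (tt y) (r + 1).
  have : tt y `^ (r + 1) <= tt x `^ (r + 1).
    by apply: ge0_ler_powR => //; rewrite ?nnegrE; lra.
  by move=> h1 h2; rewrite mul1r ler_wpM2l// ger0_norm; lra.
apply: le_trans hg; have [xy|/ltW yx'] := leP x y.
- have dz z : x <= z <= y -> 0 < tt z < d.
    by move=> zxy; apply: dom; move: yx; rewrite /edist; case: (s) => /=; lra.
  have h1 := mono 1 x y sq1 xy dz; have h2 := mono (-1) x y sqN1 xy dz.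
  by rewrite distrC [leRHS]distrC; apply: le_trans (ler_norm _); rewrite ler_norml; lra.
- have dz z : y <= z <= x -> 0 < tt z < d.
    by move=> zxy; apply: dom; move: yx; rewrite /edist; case: (s) => /=; lra.
  have h1 := mono 1 y x sq1 yx' dz; have h2 := mono (-1) y x sqN1 yx' dz.
  by apply: le_trans (ler_norm _); rewrite ler_norml; lra.
Qed.

End Integration.

(** * The Jacobi expression near an endpoint *)

Section JacobiEndpoint.
Context {R : realType}.
Variables (alpha beta : R) (s : endpoint).
Notation tt := (@edist R s).
Notation co := (@ecodist R s).
Notation eps := (@endval R s).
Notation gam := (end_exponent alpha beta s).
Notation gam' := (end_exponent alpha beta (opposite s)).
Notation a_ := (jacobi_a alpha beta).
Implicit Types (F G : R -> R) (x : R).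

Lemma jacobi_aE k x : a_ k x = tt x `^ (gam + k%:R) * co x `^ (gam' + k%:R).
Proof.
by rewrite /jacobi_a /edist /ecodist; case: s => /=; rewrite ?opprK ?mulN1r ?mul1r// mulrC.
Qed.

Lemma near_proj2 (P Q : R -> Prop) : (\forall x \near at_end s, P x /\ Q x) ->
  \forall x \near at_end s, Q x.
Proof. by apply: filterS => x []. Qed.

Lemma powR_split (a t : R) : 0 < t -> t `^ a = t * t `^ (a - 1).
Proof.
move=> t0; rewrite -{2}(powRr1 (ltW t0)) -powRDt//; congr powR; ring.
Qed.

Lemma co_near : \forall x \near at_end s, 1 < co x < 2.
Proof. by apply: filterS (near_end_lt s (ltr01 : 0 < 1 :> R)) => x; rewrite ecodistE; lra. Qed.

Lemma co_itv x : -1 < x < 1 -> 0 < tt x /\ 0 < co x.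
Proof. by rewrite -(edist_itv s) ecodistE; lra. Qed.

Lemma jacobi_a_gt0 k x : -1 < x < 1 -> 0 < a_ k x.
Proof. by move=> /co_itv[t0 c0]; rewrite jacobi_aE mulr_gt0// powR_gt0. Qed.

Lemma co_powR_cvg (c : R) : co x `^ c @[x --> at_end s] --> 2 `^ c.
Proof.
have h : co x @[x --> at_end s] --> (2 : R).
  apply/cvgrPdist_lt => e e0; apply: filterS (near_end_lt s e0) => x.
  by rewrite ecodistE opprB addrCA subrr addr0 => /andP[x0 xe]; rewrite gtr0_norm.
have c2 : {for 2, continuous (fun y : R => y `^ c)}.
  have /is_derive_derive1[+ _] := is_derive1_powR c (ltr0Sn R 1).
  by move=> /derivable1_diffP/differentiable_continuous.
exact: continuous_cvg c2 h.
Qed.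

Lemma derive1_tt a x : 0 < tt x -> derivable (fun y => tt y `^ a) x 1 /\
  derive1 (fun y => tt y `^ a) x = - eps * a * tt x `^ (a - 1).
Proof. exact: derive1_affine_powR. Qed.

Lemma derive1_co a x : 0 < co x -> derivable (fun y => co y `^ a) x 1 /\
  derive1 (fun y => co y `^ a) x = eps * a * co x `^ (a - 1).
Proof. exact: derive1_affine_powR. Qed.

(** This allows the factor [co] to be frozen at its endpoint value 2, with an error smaller by one
    power of [tt]. *)
Lemma co_powR_cls N (c : R) : cls s 1 N.+1 1 (fun x => co x `^ c - 2 `^ c).
Proof.
have cc := @cls_codist R s 1 N.+1 c ler01.
(* The class with [d = 0] records that the derivative is bounded; integrating it gives the rate
   1. *)
have cd : cls s 0 1 0 (fun x => co x `^ c) := @cls_codist R s 0 1 c (lexx _).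
have [k hk] : exists k, bigO s 1 (fun x => co x `^ c - k).
  have := @bigO_primitive R s 0 (fun x => co x `^ c).
  rewrite add0r; apply; first by lra.
    exact: cls_derivable cd.
  by have := cls_bigO (cls_derive1 cd); rewrite subr0.
have kE : k = 2 `^ c.
  have h := bigO_cvg0 ltr01 hk.
  have h2 : (co x `^ c - k) @[x --> at_end s] --> 2 `^ c - k.
    by apply: cvgB; [exact: co_powR_cvg|exact: cvg_cst].
  apply/esym/eqP; rewrite -subr_eq0.
  by rewrite -(cvg_lim (@Rhausdorff R) h2) (cvg_lim (@Rhausdorff R) h).
rewrite -kE; split=> //.
have [_ [d1 c1]] := clsB ler01 cc (cls_cst s 1 N.+1 k).
split => //; rewrite subrr.
apply: (@cls_ext _ _ _ _ _ _ (fun x => eps * c * co x `^ (c - 1))).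
  apply: filterS co_near => x x12.
  have [dk ek] := derivable_derive1_cst (- k) x.
  have [|dc ec] := @derive1_co c x; first by lra.
  by have [_ ->] := derive1D dc dk; rewrite ek addr0.
by apply: clsZ => //; exact: cls_codist.
Qed.

Lemma cls_jacobi_a N k : cls s 1 N (gam + k%:R) (a_ k).
Proof.
have := clsM ler01 (@cls_tt R s N (gam + k%:R)) (@cls_codist R s 1 N (gam' + k%:R) ler01).
by rewrite addr0; apply: cls_ext; near=> x; rewrite jacobi_aE.
Unshelve. all: by end_near. Qed.

Lemma derive1_jacobi_a1 x : -1 < x < 1 -> derivable (a_ 1) x 1 /\
  derive1 (a_ 1) x = - eps * ((gam + 1) * co x - (gam' + 1) * tt x) * a_ 0 x.
Proof.
move=> /co_itv[t0 c0].
have [dt et] := derive1_tt (gam + 1) t0.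
have [dc ec] := derive1_co (gam' + 1) c0.
have [d e] := derive1M dt dc.
have aE : a_ 1 = fun y => tt y `^ (gam + 1) * co y `^ (gam' + 1).
  by apply/funext => y; rewrite jacobi_aE.
rewrite aE; split=> //; rewrite jacobi_aE e et ec !addrK !addr0.
rewrite (powRDt gam 1 t0) (powRDt gam' 1 c0) !powRr1 ?ltW//; ring.
Qed.

Definition ellr F x := - (a_ 0 x)^-1 * derive1 (fun y => a_ 1 y * derive1 F y) x.

(** The Jacobi expression with the product rule carried out and the weight cancelled; what remains
    has polynomial coefficients. *)
Definition Lop F x := - (tt x * co x * derive1 (derive1 F) x
  - eps * ((gam + 1) * co x - (gam' + 1) * tt x) * derive1 F x).

Lemma jacobi_a10 x : -1 < x < 1 -> a_ 1 x = tt x * co x * a_ 0 x.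
Proof.
move=> /co_itv[t0 c0]; rewrite !jacobi_aE !addr0.
by rewrite (powRDt gam 1 t0) (powRDt gam' 1 c0) !powRr1 ?ltW//; ring.
Qed.

Lemma derive1_a1F F x : -1 < x < 1 -> derivable (derive1 F) x 1 ->
  derivable (fun y => a_ 1 y * derive1 F y) x 1 /\
  derive1 (fun y => a_ 1 y * derive1 F y) x = - a_ 0 x * Lop F x.
Proof.
move=> x1 dF; have [d1 e1] := derive1_jacobi_a1 x1.
have [d ->] := derive1M d1 dF; split=> //.
by rewrite e1 jacobi_a10// /Lop; ring.
Qed.

Lemma ellrE F x : -1 < x < 1 -> derivable (derive1 F) x 1 -> ellr F x = Lop F x.
Proof.
move=> x1 dF; have [_ e] := derive1_a1F x1 dF.
by rewrite /ellr e mulNr mulNr mulrN opprK mulKf// gt_eqF// jacobi_a_gt0.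
Qed.

Definition nice2 F :=
  (\forall x \near at_end s, derivable F x 1) /\
  (\forall x \near at_end s, derivable (derive1 F) x 1).

Lemma nice2_comb F G c : nice2 F -> nice2 G -> nice2 (fun x => F x + c * G x) /\
  \forall x \near at_end s, derive1 (fun x => F x + c * G x) x = derive1 F x + c * derive1 G x /\
    Lop (fun x => F x + c * G x) x = Lop F x + c * Lop G x.
Proof.
move=> [dF dF'] [dG dG'].
have h1 : \forall x \near at_end s, derivable (fun x => F x + c * G x) x 1 /\
    derive1 (fun x => F x + c * G x) x = derive1 F x + c * derive1 G x.
  apply: filterS2 dF dG => x dF dG; have [d1 e1] := derive1Z c dG.
  by have [d2 ->] := derive1D dF d1; rewrite e1.
have h2 : \forall x \near at_end s, derivable (fun x => derive1 F x + c * derive1 G x) x 1 /\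
    derive1 (fun x => derive1 F x + c * derive1 G x) x = derive1 (derive1 F) x + c * derive1 (derive1 G) x.
  apply: filterS2 dF' dG' => x dF2 dG2; have [d1 e1] := derive1Z c dG2.
  by have [d2 ->] := derive1D dF2 d1; rewrite e1.
have h3 := near_end_deriv (near_proj2 h1).
split; first split.
- by apply: filterS h1 => x [].
- by apply: filterS2 h2 h3 => x [d _] [h _]; exact: h.
- apply: filterS3 h1 h2 h3 => x [_ e1] [_ e2] [_ e3]; split => //.
  rewrite /Lop e3 e2 e1.
  move: (derive1 (derive1 F) x) (derive1 (derive1 G) x) (derive1 F x) (derive1 G x).
  by move: (tt x) (co x) eps gam gam' => *; ring.
Qed.

(** The image of [tt ^ a] under [Lop]. Its lowest coefficient [-2 * a * (a + gam)] is the indicial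
    polynomial, with roots 0 and [- gam]. *)
Definition Jop (a : R) x :=
  - a * (2 * (a + gam) * tt x `^ (a - 1) - (a + gam + gam' + 1) * tt x `^ a).

Lemma near_derive1_tt a : \forall x \near at_end s,
  derivable (fun y => tt y `^ a) x 1 /\
  derive1 (fun y => tt y `^ a) x = - eps * a * tt x `^ (a - 1).
Proof.
by apply: filterS (near_end_lt s (ltr01 : 0 < 1 :> R)) => x /andP[x0 _]; exact: derive1_tt.
Qed.

Lemma Lop_tt a : nice2 (fun x => tt x `^ a) /\
  \forall x \near at_end s, Lop (fun x => tt x `^ a) x = Jop a x.
Proof.
have h1 := near_derive1_tt a; have h2 := near_derive1_tt (a - 1).
have h3 := near_end_deriv (near_proj2 h1).
split; first split.
- by apply: filterS h1 => x [].
- apply: filterS2 h2 h3 => x [d _] [h _]; apply: h; exact: (derive1Z _ d).1.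
- apply: filterS3 h1 h3 (near_end_lt s (ltr01 : 0 < 1 :> R)) => x [_ e1] [_ e3] /andP[t0 _].
  have [d2 e2] := derive1_tt (a - 1) t0.
  rewrite /Lop e3 e1 (derive1Z _ d2).2 e2 /Jop ecodistE.
  rewrite (powR_split a t0) (powR_split (a - 1) t0).
  move: (endval_sqr s : eps * eps = 1); move: (tt x `^ (a - 1 - 1)).
  by move: (tt x) eps gam gam' => t ep g g' P ep1; ring: ep1.
Qed.

End JacobiEndpoint.

(** * Expansions in the exponents [expo] *)

Section Structure.
Context {R : realType}.
Variables (alpha beta : R) (s : endpoint).
Notation tt := (@edist R s).
Notation gam := (end_exponent alpha beta s).
Notation gam' := (end_exponent alpha beta (opposite s)).
Notation Jop := (Jop alpha beta s).
Implicit Types (F G : R -> R) (x : R).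
Hypothesis gam01 : 0 < gam < 1.

(* The exponents 0, -gam, 1, 1 - gam, 2, 2 - gam, ... of the solutions of [ell^n f = 0] at the endpoint. *)
Definition expo (i : nat) : R := (i./2)%:R - (if odd i then gam else 0).

Lemma expoE i : expo i = (i./2)%:R - (if odd i then gam else 0).
Proof. by []. Qed.

Lemma expoSS i : expo i.+2 = expo i + 1.
Proof. by rewrite /expo /= negbK -natr1; ring. Qed.

Lemma expo_ge i : - gam <= expo i.
Proof.
rewrite /expo; have : 0 <= (i./2)%:R :> R by [].
by move: gam gam01 => g g01; case: odd; lra.
Qed.

Lemma expo_ge_half m i : (2 * m <= i)%N -> m%:R - gam <= expo i.
Proof.
move=> mi; have : m%:R <= (i./2)%:R :> R by rewrite ler_nat; lia.
by rewrite /expo; move: gam gam01 => g g01; case: odd; lra.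
Qed.

(* [ell F] in L^2 gives [a_1 F' = O(t^((gam + 1) / 2))], whence exponent [rho 1]
   after one more integration. *)
Definition rho (m : nat) : R := m%:R - 1 / 2 - gam / 2.

Lemma rhoS m : rho m.+1 = rho m + 1.
Proof. by rewrite /rho -natr1; ring. Qed.

Lemma rho_le m i : (2 * m <= i)%N -> rho m <= expo i.
Proof. by move=> /expo_ge_half; rewrite /rho; move: gam gam01 (expo i) => g g01 e; lra. Qed.

Definition asym m F := exists c : nat -> R,
  cls s 1 (2 * m).-1 (rho m) (fun x => F x - \sum_(i < 2 * m) c i * tt x `^ expo i).

(** Up to a remainder, [G] is the image under [Lop] of a combination of powers; subtracting that
    combination from a solution of [Lop F = G] leaves a right-hand side that is a remainder. The
    indices start at 2 because [expo 0] and [expo 1] are the indicial roots. *)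
Definition reducible m G := exists b : nat -> R,
  cls s 1 (2 * m).-1 (rho m) (fun x => G x - \sum_(i < 2 * m) b i * Jop (expo i.+2) x).

Lemma reducible_comb m F G k : reducible m F -> reducible m G ->
  reducible m (fun x => F x + k * G x).
Proof.
move=> [b hb] [c hc]; exists (fun i => b i + k * c i).
apply: cls_ext (clsD hb (clsZ k ler01 hc)); near=> x.
rewrite mulrBr mulr_sumr addrACA -opprD -big_split /=; congr (_ - _).
by apply: eq_bigr => i _; rewrite mulrDl -[k * _ * _]mulrA.
Unshelve. all: by end_near. Qed.

Lemma reducible_rough m G : cls s 1 (2 * m).-1 (rho m) G -> reducible m G.
Proof.
move=> cG; exists (fun=> 0); apply: cls_ext cG; near=> x.
by rewrite big1 ?subr0// => i _; rewrite mul0r.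
Unshelve. all: by end_near. Qed.

Lemma reducible_ext m F G : (\forall x \near at_end s, F x = G x) -> reducible m G -> reducible m F.
Proof. by move=> fg [b hb]; exists b; apply: cls_ext hb; apply: filterS fg => x ->. Qed.

(* [Jop (expo i.+2)] is a nonzero multiple of [tt ^ expo i] plus a multiple of [tt ^ expo i.+2]. *)
Lemma reducible_tt m i : reducible m (fun x => tt x `^ expo i).
Proof.
have [k] := ubnP (2 * m - i)%N; elim: k i => // k ih i ki.
have [mi|im] := leqP (2 * m) i.
  by apply: reducible_rough; apply: cls_le (cls_tt _ _ _); exact: rho_le.
have hi : reducible m (fun x => tt x `^ expo i.+2) by apply: ih; lia.
have hJ : reducible m (Jop (expo i.+2)).
  exists (fun j => (j == i)%:R); apply: cls_ext (cls0 _ _ _ _); near=> x.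
  rewrite (bigD1 (Ordinal im))//= eqxx mul1r big1 ?addr0 ?subrr//.
  by move=> j /eqP/eqP; rewrite -val_eqE /= => /negbTE ->; rewrite mul0r.
have [a aE] : exists a : R, a = expo i.+2 by exists (expo i.+2).
have a0 : a != 0.
  rewrite aE expoSS gt_eqF//; have := expo_ge i.
  by move: gam gam01 (expo i) => g g01 e; lra.
have ag : a + gam != 0.
  rewrite aE expoSS gt_eqF//; have := expo_ge i.
  by move: gam gam01 (expo i) => g g01 e; lra.
have [d dE] : exists d, d * (2 * a * (a + gam)) = -1.
  by exists (- (2 * a * (a + gam))^-1); rewrite mulNr mulVf// !mulf_neq0.
(* [reducible_comb] has coefficient 1 on its first argument, so [d] times [hJ] is obtained as
   [hJ + (d - 1) * hJ]. *)
have := reducible_comb (d * - a * (a + gam + gam' + 1)) (reducible_comb (d - 1) hJ hJ) hi.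
apply: reducible_ext; near=> x; rewrite -aE /Jop.
have -> : tt x `^ expo i = tt x `^ (a - 1) by rewrite aE expoSS addrK.
clear aE hi hJ a0 ag; move: dE; move: (tt x `^ (a - 1)) (tt x `^ a) => P Q; move: a gam gam' => a g g' dE.
by transitivity (- (d * (2 * a * (a + g))) * P); [rewrite dE; ring|ring].
Unshelve. all: by end_near. Qed.

Lemma asym_reducible m G : asym m G -> reducible m G.
Proof.
move=> [c hc].
have h : forall M, reducible m (fun x => \sum_(i < M) c i * tt x `^ expo i).
  elim=> [|M ih].
    by apply: reducible_rough; apply: cls_ext (cls0 _ _ _ _); near=> x; rewrite big_ord0.
  apply: reducible_ext (reducible_comb (c M) ih (reducible_tt m M)).
  by near=> x; rewrite big_ord_recr.
apply: reducible_ext (reducible_comb 1 (reducible_rough hc) (h (2 * m)%N)).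
by near=> x; rewrite mul1r subrK.
Unshelve. all: by end_near. Qed.

Lemma asym_comb m F G k : asym m F -> asym m G -> asym m (fun x => F x + k * G x).
Proof.
move=> [b hb] [c hc]; exists (fun i => b i + k * c i).
apply: cls_ext (clsD hb (clsZ k ler01 hc)); near=> x.
rewrite mulrBr mulr_sumr addrACA -opprD -big_split /=; congr (_ - _).
by apply: eq_bigr => i _; rewrite mulrDl -[k * _ * _]mulrA.
Unshelve. all: by end_near. Qed.

Lemma asym_tt m i : (i < 2 * m)%N -> asym m (fun x => tt x `^ expo i).
Proof.
move=> im; exists (fun j => (j == i)%:R); apply: cls_ext (cls0 _ _ _ _); near=> x.
rewrite (bigD1 (Ordinal im))//= eqxx mul1r big1 ?addr0 ?subrr//.
by move=> j /eqP/eqP; rewrite -val_eqE /= => /negbTE ->; rewrite mul0r.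
Unshelve. all: by end_near. Qed.

Lemma asym_bigO m F : (0 < m)%N -> asym m F -> bigO s (- gam) F.
Proof.
move=> m0 [c /cls_bigO hc].
have rg : - gam <= rho m.
  have : 1 <= m%:R :> R by rewrite ler1n.
  by rewrite /rho; move: gam gam01 m%:R => g g01 M; lra.
have hs : cls s 1 0 (- gam) (fun x => \sum_(i < 2 * m) c i * tt x `^ expo i).
  by apply: cls_sum => i; apply: clsZ => //; apply: cls_le (cls_tt _ _ _); exact: expo_ge.
apply: bigO_ext (bigOD (bigO_le rg hc) (cls_bigO hs)).
by near=> x; rewrite subrK.
Unshelve. all: by end_near. Qed.

End Structure.

(** * Solving [Lop F = G] near the endpoint *)

Section StructureStep.
Context {R : realType}.
Variables (alpha beta : R) (s : endpoint).
Notation tt := (@edist R s).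
Notation co := (@ecodist R s).
Notation eps := (@endval R s).
Notation gam := (end_exponent alpha beta s).
Notation gam' := (end_exponent alpha beta (opposite s)).
Notation a_ := (jacobi_a alpha beta).
Notation Lop := (Lop alpha beta s).
Notation Jop := (Jop alpha beta s).
Notation nice2 := (nice2 s).
Notation expo := (expo alpha beta s).
Notation rho := (rho alpha beta s).
Notation asym := (asym alpha beta s).
Implicit Types (F G : R -> R) (x : R).
Hypothesis gam01 : 0 < gam < 1.

Lemma near_proj1 (P Q : R -> Prop) : (\forall x \near at_end s, P x /\ Q x) ->
  \forall x \near at_end s, P x.
Proof. by apply: filterS => x []. Qed.

Lemma near_and (P Q : R -> Prop) : (\forall x \near at_end s, P x /\ Q x) ->
  (\forall x \near at_end s, P x) /\ (\forall x \near at_end s, Q x).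
Proof. by move=> h; split; [exact: near_proj1 h|exact: near_proj2 h]. Qed.

Lemma near_tt_co : \forall x \near at_end s, 0 < tt x /\ 0 < co x.
Proof. by apply: filterS (near_end_itv s) => x; exact: co_itv. Qed.

Lemma derive1_bigO_weighted F r : bigO s (gam + 1 + r) (fun x => a_ 1 x * derive1 F x) ->
  bigO s r (derive1 F).
Proof.
move=> h.
have h1 := cls_bigO (cls_tt s 0 (- (gam + 1))).
have h2 := cls_bigO (@cls_codist R s 1 0 (- (gam' + 1)) ler01).
have := bigOM (bigOM h1 h2) h.
rewrite addr0 addKr; apply: bigO_ext.
apply: filterS near_tt_co => x [t0 c0]; rewrite (jacobi_aE _ _ s) !powRN.
have := powR_gt0 (gam + 1) t0; have := powR_gt0 (gam' + 1) c0.
move: (tt x `^ (gam + 1)) (co x `^ (gam' + 1)) (derive1 F x) => P Q D Q0 P0.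
by field; rewrite !gt_eqF.
Qed.

Lemma asym_tail m F : (\forall x \near at_end s, derivable F x 1) ->
  bigO s (gam + 1 + rho m) (fun x => a_ 1 x * derive1 F x) ->
  bigO s (rho m) (derive1 F) /\ exists c, bigO s (rho m.+1) (fun x => F x - c).
Proof.
move=> dF /derive1_bigO_weighted h; split => //; rewrite rhoS.
apply: bigO_primitive => //.
(* [rho m > -1] holds also for [m = 0], because [gam < 1]. *)
by rewrite /rho; have : 0 <= m%:R :> R by []; move: gam gam01 m%:R => g g01 M; lra.
Qed.

Lemma derive1_subr F (c : R) : (\forall x \near at_end s, derivable F x 1) ->
  \forall x \near at_end s, derivable (fun x => F x - c) x 1 /\
    derive1 (fun x => F x - c) x = derive1 F x.
Proof.
apply: filterS => x dF; have [dc ec] := derivable_derive1_cst (- c) x.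
by have [d ->] := derive1D dF dc; rewrite ec addr0.
Qed.

(** Solving the equation for [F''] costs a division by [tt * co], that is one power of [tt]. This is
    exactly the loss that [cls s 1] grants to a further derivative, so the orders are gained one by
    one. *)
Lemma cls_bootstrap F N r : nice2 F -> cls s 1 N r (Lop F) -> bigO s r (derive1 F) ->
  cls s 1 N.+1 r (derive1 F).
Proof.
move=> [_ dF'] cL OF'.
suff : forall M, (M <= N.+1)%N -> cls s 1 M r (derive1 F) by apply.
elim=> [|M ih] MN; first by split.
split=> //; split => //.
have cF := ih (ltnW MN); have cLM : cls s 1 M r (Lop F) by apply: clsW cL; lia.
have ct1 := cls_tt s M (1 : R).
have ctN1 := cls_tt s M (-1 : R).
have cc1 := @cls_codist R s 1 M 1 ler01.
have ccN1 := @cls_codist R s 1 M (-1) ler01.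
have c1 : cls s 1 M 0 (fun x => (eps * (gam + 1)) * co x `^ 1 + (- eps * (gam' + 1)) * tt x `^ 1).
  apply: clsD; first exact: clsZ.
  by apply: clsZ => //; apply: cls_le ct1; exact: ler01.
have cM := clsM ler01 c1 cF; rewrite add0r in cM.
have := clsM ler01 (clsM ler01 ctN1 ccN1) (clsD (clsZ (-1) ler01 cLM) cM).
rewrite addr0 addrC; apply: cls_ext.
apply: filterS near_tt_co => x [t0 c0]; rewrite !powR_inv1 ?powRr1 ?ltW// /Lop.
move: (derive1 (derive1 F) x) (derive1 F x) (tt x) (co x) eps gam gam' t0 c0.
by move=> F2 F1 t c e g g' t0 c0; field; rewrite !gt_eqF.
Qed.

Lemma a1_derive1_tt a : \forall x \near at_end s,
  a_ 1 x * derive1 (fun y => tt y `^ a) x = - eps * a * (tt x `^ (gam + a) * co x `^ (gam' + 1)).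
Proof.
apply: filterS near_tt_co => x [t0 c0]; rewrite (derive1_tt _ t0).2 (jacobi_aE _ _ s).
have -> : tt x `^ (gam + a) = tt x `^ (gam + 1) * tt x `^ (a - 1).
  by rewrite -powRDt//; congr powR; ring.
by move: (tt x `^ (gam + 1)) (tt x `^ (a - 1)) (co x `^ (gam' + 1)) => P Q S; ring.
Qed.

Lemma nice2_sum N (b : nat -> R) (e : nat -> R) :
  nice2 (fun x => \sum_(i < N) b i * tt x `^ e i) /\
  \forall x \near at_end s,
    Lop (fun x => \sum_(i < N) b i * tt x `^ e i) x = \sum_(i < N) b i * Jop (e i) x /\
    a_ 1 x * derive1 (fun x => \sum_(i < N) b i * tt x `^ e i) x =
      \sum_(i < N) b i * (- eps * e i * (tt x `^ (gam + e i) * co x `^ (gam' + 1))).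
Proof.
have ext F G : F = G -> nice2 G -> nice2 F by move=> ->.
elim: N => [|N [ihn ih]].
  have E : (fun x => \sum_(i < 0) b i * tt x `^ e i) = fun=> 0.
    by apply/funext => x; rewrite big_ord0.
  have E' : derive1 (fun=> 0 : R) = fun=> 0 :> R by apply/funext => x; exact: (derivable_derive1_cst 0 x).2.
  rewrite E; split; first by split; near=> x; rewrite ?E'; exact: (derivable_derive1_cst 0 x).1.
  by near=> x; rewrite !big_ord0 /Lop E' E' !mulr0 subr0 oppr0.
have E : (fun x => \sum_(i < N.+1) b i * tt x `^ e i) =
    fun x => (\sum_(i < N) b i * tt x `^ e i) + b N * tt x `^ e N.
  by apply/funext => x; rewrite big_ord_recr.
have [nt Lt] := Lop_tt alpha beta s (e N).
have [n2 L2] := nice2_comb alpha beta (b N) ihn nt; rewrite E; split => //.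
apply: filterS3 ih L2 (filterI Lt (a1_derive1_tt (e N))) => x [e1 e2] [e3 e4] [e5 e6].
split; first by rewrite e4 e1 e5 big_ord_recr.
by rewrite e3 mulrDr e2 mulrCA e6 big_ord_recr.
Unshelve. all: by end_near. Qed.

(** Where the coefficients come from: [c0] and [c] are the two constants of integration, at the
    exponents [expo 0 = 0] and [expo 1 = - gam]; the others belong to the right-hand side, shifted
    by two indices. *)
Lemma asym_intro m F (b : nat -> R) (c c0 : R) :
  cls s 1 (2 * m.+1).-1 (rho m.+1) (fun x => (F x + (- c) * tt x `^ (- gam))
    + (-1) * (\sum_(i < 2 * m) b i * tt x `^ expo i.+2) - c0) ->
  asym m.+1 F.
Proof.
move=> h; exists (fun i => match i with 0 => c0 | 1 => c | i.+2 => b i end).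
apply: cls_ext h; near=> x.
have -> : (2 * m.+1 = (2 * m).+2)%N by lia.
rewrite !big_ord_recl /=.
have -> : expo 0 = 0 by rewrite /expo /= subr0.
have -> : expo (bump 0 0) = - gam by rewrite /expo /= sub0r.
rewrite powRr0; rewrite (eq_bigr (fun i : 'I__ => b i * tt x `^ expo i.+2)) //.
by move: (\sum_(i < _) _) (F x) (tt x `^ _) => S G P; ring.
Unshelve. all: by end_near. Qed.

Lemma asym_ext m F G : (\forall x \near at_end s, F x = G x) -> asym m G -> asym m F.
Proof. by move=> fg [b hb]; exists b; apply: cls_ext hb; apply: filterS fg => x ->. Qed.

Lemma asym_one F : (\forall x \near at_end s, derivable F x 1) ->
  (exists c, bigO s (1 / 2 + gam / 2) (fun x => a_ 1 x * derive1 F x - c)) -> asym 1 F.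
Proof.
move=> dF [c hc].
have e0 : eps * gam * 2 `^ (gam' + 1) != 0 :> R.
  by rewrite !mulf_neq0 ?endval_neq0 ?lt0r_neq0 ?powR_gt0//; case/andP: gam01.
(* [a_ 1] times the derivative of [tt ^ (- gam)] tends to [eps * gam * 2 ^ (gam' + 1)], so
   subtracting [c'] times this power removes the limit [c]. *)
have [c' cE] : exists c', c = c' * (eps * gam * 2 `^ (gam' + 1)).
  by exists (c / (eps * gam * 2 `^ (gam' + 1))); rewrite divfK.
pose F3 x := F x + (- c') * tt x `^ (- gam).
have dF3 : \forall x \near at_end s, derivable F3 x 1 /\
    derive1 F3 x = derive1 F x + (- c') * derive1 (fun y => tt y `^ (- gam)) x.
  apply: filterS2 dF (near_derive1_tt s (- gam)) => x dF [dt _].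
  have [d1 e1] := derive1Z (- c') dt; have [d2 ->] := derive1D dF d1.
  by rewrite e1.
have h3 : bigO s (gam + 1 + rho 0) (fun x => a_ 1 x * derive1 F3 x).
  have -> : gam + 1 + rho 0 = 1 / 2 + gam / 2 :> R by rewrite /rho; move: gam => g; lra.
  (* Freezing [co] leaves an error of order [tt], which is small enough because
     [(1 + gam) / 2 < 1]. *)
  have h1 : bigO s (1 / 2 + gam / 2) (fun x => (- c' * (eps * gam)) * (co x `^ (gam' + 1) - 2 `^ (gam' + 1))).
    have := cls_bigO (clsZ (- c' * (eps * gam)) ler01 (co_powR_cls s 0 (gam' + 1))).
    by apply: bigO_le; move: gam gam01 => g g01; lra.
  apply: bigO_ext (bigOD hc h1).
  apply: filterS2 dF3 (a1_derive1_tt (- gam)) => x [_ ->] e1.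
  rewrite mulrDr mulrCA e1 subrr powRr0.
  rewrite cE; generalize c' (a_ 1 x * derive1 F x) eps gam (co x `^ (gam' + 1)) (2 `^ (gam' + 1) : R).
  by clear=> k A e g P Q; ring.
have [b1 [c0 b2]] := asym_tail (near_proj1 dF3) h3.
apply: (@asym_intro 0 F (fun=> 0) c' c0).
have d4 := derive1_subr c0 (near_proj1 dF3).
apply: (@cls_ext _ _ _ _ _ _ (fun x => F3 x - c0)).
  by near=> x; rewrite big_ord0 mulr0 addr0.
split; [exact: b2|split; [exact: near_proj1 d4|split; [|by []]]].
by rewrite rhoS addrK; apply: bigO_ext b1; exact: near_proj2 d4.
Unshelve. all: by end_near. Qed.

(** [F] is corrected by a multiple of [tt ^ (- gam)], which removes the limit of [a_ 1 * F'], and by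
    the powers from [asym_reducible], which turn the right-hand side into a remainder. Two
    integrations and [cls_bootstrap] show that the rest is a constant plus a remainder. *)
Lemma asym_step m F : (0 < m)%N -> nice2 F -> asym m (Lop F) -> asym m.+1 F.
Proof.
move=> m0 nF aL.
have g0 : 0 < gam by case/andP: gam01.
have e0 : eps * gam * 2 `^ (gam' + 1) != 0 :> R.
  by rewrite !mulf_neq0 ?endval_neq0 ?lt0r_neq0 ?powR_gt0.
(* The derivative of [a_ 1 * G'] is [- a_ 0 * Lop G], which is bounded because the weight absorbs
   [tt ^ (- gam)]. *)
have primitive G : nice2 G -> bigO s (- gam) (Lop G) ->
    exists c, bigO s 1 (fun x => a_ 1 x * derive1 G x - c).
  move=> [dG dG'] OL; rewrite -[1]add0r; apply: bigO_primitive; first by lra.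
    apply: filterS2 dG' (near_end_itv s) => x dx x1.
    exact: (derive1_a1F alpha beta s x1 dx).1.
  have := bigOM (cls_bigO (cls_jacobi_a alpha beta s 0 0)) OL.
  rewrite addr0 subrr => h.
  apply: bigO_ext (cls_bigO (clsZ (-1) ler01 (conj h I : cls s 1 0 0 _))).
  apply: filterS2 dG' (near_end_itv s) => x dx x1.
  by rewrite (derive1_a1F alpha beta s x1 dx).2 mulN1r mulNr.
have [c hc] := primitive F nF (asym_bigO gam01 m0 aL).
have [c' cE] : exists c', c = c' * (eps * gam * 2 `^ (gam' + 1)).
  by exists (c / (eps * gam * 2 `^ (gam' + 1))); rewrite divfK.
have [nV LV] := Lop_tt alpha beta s (- gam).
(* Since [- gam] is an indicial root, [Lop] maps this power to a multiple of itself, without the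
   term of exponent [- gam - 1] that no expansion could contain. *)
have aV : asym m (Lop (fun x => tt x `^ (- gam))).
  have a1 : asym m (fun x => tt x `^ expo 1) by apply: asym_tt; lia.
  apply: asym_ext (asym_comb (- gam * (gam' + 1) - 1) a1 a1).
  apply: filterS LV => x ->; rewrite /Jop addNr mulr0 mul0r.
  have -> : expo 1 = - gam by rewrite /expo /= sub0r.
  by generalize (tt x `^ (- gam)) gam gam'; clear=> P g g'; ring.
have [n1 L1] := nice2_comb alpha beta (- c') nF nV.
have [b hb] := asym_reducible gam01 (asym_comb (- c') aL aV).
have [n2 /near_and[L2 D2]] := nice2_sum (2 * m) b (fun i => expo i.+2).
have [n3 L3] := nice2_comb alpha beta (-1) n1 n2.
set F3 := (fun x => _) in n3 L3.
have cL3 : cls s 1 (2 * m).-1 (rho m) (Lop F3).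
  apply: cls_ext hb; apply: filterS3 L1 L2 L3 => x [_ e1] e2 [_ ->].
  by rewrite e1 e2 mulN1r.
have dF3 := n3.1.
(* A crude rate, whose purpose is to show that [a_ 1 * F3'] tends to 0. *)
have p3_1 : bigO s 1 (fun x => a_ 1 x * derive1 F3 x).
  have h1 : bigO s 1 (fun x => (- c' * (eps * gam)) * (co x `^ (gam' + 1) - 2 `^ (gam' + 1))).
    exact: cls_bigO (clsZ (- c' * (eps * gam)) ler01 (co_powR_cls s 0 (gam' + 1))).
  have h2 : bigO s 1 (fun x => - 1 * \sum_(i < 2 * m) b i * (- eps * expo i.+2 *
      (tt x `^ (gam + expo i.+2) * co x `^ (gam' + 1)))).
    apply: (@cls_bigO _ _ 1 0); apply: clsZ => //; apply: cls_sum => i.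
    apply: clsZ => //; apply: clsZ => //.
    have := clsM ler01 (cls_tt s 0 (gam + expo i.+2)) (@cls_codist R s 1 0 (gam' + 1) ler01).
    by apply: cls_le; rewrite expoSS; have := expo_ge gam01 i; generalize (expo i) gam; move=> e g; lra.
  apply: bigO_ext (bigOD hc (bigOD h1 h2)).
  have nD1 : \forall x \near at_end s, derive1 (fun x => F x + - c' * tt x `^ (- gam)) x =
      derive1 F x + - c' * derive1 (fun x => tt x `^ (- gam)) x.
    by apply: filterS L1 => x [].
  have nD3 : \forall x \near at_end s, derive1 F3 x =
      derive1 (fun x => F x + - c' * tt x `^ (- gam)) x + (-1) *
      derive1 (fun x => \sum_(i < 2 * m) b i * tt x `^ expo i.+2) x.
    by apply: filterS L3 => x [].
  apply: filterS3 (filterI nD1 nD3) (a1_derive1_tt (- gam)) D2 => x [e1 e3] e2 e4.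
  rewrite e3 e1 !mulrDr mulrCA e2 [X in _ + X = _]mulrCA e4 subrr powRr0 cE.
  generalize (a_ 1 x * derive1 F x) eps gam (co x `^ (gam' + 1)) (2 `^ (gam' + 1) : R).
  by generalize c'; clear=> k A e g P Q; ring.
have rpos : 0 < gam + 1 + rho m.
  have : 1 <= m%:R :> R by rewrite ler1n.
  by rewrite /rho; move: gam gam01 m%:R => g g01 M; lra.
have p3_2 : bigO s (gam + 1 + rho m) (fun x => a_ 1 x * derive1 F3 x).
  have [c3 h3] : exists c3, bigO s (gam + rho m + 1) (fun x => a_ 1 x * derive1 F3 x - c3).
    apply: bigO_primitive.
    - by have := rpos; generalize (rho m) gam; move=> e g; lra.
    - apply: filterS2 n3.2 (near_end_itv s) => x dx x1.
      exact: (derive1_a1F alpha beta s x1 dx).1.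
    have := bigOM (cls_bigO (cls_jacobi_a alpha beta s 0 0)) (cls_bigO cL3).
    rewrite addr0 => h.
    apply: bigO_ext (cls_bigO (clsZ (-1) ler01 (conj h I : cls s 1 0 _ _))).
    apply: filterS2 n3.2 (near_end_itv s) => x dx x1.
    by rewrite (derive1_a1F alpha beta s x1 dx).2 mulN1r mulNr.
  rewrite addrAC in h3.
  (* Integrating the sharp bound leaves an unknown constant [c3]; by [p3_1] it is 0. *)
  suff c30 : c3 = 0 by move: h3; rewrite c30; apply: bigO_ext; near=> x; rewrite subr0.
  have l1 := bigO_cvg0 ltr01 p3_1.
  have l2 := bigO_cvg0 rpos h3.
  have l3 : (a_ 1 x * derive1 F3 x - c3) @[x --> at_end s] --> 0 - c3.
    by apply: cvgB; [exact: l1|exact: cvg_cst].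
  apply/eqP; rewrite -oppr_eq0 -[- c3]add0r; apply/eqP.
  by rewrite -(cvg_lim (@Rhausdorff R) l3) (cvg_lim (@Rhausdorff R) l2).
have [b1 [c0 b2]] := asym_tail dF3 p3_2.
apply: (@asym_intro m F b c' c0).
have d4 := derive1_subr c0 dF3.
have -> : ((2 * m.+1).-1 = (2 * m).-1.+1.+1)%N by lia.
split; [exact: b2|split; [exact: near_proj1 d4|]].
apply: cls_ext (near_proj2 d4) _; rewrite rhoS addrK.
exact: cls_bootstrap n3 cL3 b1.
Unshelve. all: by end_near. Qed.

End StructureStep.

(** * Asymptotics of the maximal domain *)

Section LocalAC.
Context {R : realType}.
Implicit Types (f g p : R -> R) (x : R).

Lemma gACD p q : gAC p -> gAC q -> gAC (fun x => p x + q x).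
Proof.
move=> acp acq e e0.
have [d1 d10 H1] := acp (e / 2) ltac:(lra).
have [d2 d20 H2] := acq (e / 2) ltac:(lra).
exists (Num.min d1 d2); first by rewrite lt_min d10.
move=> I s t st; rewrite lt_min => /andP[/(H1 _ _ _ st) h1 /(H2 _ _ _ st) h2].
apply: (@le_lt_trans _ _ (\sum_i (`|p (t i) - p (s i)| + `|q (t i) - q (s i)|))).
  apply: ler_sum => i _ /=.
  by rewrite opprD addrACA; exact: ler_normD.
by rewrite big_split /=; lra.
Qed.

Lemma gACM_bounded p q M : gAC p -> gAC q -> (forall x, `|p x| <= M) ->
  (forall x, `|q x| <= M) -> gAC (fun x => p x * q x).
Proof.
move=> acp acq bp bq e e0.
have M0 : 0 <= M by apply: le_trans (bp 0).
have e1 : 0 < e / (2 * (M + 1)) by rewrite divr_gt0//; lra.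
have [d1 d10 H1] := acp _ e1.
have [d2 d20 H2] := acq _ e1.
exists (Num.min d1 d2); first by rewrite lt_min d10.
move=> I s t st; rewrite lt_min => /andP[/(H1 _ _ _ st) h1 /(H2 _ _ _ st) h2].
apply: (@le_lt_trans _ _ (\sum_i (M * `|p (t i) - p (s i)| + M * `|q (t i) - q (s i)|))).
  apply: ler_sum => i _ /=.
  have -> : p (t i) * q (t i) - p (s i) * q (s i) =
    q (t i) * (p (t i) - p (s i)) + p (s i) * (q (t i) - q (s i)) by ring.
  apply: le_trans (ler_normD _ _) _; rewrite !normrM.
  by apply: lerD; rewrite ler_wpM2r.
rewrite big_split /= -!mulr_sumr -mulrDr.
move: h1 h2; rewrite !ltr_pdivlMr; [|lra..].
have s1 : 0 <= \sum_i `|p (t i) - p (s i)| by exact: sumr_ge0.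
have s2 : 0 <= \sum_i `|q (t i) - q (s i)| by exact: sumr_ge0.
by move: (\sum_i _) (\sum_i _) s1 s2 => S1 S2 s1 s2; nra.
Qed.

Lemma gAC_clamp_bounded a b p : a <= b -> gAC (p \o clamp a b) ->
  exists M, forall x, `|(p \o clamp a b) x| <= M.
Proof.
move=> ab acp.
suff H P : gAC P -> (forall y, P (clamp a b y) = P y) -> exists M, forall x, `|P x| <= M.
  by apply: H => // y /=; rewrite (clamp_id (clamp_in y ab)).
move=> acP PE; pose V := variation_fun a b P.
exists (`|P a| + (V b - V a)) => x; rewrite -PE.
have [ac cb] := andP (clamp_in x ab).
have h1 := variation_fun_nd ab acP ac; have h2 := variation_fun_nd ab acP cb.
rewrite !PE -/V in h1 h2; rewrite PE.
have h3 := ler_normD (P a) (P x - P a); rewrite addrC subrK in h3.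
have := normr_ge0 (P b - P x); lra.
Qed.

Lemma lipschitz_gAC p K : (forall x y, x <= y -> `|p y - p x| <= K * (y - x)) -> gAC p.
Proof.
move=> lip e e0; exists (e / (`|K| + 1)).
  by rewrite divr_gt0//; have := normr_ge0 K; lra.
move=> I s t st; have K0 := normr_ge0 K; rewrite ltr_pdivlMr; last lra.
have s0 : 0 <= \sum_i (t i - s i) by apply: sumr_ge0 => i _; rewrite subr_ge0; exact: st.1.
apply: le_lt_trans; apply: (@le_trans _ _ (\sum_i `|K| * (t i - s i))).
  apply: ler_sum => i _; apply: le_trans (lip _ _ (st.1 i)) _.
  by rewrite ler_wpM2r ?ler_norm// subr_ge0; exact: st.1.
by rewrite -mulr_sumr; nra.
Qed.

Definition rAC_loc f := forall a b : R, -1 < a -> a <= b -> b < 1 -> gAC (f \o clamp a b).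

Lemma rAC_locD f g : rAC_loc f -> rAC_loc g -> rAC_loc (fun x => f x + g x).
Proof. by move=> hf hg a b a1 ab b1; exact: gACD (hf _ _ a1 ab b1) (hg _ _ a1 ab b1). Qed.

Lemma rAC_locM f g : rAC_loc f -> rAC_loc g -> rAC_loc (fun x => f x * g x).
Proof.
move=> hf hg a b a1 ab b1.
have [M hM] := gAC_clamp_bounded ab (hf _ _ a1 ab b1).
have [N hN] := gAC_clamp_bounded ab (hg _ _ a1 ab b1).
apply: (@gACM_bounded _ _ (Num.max M N) (hf _ _ a1 ab b1) (hg _ _ a1 ab b1)) => x.
  by rewrite le_max hM.
by rewrite le_max hN orbT.
Qed.

Lemma rAC_loc_ext f g : (forall x, -1 < x < 1 -> f x = g x) -> rAC_loc g -> rAC_loc f.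
Proof.
move=> fg hg a b a1 ab b1; have -> : f \o clamp a b = g \o clamp a b.
  by apply/funext => x /=; apply: fg; have := clamp_in x ab; lra.
exact: hg.
Qed.

Lemma rAC_loc_lipschitz f :
  (forall a b : R, -1 < a -> a <= b -> b < 1 -> exists K, forall x, a <= x <= b ->
    derivable f x 1 /\ `|derive1 f x| <= K) -> rAC_loc f.
Proof.
move=> H a b a1 ab b1; have [K hK] := H a b a1 ab b1.
apply: (@lipschitz_gAC _ K) => x y xy /=.
have cxy := le_clamp ab xy; have [ax xb] := andP (clamp_in x ab).
have [ay yb] := andP (clamp_in y ab).
have [z zxy ->] := @derive1_MVT _ f _ _ cxy (fun z zxy => (hK z ltac:(lra)).1).
have [_ hz] := hK z ltac:(lra).
rewrite normrM [X in _ * X]ger0_norm ?subr_ge0//.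
have K0 := le_trans (normr_ge0 _) hz.
have := clamp_lip ab xy; have : 0 <= clamp a b y - clamp a b x by rewrite subr_ge0.
move: (clamp a b y - clamp a b x) (derive1 f z) hz => u D hz; have := normr_ge0 D; nra.
Qed.

(** For [N = 2n - 1] this is the regularity of the maximal domain: derivatives exist everywhere in
    the interval and the last one is locally absolutely continuous. *)
Fixpoint ACd (N : nat) f : Prop := rAC_loc f /\
  match N with
  | 0 => True
  | N'.+1 => (forall x, -1 < x < 1 -> derivable f x 1) /\ ACd N' (derive1 f)
  end.

Lemma itv_open x : -1 < x < 1 -> \forall y \near x, -1 < y < 1.
Proof.
move=> /andP[x1 x2]; near=> y; apply/andP; split; near: y.
  exact: lt_nbhsr.
exact: lt_nbhsl.
Unshelve. all: by end_near. Qed.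

Lemma itv_deriv f g : (forall x, -1 < x < 1 -> f x = g x) -> forall x, -1 < x < 1 ->
  (derivable g x 1 -> derivable f x 1) /\ derive1 f x = derive1 g x.
Proof.
move=> fg x /itv_open x1; apply: near_eq_deriv.
by apply: filterS x1 => y; exact: fg.
Qed.

Lemma ACd_ext N f g : (forall x, -1 < x < 1 -> f x = g x) -> ACd N g -> ACd N f.
Proof.
elim: N f g => [|N ih] f g fg /=; first by move=> [h _]; split => //; exact: rAC_loc_ext h.
move=> [h [dg cg]]; split; first exact: rAC_loc_ext h.
split; first by move=> x x1; apply: (itv_deriv fg x1).1; exact: dg.
by apply: ih cg => x x1; exact: (itv_deriv fg x1).2.
Qed.

Lemma ACdS N f : ACd N.+1 f -> ACd N f.
Proof.
elim: N f => [|N ih] f [h [df cf]]; first by split.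
by split => //; split => //; exact: ih.
Qed.

Lemma ACdW N M f : (M <= N)%N -> ACd N f -> ACd M f.
Proof.
move=> /subnK <-; elim: (N - M)%N => [//|k ih]; rewrite addSn => /ACdS; exact: ih.
Qed.

Lemma ACdD N f g : ACd N f -> ACd N g -> ACd N (fun x => f x + g x).
Proof.
elim: N f g => [|N ih] f g /= [hf] => [_ [hg _]|[df cf] [hg [dg cg]]].
  by split => //; exact: rAC_locD.
split; first exact: rAC_locD.
have h x : -1 < x < 1 -> derivable (fun x => f x + g x) x 1 /\
    derive1 (fun x => f x + g x) x = derive1 f x + derive1 g x.
  by move=> x1; apply: derive1D; [exact: df|exact: dg].
split; first by move=> x /h[].
by apply: ACd_ext (ih _ _ cf cg) => x /h[].
Qed.

Lemma ACdM N f g : ACd N f -> ACd N g -> ACd N (fun x => f x * g x).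
Proof.
elim: N f g => [|N ih] f g.
  by move=> /= [hf _] [hg _]; split => //; exact: rAC_locM.
move=> cf cg; have [hf [df df']] := cf; have [hg [dg dg']] := cg.
split; first exact: rAC_locM.
have h x : -1 < x < 1 -> derivable (fun x => f x * g x) x 1 /\
    derive1 (fun x => f x * g x) x = derive1 f x * g x + f x * derive1 g x.
  by move=> x1; apply: derive1M; [exact: df|exact: dg].
split; first by move=> x /h[].
apply: (@ACd_ext _ _ (fun x => derive1 f x * g x + f x * derive1 g x)).
  by move=> x /h[].
by apply: ACdD; apply: ih => //; exact: ACdS.
Qed.

Lemma ACd_cst N c : ACd N (fun=> c).
Proof.
have ac c' : rAC_loc (fun=> c').
  apply: rAC_loc_lipschitz => a b _ _ _; exists 0 => x _.
  by have [d ->] := derivable_derive1_cst c' x; rewrite normr0.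
elim: N c => [|N ih] c; first by split.
split => //; split; first by move=> x _; exact: (derivable_derive1_cst c x).1.
by apply: ACd_ext (ih 0) => x _; exact: (derivable_derive1_cst c x).2.
Qed.

Lemma ACd_affine N c k : ACd N (fun x => c + k * x).
Proof.
have ac : rAC_loc (fun x => c + k * x).
  apply: rAC_loc_lipschitz => a b _ _ _; exists `|k| => x _.
  by have [d ->] := derive1_affine c k x.
case: N => [|N]; split => //; split; first by move=> x _; exact: (derive1_affine c k x).1.
by apply: ACd_ext (ACd_cst _ k) => x _; exact: (derive1_affine c k x).2.
Qed.

End LocalAC.

(** * From square integrability to the expansion *)

Section StructureTheorem.
Context {R : realType}.
Variables (alpha beta : R) (s : endpoint).
Hypotheses (alpha01 : 0 < alpha < 1) (beta01 : 0 < beta < 1).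
Notation tt := (@edist R s).
Notation co := (@ecodist R s).
Notation eps := (@endval R s).
Notation gam := (end_exponent alpha beta s).
Notation gam' := (end_exponent alpha beta (opposite s)).
Notation a_ := (jacobi_a alpha beta).
Notation mu := (@lebesgue_measure R).
Implicit Types (F G g : R -> R) (x : R).

Lemma gam01 : 0 < gam < 1. Proof. by case: s. Qed.
Lemma gam'01 : 0 < gam' < 1. Proof. by case: s. Qed.

Lemma tt2 x : -1 < x < 1 -> 0 < tt x < 2. Proof. by rewrite edist_itv. Qed.

Lemma jacobi_a0_ge0 x : 0 <= a_ 0 x.
Proof. by rewrite /jacobi_a mulr_ge0// powR_ge0. Qed.

Lemma jacobi_a0_le x T : -1 < x < 1 -> tt x <= T -> a_ 0 x <= T `^ gam * 2 `^ gam'.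
Proof.
move=> x1 xT; have := tt2 x1; have [t0 c0] := co_itv s x1; rewrite (jacobi_aE _ _ s) !addr0 => t02.
apply: ler_pM; rewrite ?powR_ge0//.
  by apply: ge0_ler_powR; rewrite ?nnegrE//; [case/andP: gam01 => /ltW|exact: ltW|exact: le_trans (ltW t0) xT].
by apply: ge0_ler_powR; rewrite ?nnegrE//; [case/andP: gam'01 => /ltW|exact: ltW|rewrite ecodistE; lra].
Qed.

(** The derivative of [a_ 1] is a bounded factor times the weight, and the weight is bounded because
    both of its exponents are positive. *)
Lemma rAC_loc_jacobi_a1 : rAC_loc (a_ 1).
Proof.
apply: rAC_loc_lipschitz => a b a1 ab b1.
exists (4 * (gam + gam' + 2) * (2 `^ gam * 2 `^ gam')) => x xab.
have x1 : -1 < x < 1 by lra.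
have [d ->] := derive1_jacobi_a1 alpha beta s x1; split => //.
have t02 := tt2 x1; have h := jacobi_a0_le x1 (ltW (andP t02).2).
rewrite mulNr mulNr normrN normrM; apply: ler_pM => //; last by rewrite ger0_norm// jacobi_a0_ge0.
rewrite normrM (_ : `|eps| = 1) ?mul1r; last by case: (s); rewrite /= ?normrN normr1.
have := gam01; have := gam'01; have := ecodistE s x; rewrite ler_norml.
by move: (co x) (tt x) gam gam' t02 => c t g g' t02 -> g1 g1'; nra.
Qed.

Definition in_rL2 g := measurable_fun jacobi_itv g /\
  (\int[mu]_(x in jacobi_itv) (g x ^+ 2 * a_ 0 x)%:E < +oo)%E.

Lemma measurable_a0 (D : set R) : measurable_fun D (a_ 0).
Proof.
apply: measurable_funM; apply: measurable_funTS.
  apply: (measurableT_comp (measurable_powR _)); exact: measurable_funB.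
apply: (measurableT_comp (measurable_powR _)); exact: measurable_funD.
Qed.

(* AM-GM: [a0 |g| <= lambda g^2 a0 + a0 / lambda], with [lambda] chosen as [T ^ ((gam + 1) / 2)]. *)
Lemma L2_primitive_bound F u v T : ACd 1 F -> in_rL2 (ellr alpha beta F) ->
  -1 < u -> u < v -> v < 1 -> tt u <= T -> tt v <= T ->
  `|a_ 1 v * derive1 F v - a_ 1 u * derive1 F u| <=
    (fine (\int[mu]_(x in jacobi_itv) (ellr alpha beta F x ^+ 2 * a_ 0 x)%:E)%E + 2 `^ gam')
      * T `^ ((gam + 1) / 2).
Proof.
move=> [_ [_ [acF' _]]] [mg Lg] u1 uv v1 uT vT.
set g := ellr alpha beta F; set p := fun y => a_ 1 y * derive1 F y.
have T0 : 0 < T by have [] := co_itv s (x := u) ltac:(lra); lra.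
pose l := T `^ ((gam + 1) / 2).
have l0 : 0 < l by exact: powR_gt0.
(* The constant term of [G] integrates to at most a multiple of [T ^ gam * T / l], which this
   identity turns into [l]. *)
have Tl : T `^ gam * T = l * l by rewrite /l -powRDt// -{2}(powRr1 (ltW T0)) -powRDt//; congr powR; field.
pose G x := l * (g x ^+ 2 * a_ 0 x) + T `^ gam * 2 `^ gam' / l.
have acp : gAC (p \o clamp u v).
  exact: (rAC_locM rAC_loc_jacobi_a1 acF') u1 (ltW uv) v1.
have K0 x : 0 <= g x ^+ 2 * a_ 0 x by rewrite mulr_ge0 ?sqr_ge0 ?jacobi_a0_ge0.
have C0 : 0 <= T `^ gam * 2 `^ gam' / l by rewrite divr_ge0 ?mulr_ge0 ?powR_ge0// ltW.
have sub : `]u, v[%classic `<=` (jacobi_itv : set R).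
  by move=> x; rewrite /jacobi_itv /= !in_itv /=; lra.
have mg2 : measurable_fun jacobi_itv (fun x => g x ^+ 2 * a_ 0 x).
  by apply: measurable_funM; [exact: measurable_funX|exact: measurable_a0].
have mg2uv : measurable_fun `]u, v[ (fun x => g x ^+ 2 * a_ 0 x).
  by apply: measurable_funS mg2 => //; exact: measurable_itv.
have mG : measurable_fun `]u, v[ G.
  apply: measurable_funD; last exact: measurable_cst.
  by apply: measurable_funM => //; exact: measurable_cst.
have bound := @gAC_le_integral R p G u v uv acp mG _ _.
rewrite -lee_fin; apply: le_trans (bound _ _) _.
- by move=> x; rewrite /G addr_ge0// mulr_ge0// ltW.
- move=> x xuv dp; have x1 : -1 < x < 1 by lra.
  have a0 := jacobi_a_gt0 alpha beta s 0 x1.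
  have -> : derive1 p x = - (a_ 0 x * g x) by rewrite /g /ellr mulNr mulrN opprK mulrA mulfV ?mul1r// gt_eqF.
  rewrite normrN normrM (gtr0_norm a0) /G.
  have xT : tt x <= T.
    by move: uT vT; rewrite /edist; case: (s) => /=; lra.
  have h := jacobi_a0_le x1 xT.
  apply: (@le_trans _ _ (l * (g x ^+ 2 * a_ 0 x) + a_ 0 x / l)).
    rewrite -subr_ge0.
    have -> : l * (g x ^+ 2 * a_ 0 x) + a_ 0 x / l - a_ 0 x * `|g x| =
       a_ 0 x / l * ((l * `|g x|) ^+ 2 + 1 - (l * `|g x|)).
      have <- : `|g x| ^+ 2 = g x ^+ 2 by rewrite real_normK ?num_real.
      by generalize (`|g x|) (a_ 0 x) => z w; field; rewrite gt_eqF.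
    apply: mulr_ge0; first by rewrite divr_ge0 ?ltW.
    by move: (l * `|g x|) => z; nra.
  by rewrite lerD2l ler_pM2r ?invr_gt0.
rewrite /G; under eq_integral => x _ do rewrite EFinD.
rewrite ge0_integralD//; last 2 first.
- by move=> x _; rewrite lee_fin mulr_ge0// ltW.
- by apply/measurable_EFinP; apply: measurable_funM => //; exact: measurable_cst.
under eq_integral => x _ do rewrite EFinM.
rewrite ge0_integralZl_EFin//; last 3 first.
- by move=> x _; rewrite lee_fin.
- exact/measurable_EFinP.
- exact: ltW.
have -> : (\int[mu]_(_ in `]u, v[) (T `^ gam * 2 `^ gam' / l)%:E =
    (T `^ gam * 2 `^ gam' / l * (v - u))%:E)%E.
  rewrite integral_cst; last exact: measurable_itv.
  transitivity ((T `^ gam * 2 `^ gam' / l)%:E * (v - u)%:E)%E; last by rewrite -EFinM.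
  congr (_ * _)%E.
  by have := lebesgue_measure_itv `]u, v[; rewrite /= lte_fin uv -EFinB.
have intfin : (\int[mu]_(x in jacobi_itv) (g x ^+ 2 * a_ 0 x)%:E)%E \is a fin_num.
  by rewrite ge0_fin_numE//; apply: integral_ge0 => x _; rewrite lee_fin.
have le1 : (\int[mu]_(x in `]u, v[) (g x ^+ 2 * a_ 0 x)%:E <=
    \int[mu]_(x in jacobi_itv) (g x ^+ 2 * a_ 0 x)%:E)%E.
  apply: ge0_subset_integral => //; try exact: measurable_itv.
  - exact/measurable_EFinP.
  - by move=> x _; rewrite lee_fin.
apply: (@le_trans _ _ (l%:E * \int[mu]_(x in jacobi_itv) (g x ^+ 2 * a_ 0 x)%:E +
  (T `^ gam * 2 `^ gam' / l * (v - u))%:E)%E).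
  by apply: leeD => //; apply: lee_wpmul2l => //; rewrite lee_fin ltW.
rewrite -(fineK intfin) -EFinM -EFinD lee_fin mulrDl [l * _]mulrC lerD2l.
have vuT : v - u <= T.
  have := (co_itv s (x := u) ltac:(lra)).1; have := (co_itv s (x := v) ltac:(lra)).1.
  by move: uT vT; rewrite /edist; case: (s) => /=; lra.
rewrite -/l.
have -> : 2 `^ gam' * l = T `^ gam * 2 `^ gam' / l * T.
  have -> : T `^ gam * 2 `^ gam' / l * T = 2 `^ gam' * (T `^ gam * T) / l by ring.
  by rewrite Tl mulrA mulfK// gt_eqF.
by rewrite ler_wpM2l.
Qed.

Lemma asym_base F : ACd 1 F -> in_rL2 (ellr alpha beta F) -> asym alpha beta s 1 F.
Proof.
move=> aF LF; have [_ [dF _]] := aF.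
apply: (asym_one gam01); first by apply: filterS (near_end_itv s) => x; exact: dF.
set K := fine (\int[mu]_(x in jacobi_itv) (ellr alpha beta F x ^+ 2 * a_ 0 x)%:E)%E + 2 `^ gam'.
have -> : 1 / 2 + gam / 2 = (gam + 1) / 2 :> R by field.
apply: (@bigO_cauchy R s ((gam + 1) / 2) K 1) => //.
  by have := gam01; move: gam => g g01; lra.
move=> x y y0 yx x1.
have x1' : -1 < x < 1 by rewrite -(edist_itv s); lra.
have y1' : -1 < y < 1 by rewrite -(edist_itv s); lra.
have [xy|yx'|->] := ltgtP x y.
- by rewrite distrC; apply: (L2_primitive_bound aF LF) => //; lra.
- by apply: (L2_primitive_bound aF LF) => //; lra.
rewrite subrr normr0 mulr_ge0 ?powR_ge0// addr_ge0 ?powR_ge0// fine_ge0//.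
by apply: integral_ge0 => z _; rewrite lee_fin mulr_ge0 ?sqr_ge0 ?jacobi_a0_ge0.
Qed.

(** The polynomial coefficients of [Lop] make this a matter of sums and products; the divergence
    form would bring in derivatives of the weight. *)
Lemma ACd_Lop N F : ACd N.+2 F -> ACd N (Lop alpha beta s F).
Proof.
move=> aF; have [_ [_ aF1]] := aF; have [_ [_ aF2]] := aF1.
have at_ : ACd N tt := ACd_affine N 1 (- eps).
have ac_ : ACd N co := ACd_affine N 1 eps.
have h1 := ACdM (ACdM at_ ac_) aF2.
have h2 := ACdM (ACdD (ACdM (ACd_cst N (eps * (gam + 1))) ac_)
                      (ACdM (ACd_cst N (- eps * (gam' + 1))) at_)) (ACdS aF1).
apply: ACd_ext (ACdD (ACdM (ACd_cst N (-1)) h1) h2) => x _.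
rewrite /Lop; generalize (tt x) (co x) (derive1 (derive1 F) x) (derive1 F x) eps gam gam'.
by clear=> t c F2 F1 e g g'; ring.
Qed.

Lemma ellr_Lop F x : ACd 2 F -> -1 < x < 1 -> ellr alpha beta F x = Lop alpha beta s F x.
Proof. by move=> [_ [_ [_ [dF _]]]] x1; apply: ellrE => //; exact: dF. Qed.

(** Square integrability enters only in the base case, applied to the iterate of order n - 1. Each
    further step works with the expansion already found for [ell F]. *)
Theorem structure n F : (0 < n)%N -> ACd (2 * n).-1 F ->
  in_rL2 (iter n (ellr alpha beta) F) -> asym alpha beta s n F.
Proof.
case: n => // n _; elim: n F => [|n ih] F aF LF; first exact: asym_base.
have aF' : ACd (2 * n.+1).-1.+2 F by apply: ACdW aF; lia.
have a2 : ACd 2 F by apply: ACdW aF'; lia.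
have aL : ACd (2 * n.+1).-1 (ellr alpha beta F).
  by apply: ACd_ext (ACd_Lop aF') => x; exact: ellr_Lop.
have dF' : forall x, -1 < x < 1 -> derivable (derive1 F) x 1 by case: a2 => _ [_ [_ []]].
apply: (asym_step gam01) => //.
  split; apply: filterS (near_end_itv s) => x x1; last exact: dF'.
  by case: aF => _ [+ _]; apply.
apply: asym_ext (ih _ aL _); last by rewrite -iterSr.
by apply: filterS (near_end_itv s) => x x1; rewrite ellr_Lop.
Qed.

End StructureTheorem.

(** * Real and imaginary parts of functions in the maximal domain *)

Section DmaxStructure.
Context {R : realType}.
Variables (alpha beta : R).
Hypotheses (alpha01 : 0 < alpha < 1) (beta01 : 0 < beta < 1).
Implicit Types f : R -> R[i].
Notation Re := complex.Re.
Notation Im := complex.Im.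
Notation ellr := (ellr alpha beta).

Lemma cderiveE k f : cderive k f = fun x =>
  (iter k (@derive1 R R) (fun y => Re (f y)) x +i*
   iter k (@derive1 R R) (fun y => Im (f y)) x)%C.
Proof.
elim: k => [|k ih]; first by apply/funext => x /=; case: (f x).
by rewrite /cderive iterS -/(cderive k f) ih.
Qed.

Lemma real_complexM (a : R) (z : R[i]) : ((a%:C)%C * z = (a * Re z) +i* (a * Im z))%C.
Proof. by case: z => x y; rewrite /GRing.mul /= !mul0r subr0 addr0. Qed.

Lemma iter_jacobi_exprE k f : iter k (jacobi_expr alpha beta) f = fun x =>
  (iter k ellr (fun y => Re (f y)) x +i* iter k ellr (fun y => Im (f y)) x)%C.
Proof.
elim: k => [|k ih]; first by apply/funext => x /=; case: (f x).
rewrite iterS ih /jacobi_expr; set g := (fun x : R => _ +i* _)%C.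
have E : (fun y => ((jacobi_a alpha beta 1 y)%:C)%C * cderive 1 g y) = fun y =>
   ((jacobi_a alpha beta 1 y * derive1 (fun x => Re (g x)) y) +i*
    (jacobi_a alpha beta 1 y * derive1 (fun x => Im (g x)) y))%C.
  by apply/funext => y; rewrite cderiveE real_complexM.
rewrite E; apply/funext => x; rewrite cderiveE /= -fmorphV -rmorphN real_complexM /=.
by [].
Qed.

Lemma normr_Re (z : R[i]) : `|Re z| <= Normc.normc z.
Proof. by case: z => x y /=; rewrite -sqrtr_sqr ler_sqrt ?lerDl ?sqr_ge0 ?addr_ge0 ?sqr_ge0. Qed.

Lemma normr_Im (z : R[i]) : `|Im z| <= Normc.normc z.
Proof. by case: z => x y /=; rewrite -sqrtr_sqr ler_sqrt ?lerDr ?sqr_ge0 ?addr_ge0 ?sqr_ge0. Qed.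

Lemma AC_loc_real (L : R[i] -> R) f : (forall z w, L (z - w) = L z - L w) ->
  (forall z, `|L z| <= Normc.normc z) -> AC_loc f -> rAC_loc (fun x => L (f x)).
Proof.
move=> LB Ln acf a b a1 ab b1; apply: (gAC_clamp ab) => e e0.
have [d d0 H] := acf a b a1 ab b1 e e0; exists d => // m s t h1 h2 h3.
apply: le_lt_trans (H m s t h1 h2 h3); apply: ler_sum => i _.
by rewrite -LB.
Qed.

Lemma ACd_intro N (F : R -> R) :
  (forall k, (k <= N)%N -> rAC_loc (iter k (@derive1 R R) F)) ->
  (forall k x, (k < N)%N -> -1 < x < 1 -> derivable (iter k (@derive1 R R) F) x 1) ->
  ACd N F.
Proof.
elim: N F => [|N ih] F h dh; first by split=> //; exact: (h 0%N).
split; first exact: (h 0%N).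
split; first by move=> x; exact: (dh 0%N).
by apply: ih => [k kN|k x kN]; rewrite -iterSr; [exact: h|exact: dh].
Qed.

Lemma in_L2_real (L : R[i] -> R) f : (forall z, `|L z| <= Normc.normc z) ->
  measurable_fun jacobi_itv (fun x => L (f x)) -> in_L2 alpha beta f ->
  in_rL2 alpha beta (fun x => L (f x)).
Proof.
move=> Ln mL [mRe mIm fin]; split => //; apply: le_lt_trans fin.
have nE : (fun x => Normc.normc (f x)) = fun x => Num.sqrt (Re (f x) ^+ 2 + Im (f x) ^+ 2).
  by apply/funext => x; case: (f x).
have ma0 : measurable_fun (jacobi_itv : set R) (jacobi_a alpha beta 0).
  exact: measurable_a0.
apply: ge0_le_integral.
- exact: measurable_itv.
- by move=> x _; rewrite lee_fin mulr_ge0 ?sqr_ge0 ?jacobi_a0_ge0.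
- by apply/measurable_EFinP; apply: measurable_funM => //; exact: measurable_funX.
- apply/measurable_EFinP; apply: measurable_funM => //.
  have -> : (fun x => Normc.normc (f x) ^+ 2) = fun x => Re (f x) ^+ 2 + Im (f x) ^+ 2.
    apply/funext => x; rewrite (congr1 (fun g => g x) nE) sqr_sqrtr// addr_ge0 ?sqr_ge0//.
  by apply: measurable_funD; exact: measurable_funX.
- move=> x _; rewrite lee_fin ler_wpM2r ?jacobi_a0_ge0//.
  rewrite -real_normK ?num_real// ler_pXn2r ?nnegrE ?Ln//.
  exact: le_trans (Ln (f x)).
Qed.

Lemma Dmax_real n f : (0 < n)%N -> Dmax alpha beta n f ->
  [/\ ACd (2 * n).-1 (fun x => Re (f x)), ACd (2 * n).-1 (fun x => Im (f x)),
    in_rL2 alpha beta (iter n ellr (fun x => Re (f x))) &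
    in_rL2 alpha beta (iter n ellr (fun x => Im (f x)))].
Proof.
move=> n0 [_ df acf].
rewrite iter_jacobi_exprE => L2; have [mRe mIm _] := L2.
have ReB (z w : R[i]) : Re (z - w) = Re z - Re w by case: z w => [? ?] [? ?].
have ImB (z w : R[i]) : Im (z - w) = Im z - Im w by case: z w => [? ?] [? ?].
split.
- apply: ACd_intro => [k kn|k x kn x1].
    have h : (k < 2 * n)%N by lia.
    by have := @AC_loc_real (@complex.Re R) _ ReB normr_Re (acf k h); rewrite cderiveE.
  have h : (k.+1 < 2 * n)%N by lia.
  by have := (df k x h x1).1; rewrite cderiveE.
- apply: ACd_intro => [k kn|k x kn x1].
    have h : (k < 2 * n)%N by lia.
    by have := @AC_loc_real (@complex.Im R) _ ImB normr_Im (acf k h); rewrite cderiveE.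
  have h : (k.+1 < 2 * n)%N by lia.
  by have := (df k x h x1).2; rewrite cderiveE.
- exact: (in_L2_real normr_Re mRe L2).
- exact: (in_L2_real normr_Im mIm L2).
Qed.

End DmaxStructure.

(** * The sesquilinear form at an endpoint *)

Lemma iter_derive1_0 {R : realType} k : iter k (@derive1 R R) (fun=> 0) = fun=> 0.
Proof. by elim: k => // k ih; rewrite iterS ih; apply/funext => x; exact: (derivable_derive1_cst 0 x).2. Qed.

Section Brackets.
Context {R : realType}.
Variables (alpha beta : R) (s : endpoint).
Notation gam := (end_exponent alpha beta s).
Notation a_ := (jacobi_a alpha beta).
Notation D k := (iter k (@derive1 R R)).
Implicit Types (F G H : R -> R) (x : R).

Lemma near_iter F G k : (\forall x \near at_end s, F x = G x) ->
  \forall x \near at_end s, D k F x = D k G x.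
Proof.
move=> FG; elim: k => [//|k ih].
by apply: filterS (near_end_deriv ih) => x [].
Qed.

Lemma near_iter_comb d N r1 r2 F G c k : (k <= N)%N -> cls s d N r1 F -> cls s d N r2 G ->
  \forall x \near at_end s, D k (fun x => F x + c * G x) x = D k F x + c * D k G x.
Proof.
move=> + cF cG; elim: k => [_|k ih kN]; first by near=> x.
have h1 := near_end_deriv (ih (ltnW kN)).
have h2 := cls_iter_derivable kN cF; have h3 := cls_iter_derivable kN cG.
apply: filterS3 h1 h2 h3 => x [_ /= ->] dF dG.
have [d1 e1] := derive1Z c dG.
by have [_ ->] := derive1D dF d1; rewrite e1.
Unshelve. all: by end_near. Qed.

(** One of the two terms of index [k] in the form; the other has [F] and [G] exchanged, so each
    estimate on [half] is used twice. *)
Definition half k F G x : R :=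
  \sum_(1 <= j < k.+1) (-1) ^+ (k + j) * (D (k - j)%N (fun y => a_ k y * D k G y) x * D (j - 1)%N F x).

Definition rbr n F G x : R := \sum_(1 <= k < n.+1) (half k F G x - half k G F x).

Lemma rbr_antisym n F G x : rbr n F G x = - rbr n G F x.
Proof. by rewrite /rbr -sumrN; apply: eq_bigr => k _; rewrite opprB. Qed.

(** The [k] powers of [tt] in [a_ k] make up for the [k] derivatives. *)
Lemma cls_aD n k r G : (k <= n)%N -> cls s 1 (2 * n).-1 r G ->
  cls s 1 ((2 * n).-1 - k) (gam + r) (fun y => a_ k y * D k G y).
Proof.
move=> kn cG; have [->|k0] := posnP k.
  rewrite subn0; have := clsM ler01 (cls_jacobi_a alpha beta s (2 * n).-1 0) cG.
  by rewrite addr0.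
have kN : (k <= (2 * n).-1)%N by lia.
have := clsM ler01 (cls_jacobi_a alpha beta s ((2 * n).-1 - k) k) (cls_iter kN cG).
by congr cls; ring.
Qed.

Lemma half_term_bigO n k j r r' F G : (1 <= j <= k)%N -> (k <= n)%N ->
  cls s 1 (2 * n).-1 r F -> cls s 1 (2 * n).-1 r' G ->
  bigO s (gam + r + r' - k%:R + 1)
    (fun x => D (k - j)%N (fun y => a_ k y * D k G y) x * D (j - 1)%N F x).
Proof.
move=> jk kn cF cG.
have h1 : ((k - j) <= (2 * n).-1 - k)%N by lia.
have h2 : ((j - 1) <= (2 * n).-1)%N by lia.
have := bigOM (cls_bigO (cls_iter h1 (cls_aD kn cG))) (cls_bigO (cls_iter h2 cF)).
by congr bigO; rewrite !natrB; [ring|lia..].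
Qed.

Lemma bigOZ r c F : bigO s r F -> bigO s r (fun x => c * F x).
Proof. by move=> h; exact: cls_bigO (clsZ c ler01 (conj h I : cls s 1 0 r F)). Qed.

Lemma bigO_sum_nat r m n (F : nat -> R -> R) :
  (forall i, (m <= i < n)%N -> bigO s r (F i)) -> bigO s r (fun x => \sum_(m <= i < n) F i x).
Proof.
move=> h; under eq_fun do rewrite big_nat_cond.
apply: (@cls_bigO _ s 1 0).
suff : forall l : seq nat, cls s 1 0 r (fun x => \sum_(i <- l | (m <= i < n)%N && true) F i x) by apply.
elim=> [|i l ih]; first by apply: cls_ext (cls0 _ _ _ _); near=> x; rewrite big_nil.
have [imn|imn] := boolP ((m <= i < n)%N && true); under eq_fun do rewrite big_cons.
  rewrite imn; move: imn; rewrite andbT => imn.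
  exact: (clsD (conj (h i imn) I : cls s 1 0 r (F i)) ih).
by rewrite (negbTE imn).
Unshelve. all: by end_near. Qed.

Lemma half_bigO n k r r' F G : (1 <= k <= n)%N ->
  cls s 1 (2 * n).-1 r F -> cls s 1 (2 * n).-1 r' G ->
  bigO s (gam + r + r' - k%:R + 1) (half k F G).
Proof.
move=> kn cF cG; apply: bigO_sum_nat => j jk; apply: bigOZ.
by apply: (half_term_bigO _ _ cF cG); lia.
Qed.

(** The exponent of a summand depends on [k] only, since the derivatives are merely distributed by
    [j]; the worst case is [k = n]. *)
Lemma rbr_bigO n r r' F G :
  cls s 1 (2 * n).-1 r F -> cls s 1 (2 * n).-1 r' G ->
  bigO s (gam + r + r' - n%:R + 1) (rbr n F G).
Proof.
move=> cF cG; apply: bigO_sum_nat => k kn.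
have kn' : k%:R <= n%:R :> R by rewrite ler_nat; lia.
apply: (@bigO_le _ _ _ (gam + r + r' - k%:R + 1)).
  by move: gam k%:R n%:R kn' => g K M h; lra.
have h1 := half_bigO (ltac:(lia) : (1 <= k <= n)%N) cF cG.
have h2 := half_bigO (ltac:(lia) : (1 <= k <= n)%N) cG cF.
rewrite (addrAC gam r') in h2; have := bigOD h1 (bigOZ (-1) h2).
by apply: bigO_ext; near=> x; rewrite mulN1r.
Unshelve. all: by end_near. Qed.

Lemma near_sum_nat (V : nmodType) m n (F G : nat -> R -> V) :
  (forall i, (m <= i < n)%N -> \forall x \near at_end s, F i x = G i x) ->
  \forall x \near at_end s, \sum_(m <= i < n) F i x = \sum_(m <= i < n) G i x.
Proof.
move=> h; have : \forall x \near at_end s, forall i : 'I_n, (m <= i)%N -> F i x = G i x.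
  apply: filter_forall => i; have [mi|mi] := leqP m i; last by near=> x.
  by apply: filterS (h i _) => //; rewrite mi /=.
apply: filterS => x hx; apply: eq_big_nat => i /andP[mi iN].
exact: (hx (Ordinal iN)).
Unshelve. all: by end_near. Qed.

Lemma rbr_ext n F F' G G' : (\forall x \near at_end s, F x = F' x) ->
  (\forall x \near at_end s, G x = G' x) ->
  \forall x \near at_end s, rbr n F G x = rbr n F' G' x.
Proof.
have aux k H H' K K' : (\forall x \near at_end s, H x = H' x) ->
    (\forall x \near at_end s, K x = K' x) -> \forall x \near at_end s, half k H K x = half k H' K' x.
  move=> hH hK; apply: near_sum_nat => j _.
  have e1 := near_iter (j - 1) hH.
  have e2 : \forall x \near at_end s, a_ k x * D k K x = a_ k x * D k K' x.
    by apply: filterS (near_iter k hK) => x ->.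
  by apply: filterS2 e1 (near_iter (k - j) e2) => x /= -> ->.
move=> hF hG; apply: near_sum_nat => k _.
by apply: filterS2 (aux k _ _ _ _ hF hG) (aux k _ _ _ _ hG hF) => x -> ->.
Qed.

Lemma rbr_comb n r1 r2 r F1 F2 G c : cls s 1 (2 * n).-1 r1 F1 ->
  cls s 1 (2 * n).-1 r2 F2 -> cls s 1 (2 * n).-1 r G ->
  \forall x \near at_end s, rbr n (fun x => F1 x + c * F2 x) G x = rbr n F1 G x + c * rbr n F2 G x.
Proof.
move=> c1 c2 cG.
have h k : (1 <= k < n.+1)%N -> \forall x \near at_end s,
    half k (fun x => F1 x + c * F2 x) G x = half k F1 G x + c * half k F2 G x.
  move=> kn.
  have : \forall x \near at_end s, half k (fun x => F1 x + c * F2 x) G x =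
      \sum_(1 <= j < k.+1) ((-1) ^+ (k + j) * (D (k - j)%N (fun y => a_ k y * D k G y) x * D (j - 1)%N F1 x)
       + c * ((-1) ^+ (k + j) * (D (k - j)%N (fun y => a_ k y * D k G y) x * D (j - 1)%N F2 x))).
    apply: near_sum_nat => j jk.
    have jN : (j - 1 <= (2 * n).-1)%N by lia.
    by apply: filterS (near_iter_comb c jN c1 c2) => x /= ->; ring.
  by apply: filterS => x ->; rewrite big_split /= mulr_sumr.
have h' k : (1 <= k < n.+1)%N -> \forall x \near at_end s,
    half k G (fun x => F1 x + c * F2 x) x = half k G F1 x + c * half k G F2 x.
  move=> kn.
  have kN : (k <= (2 * n).-1)%N by lia.
  have kn' : (k <= n)%N by lia.
  have : \forall x \near at_end s, half k G (fun x => F1 x + c * F2 x) x =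
      \sum_(1 <= j < k.+1) ((-1) ^+ (k + j) * (D (k - j)%N (fun y => a_ k y * D k F1 y) x * D (j - 1)%N G x)
       + c * ((-1) ^+ (k + j) * (D (k - j)%N (fun y => a_ k y * D k F2 y) x * D (j - 1)%N G x))).
    apply: near_sum_nat => j jk.
    have jN : (k - j <= (2 * n).-1 - k)%N by lia.
    have e1 : \forall x \near at_end s, a_ k x * D k (fun x => F1 x + c * F2 x) x =
        a_ k x * D k F1 x + c * (a_ k x * D k F2 x).
      by apply: filterS (near_iter_comb c kN c1 c2) => x /= ->; ring.
    have e2 := near_iter_comb c jN (cls_aD kn' c1) (cls_aD kn' c2).
    by apply: filterS2 (near_iter (k - j) e1) e2 => x /= -> ->; ring.
  by apply: filterS => x ->; rewrite big_split /= mulr_sumr.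
have : \forall x \near at_end s, rbr n (fun x => F1 x + c * F2 x) G x =
    \sum_(1 <= k < n.+1) ((half k F1 G x - half k G F1 x) + c * (half k F2 G x - half k G F2 x)).
  apply: near_sum_nat => k kn.
  by apply: filterS2 (h k kn) (h' k kn) => x -> ->; ring.
by apply: filterS => x ->; rewrite big_split /= mulr_sumr.
Qed.

End Brackets.

(** * Green's formula and convergence of the form on powers *)

Section Green.
Context {R : realType}.
Variables (alpha beta : R) (s : endpoint).
Notation tt := (@edist R s).
Notation co := (@ecodist R s).
Notation eps := (@endval R s).
Notation gam := (end_exponent alpha beta s).
Notation gam' := (end_exponent alpha beta (opposite s)).
Notation a_ := (jacobi_a alpha beta).
Notation D k := (iter k (@derive1 R R)).
Notation half := (half alpha beta).
Notation rbr := (rbr alpha beta).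
Notation expo := (expo alpha beta s).
Implicit Types (F G H : R -> R) (x : R).
Hypothesis gam01 : 0 < gam < 1.

Lemma derive1_sum_nat m n (f : nat -> R -> R) x :
  (forall i, (m <= i < n)%N -> derivable (f i) x 1) ->
  derivable (fun y => \sum_(m <= i < n) f i y) x 1 /\
  derive1 (fun y => \sum_(m <= i < n) f i y) x = \sum_(m <= i < n) derive1 (f i) x.
Proof.
elim: n => [|n ih] h.
  under eq_fun do rewrite big_geq //.
  by rewrite big_geq//; exact: derivable_derive1_cst.
have [mn|nm] := leqP m n; last first.
  under eq_fun do rewrite big_geq //.
  by rewrite big_geq//; exact: derivable_derive1_cst.
have [|d1 e1] := ih; first by move=> i /andP[mi iN]; apply: h; rewrite mi ltnS ltnW.
have dn : derivable (f n) x 1 by apply: h; rewrite mn ltnSn.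
have E : (fun y => \sum_(m <= i < n.+1) f i y) = fun y => (\sum_(m <= i < n) f i y) + f n y.
  by apply/funext => y; rewrite big_nat_recr.
by have [d e] := derive1D d1 dn; rewrite E; split => //; rewrite e e1 big_nat_recr.
Qed.

Lemma cls_all_derivable d N r F : cls s d N r F ->
  \forall x \near at_end s, forall i, (i < N)%N -> derivable (D i F) x 1.
Proof.
move=> cF; have : \forall x \near at_end s, forall i : 'I_N, derivable (D i F) x 1.
  by apply: filter_forall => i; exact: cls_iter_derivable cF.
by apply: filterS => x h i iN; exact: (h (Ordinal iN)).
Qed.

(** Repeated integration by parts: with [P = a_ k * D k G], the derivative of the summand [j] is the
    difference of consecutive values of [(-1) ^+ (k + j) * D (k - j) P * D j F], and the sum
    telescopes. *)
Lemma half_derive n k r r' F G : (1 <= k <= n)%N ->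
  cls s 1 (2 * n.+1).-1 r F -> cls s 1 (2 * n.+1).-1 r' G ->
  \forall x \near at_end s, derivable (half k F G) x 1 /\
    derive1 (half k F G) x = a_ k x * D k G x * D k F x
      - (-1) ^+ k * (D k (fun y => a_ k y * D k G y) x * F x).
Proof.
move=> kn cF cG; set P := fun y => a_ k y * D k G y.
have cP : cls s 1 ((2 * n.+1).-1 - k) (gam + r') P by apply: (@cls_aD R alpha beta s n.+1 k r' G _ cG); lia.
apply: filterS2 (cls_all_derivable cF) (cls_all_derivable cP) => x dF dP.
have term j : (1 <= j < k.+1)%N ->
    derivable (fun y => (-1) ^+ (k + j) * (D (k - j)%N P y * D (j - 1)%N F y)) x 1 /\
    derive1 (fun y => (-1) ^+ (k + j) * (D (k - j)%N P y * D (j - 1)%N F y)) x =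
      (-1) ^+ (k + j) * (D (k - j)%N P x * D j F x) -
      (-1) ^+ (k + j.-1) * (D (k - j.-1)%N P x * D j.-1 F x).
  case: j => [/andP[]//|j jk]; rewrite subn1 /=.
  have d1 : derivable (D (k - j.+1)%N P) x 1 by apply: dP; lia.
  have d2 : derivable (D j F) x 1 by apply: dF; lia.
  have [d3 e3] := derive1M d1 d2.
  have [d4 e4] := derive1Z ((-1) ^+ (k + j.+1)) d3.
  split; first exact: d4.
  rewrite -[LHS]/(derive1 (fun y => (-1) ^+ (k + j.+1) * (D (k - j.+1)%N P y * D j F y)) x) e4 e3.
  have -> : (k - j = (k - j.+1).+1)%N by lia.
  by rewrite -!iterS addnS exprS; ring.
have [d e] := derive1_sum_nat (fun j jk => (term j jk).1).
split; first exact: d.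
rewrite [LHS]e.
rewrite (eq_big_nat _ _ (fun j jk => (term j jk).2)) big_add1 /=.
rewrite (telescope_sumr (fun j => (-1) ^+ (k + j) * (D (k - j)%N P x * D j F x))) //.
by rewrite subnn subn0 addn0 addnn -mul2n exprM sqrrN !expr1n mul1r.
Qed.

(** The terms [a_ k * D k F * D k G] of the two halves cancel. The class has order 2n + 1 because
    the derivative of the form reaches order 2n. *)
Lemma rbr_derive n r r' F G :
  cls s 1 (2 * n.+1).-1 r F -> cls s 1 (2 * n.+1).-1 r' G ->
  \forall x \near at_end s, derivable (rbr n F G) x 1 /\
    derive1 (rbr n F G) x = \sum_(1 <= k < n.+1) (-1) ^+ k *
      (D k (fun y => a_ k y * D k F y) x * G x - D k (fun y => a_ k y * D k G y) x * F x).
Proof.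
move=> cF cG.
have h : \forall x \near at_end s, forall i : 'I_n.+1, (1 <= i)%N ->
  (derivable (half i F G) x 1 /\
    derive1 (half i F G) x = a_ i x * D i G x * D i F x
      - (-1) ^+ i * (D i (fun y => a_ i y * D i G y) x * F x)) /\
  (derivable (half i G F) x 1 /\
    derive1 (half i G F) x = a_ i x * D i F x * D i G x
      - (-1) ^+ i * (D i (fun y => a_ i y * D i F y) x * G x)).
  apply: filter_forall => i; have [i1|i1] := leqP 1 i; last by near=> x.
  have iN : (1 <= i <= n)%N by rewrite i1 -ltnS ltn_ord.
  by apply: filterS2 (half_derive iN cF cG) (half_derive iN cG cF).
apply: filterS h => x h.
have term k : (1 <= k < n.+1)%N -> derivable (fun y => half k F G y - half k G F y) x 1 /\
    derive1 (fun y => half k F G y - half k G F y) x = (-1) ^+ k *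
      (D k (fun y => a_ k y * D k F y) x * G x - D k (fun y => a_ k y * D k G y) x * F x).
  move=> /andP[k1 kn]; have [[d1 e1] [d2 e2]] := h (Ordinal kn) k1.
  rewrite /= in d1 e1 d2 e2; have [d3 e3] := derive1Z (-1) d2.
  have [d4 e4] := derive1D d1 d3.
  have E : (fun y => half k F G y - half k G F y) = fun y => half k F G y + -1 * half k G F y.
    by apply/funext => y; rewrite mulN1r.
  by rewrite E; split; [exact: d4|rewrite e4 e3 e1 e2; ring].
have [d e] := derive1_sum_nat (fun j jk => (term j jk).1).
by split; [exact: d|rewrite [LHS]e; apply: eq_big_nat => k kn; exact: (term k kn).2].
Unshelve. all: by end_near. Qed.

(** The falling factorial, which is up to sign the coefficient in the [k]-th derivative of
    [tt ^ a]. *)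
Definition ffr (a : R) (k : nat) : R := \prod_(i < k) (a - i%:R).

Lemma ffrS a k : ffr a k.+1 = ffr a k * (a - k%:R).
Proof. by rewrite /ffr big_ord_recr. Qed.

Lemma near_D_tt k a : \forall x \near at_end s,
  D k (fun y => tt y `^ a) x = (- eps) ^+ k * ffr a k * tt x `^ (a - k%:R).
Proof.
elim: k => [|k ih].
  by near=> x; rewrite /= /ffr big_ord0 expr0 !mul1r subr0.
apply: filterS2 (near_end_deriv ih) (near_derive1_tt s (a - k%:R)) => x [_ /= ->] [d e].
rewrite (derive1Z _ d).2 e ffrS exprS -natr1.
have -> : a - (k%:R + 1) = a - k%:R - 1 by ring.
by move: (tt x `^ _) ((- eps) ^+ k) eps (ffr a k) => T E e' f; ring.
Unshelve. all: by end_near. Qed.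

Lemma ffr_nat_eq0 i k : (i < k)%N -> ffr i%:R k = 0.
Proof. by move=> ik; rewrite /ffr (bigD1 (Ordinal ik)) //= subrr mul0r. Qed.

Lemma near_aD_tt k a : \forall x \near at_end s,
  a_ k x * D k (fun y => tt y `^ a) x =
    ((- eps) ^+ k * ffr a k) * (tt x `^ (gam + a) * co x `^ (gam' + k%:R)).
Proof.
apply: filterS2 (near_D_tt k a) (near_end_lt s (ltr01 : 0 < 1 :> R)) => x /= -> /andP[t0 _].
rewrite (jacobi_aE _ _ s).
have -> : tt x `^ (gam + a) = tt x `^ (gam + k%:R) * tt x `^ (a - k%:R).
  by rewrite -powRDt//; congr powR; ring.
by move: (tt x `^ (gam + _)) (tt x `^ (a - _)) (co x `^ _) (ffr a k) ((- eps) ^+ k) => A B C f e; ring.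
Qed.

Lemma cls_tt_nat N i : cls s 0 N 0 (fun x => tt x `^ i%:R).
Proof.
elim: N i => [|N ih] i.
  by split => //; apply: bigO_le (bigO_tt s _).
have hb : bigO s 0 (fun x => tt x `^ i%:R) by apply: bigO_le (bigO_tt s _).
split => //; split; first by apply: filterS (near_derive1_tt s i%:R) => x [].
rewrite subr0; case: i hb => [|i] hb.
  apply: cls_ext (cls0 s 0 N 0); apply: filterS (near_derive1_tt s 0) => x [_ ->].
  by rewrite mulr0 mul0r.
apply: cls_ext (clsZ (- eps * i.+1%:R) (lexx 0) (ih i)).
apply: filterS (near_derive1_tt s i.+1%:R) => x [_ ->].
by rewrite -natr1 addrK.
Qed.

Lemma expo_odd i : odd i -> gam + expo i = (i./2)%:R.
Proof. by move=> oi; rewrite /expo oi addrC subrK. Qed.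

Lemma expo_even i : ~~ odd i -> expo i = (i./2)%:R.
Proof. by move=> /negbTE oi; rewrite /expo oi subr0. Qed.

(** For odd [p] the sum [gam + expo p] is a natural number, so the function under [D k] is smooth up
    to the endpoint. For even [p] the inner derivative vanishes when [p./2 < k], and otherwise the
    power is high enough to survive [k] derivatives. *)
Lemma LO_bounded k p : bigO s 0 (D k (fun y => a_ k y * D k (fun y => tt y `^ expo p) y)).
Proof.
have near_E := near_iter k (near_aD_tt k (expo p)).
have [oi|oi] := boolP (odd p).
  apply: bigO_ext near_E _; rewrite (expo_odd oi).
  have c := clsZ ((- eps) ^+ k * ffr (expo p) k) (lexx 0)
    (clsM (lexx 0) (cls_tt_nat k p./2) (@cls_codist R s 0 k (gam' + k%:R) (lexx 0))).
  by have := cls_bigO (cls_iter (leqnn k) c); rewrite mul0r subr0 addr0.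
have eo := expo_even oi; have [pk|kp] := ltnP p./2 k.
  have c := @cls0 R s 0 k 0.
  have e0 : \forall x \near at_end s, a_ k x * D k (fun y => tt y `^ expo p) x = 0.
    by apply: filterS (near_aD_tt k (expo p)) => x ->; rewrite eo ffr_nat_eq0// mulr0 mul0r.
  apply: bigO_ext (near_iter k e0) _.
  by have := cls_bigO (cls_iter (leqnn k) c); rewrite mul0r subr0.
apply: bigO_ext near_E _.
have c := clsZ ((- eps) ^+ k * ffr (expo p) k) ler01
    (clsM ler01 (cls_tt s k (gam + expo p)) (@cls_codist R s 1 k (gam' + k%:R) ler01)).
have := cls_bigO (cls_iter (leqnn k) c); apply: bigO_le.
have : k%:R <= (p./2)%:R :> R by rewrite ler_nat.
by rewrite eo; case/andP: gam01; move: gam (p./2)%:R k%:R => g P K; lra.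
Qed.

(** Counting exponents would allow the form to blow up. By Green's formula and [LO_bounded] its
    derivative is O(t^(-gam)), which is integrable at the endpoint as [gam < 1]. *)
Lemma rbr_tt_cvg n p q : exists L : R,
  rbr n (fun x => tt x `^ expo p) (fun x => tt x `^ expo q) x @[x --> at_end s] --> L.
Proof.
set F := fun x => tt x `^ expo p; set G := fun x => tt x `^ expo q.
have cF := cls_tt s (2 * n.+1).-1 (expo p); have cG := cls_tt s (2 * n.+1).-1 (expo q).
have dr := rbr_derive cF cG.
have OF : bigO s (- gam) F by apply: bigO_le (bigO_tt s _); exact: expo_ge.
have OG : bigO s (- gam) G by apply: bigO_le (bigO_tt s _); exact: expo_ge.
have Od : bigO s (- gam) (derive1 (rbr n F G)).
  apply: bigO_ext (near_proj2 dr) _; apply: bigO_sum_nat => k _; apply: bigOZ.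
  have h1 := bigOM (LO_bounded k p) OG; have h2 := bigOM (LO_bounded k q) OF.
  rewrite add0r in h1 h2; have := bigOD h1 (bigOZ (-1) h2).
  by apply: bigO_ext; near=> x; rewrite mulN1r.
have [|c hc] := bigO_primitive _ (near_proj1 dr) Od.
  by case/andP: gam01; move: gam => g; lra.
have g1 : 0 < - gam + 1 by case/andP: gam01; move: gam => g; lra.
exists c; have := bigO_cvg0 g1 hc.
by move=> /(cvgD (cvg_cst c)) h; move: h; rewrite addr0; apply: cvg_trans; apply: near_eq_cvg;
  near=> x; rewrite /= addrC subrK.
Unshelve. all: by end_near. Qed.

End Green.

(** * Limits of the form on pairs of powers *)

Section Pairings.
Context {R : realType}.
Variables (alpha beta : R) (s : endpoint).
Notation tt := (@edist R s).
Notation co := (@ecodist R s).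
Notation eps := (@endval R s).
Notation gam := (end_exponent alpha beta s).
Notation gam' := (end_exponent alpha beta (opposite s)).
Notation a_ := (jacobi_a alpha beta).
Notation D k := (iter k (@derive1 R R)).
Notation half := (half alpha beta).
Notation rbr := (rbr alpha beta).
Notation expo := (expo alpha beta s).
Implicit Types (F G H : R -> R) (x : R).
Hypothesis gam01 : 0 < gam < 1.

Lemma expo_double i : expo (2 * i) = i%:R.
Proof. by rewrite expo_even mul2n ?odd_double// doubleK. Qed.

Lemma expo_doubleS m : expo (2 * m).+1 = m%:R - gam.
Proof.
have h : odd (2 * m).+1 by rewrite /= mul2n odd_double.
by have := @expo_odd R alpha beta s _ h; rewrite /= mul2n uphalf_double => <-; rewrite addrC addKr.
Qed.

Lemma rbr_vanish n r r' F G : 0 < gam + r + r' - n%:R + 1 ->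
  cls s 1 (2 * n).-1 r F -> cls s 1 (2 * n).-1 r' G ->
  rbr n F G x @[x --> at_end s] --> (0 : R).
Proof. by move=> h cF cG; exact: (bigO_cvg0 h (rbr_bigO alpha beta cF cG)). Qed.

Lemma near_iterZ d N r F c k : (k <= N)%N -> cls s d N r F ->
  \forall x \near at_end s, D k (fun x => c * F x) x = c * D k F x.
Proof.
move=> kN cF; have h := near_iter_comb c kN (@cls0 R s d N r) cF.
have e : \forall x \near at_end s, c * F x = 0 + c * F x by near=> x; rewrite add0r.
have z : D k (fun=> 0 : R) = fun=> 0 :> R := iter_derive1_0 k.
by apply: filterS2 (near_iter k e) h => x -> ->; rewrite z add0r.
Unshelve. all: by end_near. Qed.

Lemma ffr_neq0 (a : R) k : (forall i, (i < k)%N -> a != i%:R) -> ffr a k != 0.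
Proof. by move=> h; apply/prodf_neq0 => i _; rewrite subr_eq0 h. Qed.

Section Diagonal.
Variables (n i m : nat).
Hypothesis im : (i + m).+1 = n.
Let F x := tt x `^ i%:R.
Let G x := tt x `^ (m%:R - gam).
Let c := gam' + n%:R.
Let K := (- eps) ^+ n * ffr (m%:R - gam) n.
(** The limit of the summand [j] of [half n F G]: once [co] is frozen at 2, the powers of [tt]
    cancel because [i + m = n - 1]. *)
Let const j := (-1) ^+ (n + j) *
  (K * 2 `^ c * ((- eps) ^+ (n - j) * ffr m%:R (n - j) * ((- eps) ^+ (j - 1) * ffr i%:R (j - 1)))).

(** Only [j = i + 1] survives: for larger [j] the derivative of [tt ^ i] vanishes, for smaller [j]
    that of [tt ^ m]. The remaining term is nonzero because [m - gam] is not an integer. *)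
Lemma diagonal_const : \sum_(1 <= j < n.+1) const j != 0.
Proof.
rewrite (bigD1_seq i.+1) ?iota_uniq ?mem_index_iota//=; last by lia.
rewrite big1_seq ?addr0; last first.
  move=> j /andP[ji]; rewrite mem_index_iota => jn; rewrite /const.
  have [ij|ij] := ltnP i (j - 1); first by rewrite (ffr_nat_eq0 ij) !mulr0.
  have mj : (m < n - j)%N by lia.
  by rewrite (ffr_nat_eq0 mj) mulr0 mul0r !mulr0.
rewrite /const /K; have -> : (n - i.+1 = m)%N by lia.
rewrite subn1 /=.
have e0 : - eps != 0 :> R by rewrite oppr_eq0 endval_neq0.
have f0 k : ffr (k%:R : R) k != 0.
  by apply: ffr_neq0 => l lk; rewrite eqr_nat; lia.
have fg : ffr (m%:R - gam) n != 0.
  apply: ffr_neq0 => l _; apply/eqP => h.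
  have : gam = (m%:Z - l%:Z)%:~R by rewrite intrB -!pmulrn -h; ring.
  by move=> g; move: gam01; rewrite g ltr0z ltrz1; lia.
have p0 : (2 : R) `^ c != 0 by rewrite lt0r_neq0// powR_gt0.
have s0 l : (-1) ^+ l != 0 :> R by rewrite expf_neq0// oppr_eq0 oner_eq0.
by rewrite !mulf_neq0// ?expf_neq0.
Qed.

Lemma half_diagonal : bigO s 1 (fun x => half n F G x - \sum_(1 <= j < n.+1) const j).
Proof.
(* The error of replacing [co] by 2, smaller by one power of [tt] than the main term. *)
pose W x := tt x `^ m%:R * (co x `^ c - 2 `^ c).
have cW : cls s 1 n (m%:R + 1) W.
  apply: clsM => //; first exact: cls_tt.
  by apply: clsS; exact: co_powR_cls.
have cM : cls s 1 n m%:R (fun x => tt x `^ m%:R) by exact: cls_tt.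
have PE : \forall x \near at_end s, a_ n x * D n G x = (K * 2 `^ c) * tt x `^ m%:R + K * W x.
  apply: filterS (near_aD_tt alpha beta s n (m%:R - gam)) => x ->.
  have -> : gam + (m%:R - gam) = m%:R by ring.
  rewrite -/K /W -/c.
  by move: (tt x `^ _) (co x `^ _) (2 `^ _) => T C P; move: K => k; ring.
apply: bigO_ext (_ : bigO s 1 (fun x => \sum_(1 <= j < n.+1)
  ((-1) ^+ (n + j) * (D (n - j)%N (fun y => a_ n y * D n G y) x * D (j - 1)%N F x) - const j))).
  by near=> x; rewrite sumrB.
apply: bigO_sum_nat => j jn.
have jN : (n - j <= n)%N by lia.
have e1 := near_iter (n - j) PE.
have e2 := near_iter_comb K jN (clsZ (K * 2 `^ c) ler01 cM) cW.
have e3 := near_iterZ (K * 2 `^ c) jN cM.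
have e4 := @near_D_tt R s (n - j) m%:R.
have e5 := @near_D_tt R s (j - 1) i%:R.
have h1 : bigO s 1 (fun x => D (n - j)%N W x * D (j - 1)%N F x).
  have cF : cls s 1 n i%:R F by exact: cls_tt.
  have := bigOM (cls_bigO (cls_iter jN cW)) (cls_bigO (cls_iter (ltac:(lia) : (j - 1 <= n)%N) cF)).
  apply: bigO_le; rewrite !natrB; [|lia..]; rewrite -im -natr1 natrD.
  by move: (i%:R) (m%:R) (j%:R) => a b d; lra.
apply: bigO_ext (bigOZ ((-1) ^+ (n + j) * K) h1).
near=> x.
have E1 : D (n - j)%N (fun y => a_ n y * D n G y) x = (K * 2 `^ c) * D (n - j)%N (fun x => tt x `^ m%:R) x + K * D (n - j)%N W x.
  transitivity (D (n - j)%N (fun y => (K * 2 `^ c) * tt y `^ m%:R + K * W y) x); first by near: x.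
  transitivity (D (n - j)%N (fun x => K * 2 `^ c * tt x `^ m%:R) x + K * D (n - j)%N W x); first by near: x.
  by congr (_ + _); near: x.
have E4 : D (n - j)%N (fun y => tt y `^ m%:R) x = (- eps) ^+ (n - j) * ffr m%:R (n - j) * tt x `^ (m%:R - (n - j)%:R).
  by near: x.
have E5 : D (j - 1)%N (fun y => tt y `^ i%:R) x = (- eps) ^+ (j - 1) * ffr i%:R (j - 1) * tt x `^ (i%:R - (j - 1)%:R).
  by near: x.
have /andP[t0 _] : 0 < tt x < 1 by near: x; exact: near_end_lt.
have T1 : tt x `^ (m%:R - (n - j)%:R) * tt x `^ (i%:R - (j - 1)%:R) = 1.
  rewrite -powRDt// -[RHS](powRr0 (tt x)); congr powR.
  rewrite !natrB; [|lia..]; rewrite -im -natr1 natrD.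
  by move: (i%:R) (m%:R) (j%:R) => a b d; ring.
rewrite E1 E4 /const.
have -> : D (j - 1)%N F x = (- eps) ^+ (j - 1) * ffr i%:R (j - 1) * tt x `^ (i%:R - (j - 1)%:R) := E5.
move: T1; move: (tt x `^ (m%:R - _)) (tt x `^ (i%:R - _)) (D (n - j)%N W x) => A B w AB.
move: (ffr m%:R (n - j)) (ffr i%:R (j - 1)) ((- eps) ^+ (n - j)) ((- eps) ^+ (j - 1)) ((-1) ^+ (n + j)) (2 `^ c).
move: K => k f g e1' e2' z P.
transitivity (z * k * w * (e2' * g * B) + z * (k * P * (e1' * f * (e2' * g))) * (A * B) - z * (k * P * (e1' * f * (e2' * g)))).
  by ring.
by rewrite AB; ring.
Unshelve. all: by end_near. Qed.

End Diagonal.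

Lemma bigO_sub_cvg r (f : R -> R) (L : R) : 0 < r -> bigO s r (fun x => f x - L) ->
  f x @[x --> at_end s] --> L.
Proof.
move=> r0 /(bigO_cvg0 r0) /(cvgD (cvg_cst L)) h; move: h; rewrite addr0; apply: cvg_trans.
by apply: near_eq_cvg; near=> x; rewrite /= addrC subrK.
Unshelve. all: by end_near. Qed.

(** Only [half n F G] contributes: the terms with [k < n] keep a positive power of [tt], and in
    [half n G F] the [n] derivatives annihilate [tt ^ i], as [i < n]. *)
Lemma rbr_diagonal n i m : (i + m).+1 = n -> exists2 L : R, L != 0 &
  rbr n (fun x => tt x `^ i%:R) (fun x => tt x `^ (m%:R - gam)) x @[x --> at_end s] --> L.
Proof.
move=> im; eexists; first exact: (diagonal_const im).
apply: (@bigO_sub_cvg 1) => //.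
set F := fun x => tt x `^ i%:R; set G := fun x => tt x `^ (m%:R - gam).
have cF : cls s 1 (2 * n).-1 i%:R F by exact: cls_tt.
have cG : cls s 1 (2 * n).-1 (m%:R - gam) G by exact: cls_tt.
have lower : bigO s 1 (fun x => \sum_(1 <= k < n) (half k F G x - half k G F x)).
  apply: bigO_sum_nat => k kn.
  have kn' : (1 <= k <= n)%N by lia.
  have h1 := half_bigO alpha beta kn' cF cG; have h2 := half_bigO alpha beta kn' cG cF.
  have kr : k%:R + 1 <= n%:R :> R by rewrite natr1 ler_nat; lia.
  have e : n%:R = i%:R + m%:R + 1 :> R by rewrite -im -natr1 natrD.
  have {}h1 := bigO_le (_ : 1 <= _) h1; have {}h2 := bigO_le (_ : 1 <= _) h2.
  have := bigOD (h1 _) (bigOZ (-1) (h2 _)).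
  have g1 : 1 <= gam + i%:R + (m%:R - gam) - k%:R + 1.
    by move: gam (i%:R) (m%:R) (k%:R) (n%:R) kr e => g a b d N kr e; lra.
  have g2 : 1 <= gam + (m%:R - gam) + i%:R - k%:R + 1.
    by move: gam (i%:R) (m%:R) (k%:R) (n%:R) kr e => g a b d N kr e; lra.
  by move=> /(_ g1 g2); apply: bigO_ext; near=> x; rewrite mulN1r.
have zero : \forall x \near at_end s, half n G F x = 0.
  have aF : \forall x \near at_end s, a_ n x * D n F x = 0.
    apply: filterS (near_aD_tt alpha beta s n i%:R) => x ->.
    by rewrite ffr_nat_eq0 ?mulr0 ?mul0r//; lia.
  have h j : \forall x \near at_end s, D (n - j)%N (fun y => a_ n y * D n F y) x = 0.
    by apply: filterS (near_iter (n - j) aF) => x ->; rewrite iter_derive1_0.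
  have : \forall x \near at_end s, half n G F x = \sum_(1 <= j < n.+1) 0.
    by apply: near_sum_nat => j _; apply: filterS (h j) => x ->; rewrite mul0r mulr0.
  by apply: filterS => x ->; rewrite big1.
apply: bigO_ext (bigOD lower (half_diagonal im)).
have n1 : (1 <= n)%N by lia.
apply: filterS zero => x z.
by rewrite /rbr big_nat_recr//= z subr0 addrA.
Unshelve. all: by end_near. Qed.

Definition Lam n p q : R :=
  lim (rbr n (fun x => tt x `^ expo p) (fun x => tt x `^ expo q) x @[x --> at_end s]).

Lemma Lam_cvg n p q :
  rbr n (fun x => tt x `^ expo p) (fun x => tt x `^ expo q) x @[x --> at_end s] --> Lam n p q.
Proof. by have [L h] := rbr_tt_cvg gam01 n p q; apply/cvg_ex; exists L. Qed.

(** With [Lam_eq0] this says that the matrix of pairings of [tt ^ i] with [tt ^ (m - gam)] is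
    triangular with respect to the antidiagonal, with nonzero antidiagonal entries; these are the
    divisors in the Gram-Schmidt process. *)
Lemma Lam_diag n i m : (i + m).+1 = n -> Lam n (2 * i) (2 * m).+1 != 0.
Proof.
move=> im; have [L L0 h] := rbr_diagonal im.
by rewrite /Lam expo_double expo_doubleS (cvg_lim (@Rhausdorff R) h).
Qed.

Lemma Lam_eq0 n i m : (n <= i + m)%N -> Lam n (2 * i) (2 * m).+1 = 0.
Proof.
move=> nim; rewrite /Lam expo_double expo_doubleS; apply: (cvg_lim (@Rhausdorff R)).
apply: (@rbr_vanish n i%:R (m%:R - gam)); [|exact: cls_tt..].
have : n%:R <= i%:R + m%:R :> R by rewrite -natrD ler_nat.
by move: gam (i%:R) (m%:R) (n%:R) => g a b d; lra.
Qed.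

Lemma cls_lincomb M N (b : R) (c : nat -> R) (e : nat -> R) : (forall i, b <= e i) ->
  cls s 1 M b (fun x => \sum_(i < N) c i * tt x `^ e i).
Proof.
by move=> be; apply: cls_sum => i; apply: clsZ => //; apply: cls_le (cls_tt _ _ _).
Qed.

Lemma rbr_sum_l n r N (b : R) (c : nat -> R) (e : nat -> R) G : (forall i, b <= e i) ->
  cls s 1 (2 * n).-1 r G ->
  \forall x \near at_end s, rbr n (fun x => \sum_(i < N) c i * tt x `^ e i) G x =
    \sum_(i < N) c i * rbr n (fun x => tt x `^ e i) G x.
Proof.
move=> be cG; elim: N => [|N ih].
  (* Additivity applied to [0 + 1 * 0] shows that the form vanishes on the zero function. *)
  have h := rbr_comb alpha beta 1 (@cls0 R s 1 (2 * n).-1 0) (@cls0 R s 1 (2 * n).-1 0) cG.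
  have E : (fun x => \sum_(i < 0) c i * tt x `^ e i) = fun=> 0 by apply/funext => x; rewrite big_ord0.
  have E' : (fun x : R => 0 + 1 * 0 : R) = fun=> 0 by apply/funext => x; rewrite mulr0 addr0.
  rewrite E' in h; rewrite E; apply: filterS h => x.
  by rewrite mul1r big_ord0 => /eqP; rewrite -subr_eq0 opprD addrA subrr sub0r oppr_eq0 => /eqP.
have E : (fun x => \sum_(i < N.+1) c i * tt x `^ e i) =
    fun x => (\sum_(i < N) c i * tt x `^ e i) + c N * tt x `^ e N.
  by apply/funext => x; rewrite big_ord_recr.
rewrite E; apply: filterS2 ih (rbr_comb alpha beta (c N) (cls_lincomb _ N c be) (cls_tt s _ (e N)) cG).
by move=> x e1 ->; rewrite e1 big_ord_recr.
Unshelve. all: by end_near. Qed.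

Lemma cvg_lincomb N (c L : nat -> R) (f : nat -> R -> R) (g : R -> R) :
  (\forall x \near at_end s, g x = \sum_(i < N) c i * f i x) ->
  (forall i, f i x @[x --> at_end s] --> L i) ->
  g x @[x --> at_end s] --> \sum_(i < N) c i * L i.
Proof.
move=> gE fL; have h : (\sum_(i < N) c i * f i x) @[x --> at_end s] --> \sum_(i < N) c i * L i.
  elim: N {gE} => [|N ih].
    by under eq_fun do rewrite big_ord0; rewrite big_ord0; exact: cvg_cst.
  under eq_fun do rewrite big_ord_recr /=; rewrite big_ord_recr /=.
  apply: cvgD; first exact: ih.
  by apply: cvgM; [exact: cvg_cst|exact: fL].
by apply: cvg_trans h; apply: near_eq_cvg; apply: filterS gE => x ->.
Qed.

(* The shape of v_j and u_j near the endpoint. *)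
Definition vcomb n (kap : nat -> R) x : R := \sum_(m < n) kap m * tt x `^ expo (2 * m).+1.

Lemma cls_vcomb M n kap : cls s 1 M (- gam) (vcomb n kap).
Proof.
by apply: (@cls_lincomb _ _ _ kap (fun m => expo (2 * m).+1)) => i; exact: expo_ge.
Qed.

Definition pairing n (kap : nat -> R) (p : nat) : R := \sum_(m < n) kap m * Lam n p (2 * m).+1.

Lemma rbr_tt_vcomb n p kap :
  rbr n (fun x => tt x `^ expo p) (vcomb n kap) x @[x --> at_end s] --> pairing n kap p.
Proof.
apply: (@cvg_lincomb _ _ (fun m => Lam n p (2 * m).+1)
  (fun m => rbr n (fun x => tt x `^ expo p) (fun x => tt x `^ expo (2 * m).+1))); last first.
  by move=> m; exact: Lam_cvg.
have h := @rbr_sum_l n (expo p) n (- gam) kap (fun m => expo (2 * m).+1) _ (fun m => expo_ge gam01 _) (cls_tt s _ _).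
apply: filterS h => x h; rewrite rbr_antisym h -sumrN; apply: eq_bigr => m _.
by rewrite [in RHS]rbr_antisym mulrN.
Qed.

Lemma rbr_asym_vcomb n (c : nat -> R) F kap : (0 < n)%N ->
  cls s 1 (2 * n).-1 (rho alpha beta s n) (fun x => F x - \sum_(i < 2 * n) c i * tt x `^ expo i) ->
  rbr n F (vcomb n kap) x @[x --> at_end s] --> \sum_(i < 2 * n) c i * pairing n kap i.
Proof.
move=> n0 cF0; set F0 := (fun x => _) in cF0.
have cU := cls_vcomb (2 * n).-1 n kap.
have cS : cls s 1 (2 * n).-1 (- gam) (fun x => \sum_(i < 2 * n) c i * tt x `^ expo i).
  by apply: cls_lincomb => i; exact: expo_ge.
have h1 := rbr_comb alpha beta 1 cF0 cS cU.
have h2 := @rbr_sum_l n _ (2 * n) (- gam) c expo _ (expo_ge gam01) cU.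
(* The exponent is [gam + rho n - gam - n + 1 = (1 - gam) / 2], which is positive. *)
have v : rbr n F0 (vcomb n kap) x @[x --> at_end s] --> (0 : R).
  apply: (rbr_vanish _ cF0 cU); rewrite /rho.
  by case/andP: gam01; move: gam (n%:R) => g N; lra.
have w : rbr n (fun x => \sum_(i < 2 * n) c i * tt x `^ expo i) (vcomb n kap) x @[x --> at_end s] -->
    \sum_(i < 2 * n) c i * pairing n kap i.
  apply: (@cvg_lincomb (2 * n) c (pairing n kap)
    (fun i => rbr n (fun x => tt x `^ expo i) (vcomb n kap)) _ h2) => i.
  exact: rbr_tt_vcomb.
have vw : (rbr n F0 (vcomb n kap) x +
    rbr n (fun x => \sum_(i < 2 * n) c i * tt x `^ expo i) (vcomb n kap) x) @[x --> at_end s] -->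
    \sum_(i < 2 * n) c i * pairing n kap i.
  by rewrite -[X in _ --> X]add0r; exact: cvgD v w.
apply: cvg_trans vw; apply: near_eq_cvg.
have e : \forall x \near at_end s, F x = F0 x + 1 * \sum_(i < 2 * n) c i * tt x `^ expo i.
  by near=> x; rewrite /F0 mul1r subrK.
have e' : \forall x \near at_end s, vcomb n kap x = vcomb n kap x by near=> x.
by apply: filterS2 h1 (rbr_ext alpha beta n e e') => x h1 ->; rewrite h1 mul1r.
Unshelve. all: by end_near. Qed.

End Pairings.

(** * Reduction of the complex form to the real one *)

Section ComplexBracket.
Local Open Scope complex_scope.
Context {R : realType}.
Notation Re := complex.Re.
Notation Im := complex.Im.
Notation D k := (iter k (@derive1 R R)).

Lemma complex_cvg (T : Type) (F : set_system T) {FF : Filter F} (X Y : T -> R) (a b : R) :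
  X x @[x --> F] --> a -> Y x @[x --> F] --> b ->
  ((X x +i* Y x) : R[i]^o) @[x --> F] --> ((a +i* b) : R[i]^o).
Proof.
(* The radius is a positive element of [R[i]], hence has imaginary part 0. *)
move=> Xa Yb; apply/cvgrPdist_lt => -[e e'] /=; rewrite ltcE /= => /andP[/eqP -> e0].
have e2 : 0 < e / 2 by lra.
have /cvgrPdist_lt/(_ _ e2) hX := Xa; have /cvgrPdist_lt/(_ _ e2) hY := Yb.
apply: filterS2 hX hY => x hX hY.
rewrite ltcE /= eqxx /=.
apply: (@le_lt_trans _ _ (`|a - X x| + `|b - Y x|)); last by lra.
rewrite -[leRHS]ger0_norm ?addr_ge0// -sqrtr_sqr ler_sqrt ?sqr_ge0//.
rewrite [in leRHS]sqrrD !real_normK ?num_real// addrAC lerDl mulrn_wge0// mulr_ge0//.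
Qed.

Lemma complex_sum (I : Type) (l : seq I) (P : pred I) (X Y : I -> R) :
  \sum_(i <- l | P i) (X i +i* Y i) = (\sum_(i <- l | P i) X i) +i* (\sum_(i <- l | P i) Y i).
Proof.
elim: l => [|i l ih]; first by rewrite !big_nil.
by rewrite !big_cons; case: ifP => // _; rewrite ih.
Qed.

Variables (alpha beta : R) (s : endpoint).
Notation rbr := (rbr alpha beta).
Notation a_ := (jacobi_a alpha beta).

(** Since [g] is real near the endpoint, conjugation does nothing there and the form acts separately
    on the real and imaginary parts of [f]. *)
Lemma bracket_real n (f g : R -> R[i]) (U : R -> R) :
  (\forall x \near at_end s, g x = (U x)%:C) ->
  \forall x \near at_end s, bracket alpha beta n f g x =
    rbr n (fun y => Re (f y)) U x +i* rbr n (fun y => Im (f y)) U x.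
Proof.
move=> gU; set fr := fun y => Re (f y); set fi := fun y => Im (f y).
pose gbar := fun y => (g y)^*.
have nr : \forall x \near at_end s, Re (gbar x) = U x by apply: filterS gU => x; rewrite /gbar => ->.
have ni : \forall x \near at_end s, Im (gbar x) = 0.
  by apply: filterS gU => x; rewrite /gbar => -> /=; rewrite oppr0.
have z k : D k (fun=> 0 : R) = fun=> 0 :> R := iter_derive1_0 k.
have cE k h : (fun y => (a_ k y)%:C * cderive k h y) = fun y =>
    (a_ k y * D k (fun y => Re (h y)) y) +i* (a_ k y * D k (fun y => Im (h y)) y).
  by apply/funext => y; rewrite cderiveE real_complexM.
have : \forall x \near at_end s, bracket alpha beta n f g x =
    \sum_(1 <= k < n.+1) \sum_(1 <= j < k.+1)
     (((-1) ^+ (k + j) * (D (k - j)%N (fun y => a_ k y * D k U y) x * D (j - 1)%N fr x) -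
      (-1) ^+ (k + j) * (D (k - j)%N (fun y => a_ k y * D k fr y) x * D (j - 1)%N U x)) +i*
      ((-1) ^+ (k + j) * (D (k - j)%N (fun y => a_ k y * D k U y) x * D (j - 1)%N fi x) -
      (-1) ^+ (k + j) * (D (k - j)%N (fun y => a_ k y * D k fi y) x * D (j - 1)%N U x))).
  apply: near_sum_nat => k _; apply: near_sum_nat => j _.
  have r1 := near_iter (j - 1) nr; have i1 := near_iter (j - 1) ni.
  have r2 : \forall x \near at_end s, a_ k x * D k (fun y => Re (gbar y)) x = a_ k x * D k U x.
    by apply: filterS (near_iter k nr) => x ->.
  have i2 : \forall x \near at_end s, a_ k x * D k (fun y => Im (gbar y)) x = 0.
    by apply: filterS (near_iter k ni) => x ->; rewrite z mulr0.
  have r3 := near_iter (k - j) r2; have i3 := near_iter (k - j) i2.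
  apply: filterS2 (filterI r1 i1) (filterI r3 i3) => x [e1 e2] [e3 e4].
  rewrite !cE !cderiveE /= -/gbar -/fr -/fi.
  rewrite e1 e2 e3 e4 !z.
  have -> : (-1) ^+ (k + j) = ((-1) ^+ (k + j))%:C :> R[i] by rewrite rmorphXn rmorphN1.
  rewrite real_complexM /= -/fr -/fi.
  by congr (_ +i* _); ring.
apply: filterS => x ->.
under eq_bigr => k _ do rewrite complex_sum.
rewrite complex_sum /rbr /half; congr (_ +i* _); apply: eq_bigr => k _; by rewrite sumrB.
Qed.

Lemma bracket_end_real n f g U (a b : R) :
  (\forall x \near at_end s, g x = (U x)%:C) ->
  rbr n (fun y => Re (f y)) U x @[x --> at_end s] --> a ->
  rbr n (fun y => Im (f y)) U x @[x --> at_end s] --> b ->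
  bracket_end alpha beta n s f g = a +i* b.
Proof.
move=> gU ha hb; have FF : Filter (at_end s : set_system R) by exact: _.
have h := @complex_cvg _ _ FF _ _ _ _ ha hb.
apply: (cvg_lim (@norm_hausdorff _ R[i]^o)).
have e : {near at_end s, (fun x => rbr n (fun y => Re (f y)) U x +i* rbr n (fun y => Im (f y)) U x)
    =1 bracket alpha beta n f g}.
  by apply: filterS (bracket_real n f gU) => x ->.
exact: (cvg_trans (near_eq_cvg e) h).
Qed.

End ComplexBracket.

(** * The functions u_j *)

Section GramSchmidt.
Local Open Scope complex_scope.
Context {R : realType}.
Variables (alpha beta : R) (s : endpoint) (n : nat).
Notation Re := complex.Re.
Notation Im := complex.Im.
Notation tt := (@edist R s).
Notation gam := (end_exponent alpha beta s).
Notation expo := (expo alpha beta s).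
Notation rbr := (rbr alpha beta).
Notation Lam := (Lam alpha beta s n).
Notation vcomb := (vcomb alpha beta s n).
Notation pairing := (pairing alpha beta s n).
Notation bend := (bracket_end alpha beta n s).
Hypothesis gam01 : 0 < gam < 1.
Variables phi v u : nat -> R -> R[i].
Hypotheses (hphi : forall j, (1 <= j <= n)%N -> is_phi s j (phi j))
  (hv : forall j, (1 <= j <= n)%N -> is_v alpha beta n s j (v j))
  (hu : is_gram_schmidt alpha beta n s phi v u).

Lemma phi_near j : (1 <= j <= n)%N ->
  \forall x \near at_end s, phi j x = (tt x `^ expo (2 * (j - 1)))%:C.
Proof.
move=> jn; have [_ h _] := hphi jn.
apply: filterS2 h (near_end_lt s (ltr01 : 0 < 1 :> R)) => x -> /andP[t0 _].
by rewrite -edistE expo_double powR_mulrn// ltW.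
Qed.

Lemma vcomb_delta q x : (q < n)%N -> vcomb (fun m => (m == q)%:R) x = tt x `^ expo (2 * q).+1.
Proof.
move=> qn; rewrite /vcomb (bigD1 (Ordinal qn)) //= eqxx mul1r big1 ?addr0//.
by move=> m; rewrite -val_eqE /= => /negbTE ->; rewrite mul0r.
Qed.

Lemma pairing_delta q p : (q < n)%N -> pairing (fun m => (m == q)%:R) p = Lam p (2 * q).+1.
Proof.
move=> qn; rewrite /pairing (bigD1 (Ordinal qn)) //= eqxx mul1r big1 ?addr0//.
by move=> m; rewrite -val_eqE /= => /negbTE ->; rewrite mul0r.
Qed.

Lemma v_near j : (1 <= j <= n)%N ->
  \forall x \near at_end s, v j x = (vcomb (fun m => (m == n - j)%N%:R) x)%:C.
Proof.
move=> jn; have [_ h _] := hv jn; apply: filterS h => x ->.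
rewrite vcomb_delta; last by lia.
by rewrite -edistE expo_doubleS natrB; [congr ((_ `^ _)%:C); ring|lia].
Qed.

Lemma bracket_phi j g kap : (1 <= j <= n)%N ->
  (\forall x \near at_end s, g x = (vcomb kap x)%:C) ->
  bend (phi j) g = (pairing kap (2 * (j - 1)))%:C.
Proof.
move=> jn gU; have ph := phi_near jn.
have pr : \forall x \near at_end s, Re (phi j x) = tt x `^ expo (2 * (j - 1)).
  by apply: filterS ph => x ->.
have pim : \forall x \near at_end s, Im (phi j x) = 0 by apply: filterS ph => x ->.
have U : \forall x \near at_end s, vcomb kap x = vcomb kap x by near=> x.
have h1 : rbr n (fun y => Re (phi j y)) (vcomb kap) x @[x --> at_end s] --> pairing kap (2 * (j - 1)).
  have h := @rbr_tt_vcomb R alpha beta s gam01 n (2 * (j - 1)) kap; apply: cvg_trans h.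
  apply: near_eq_cvg; apply: filterS (rbr_ext alpha beta n pr U) => x e; exact: esym e.
have h2 : rbr n (fun y => Im (phi j y)) (vcomb kap) x @[x --> at_end s] --> (0 : R).
  have g0 : 0 < gam + n%:R + (- gam) - n%:R + 1 by move: gam (n%:R) => gm N; lra.
  have h := rbr_vanish g0 (@cls0 R s 1 (2 * n).-1 n%:R) (cls_vcomb gam01 _ n kap).
  apply: cvg_trans h.
  apply: near_eq_cvg; apply: filterS (rbr_ext alpha beta n pim U) => x e; exact: esym e.
exact: (bracket_end_real gU h1 h2).
Unshelve. all: by end_near. Qed.

(** One Gram-Schmidt step on coefficients, used with [f] the pairings and with [f] the powers of
    [tt], so that the same coefficients describe both. *)
Lemma lincomb_sub (I : Type) (l : seq I) (N : nat) (A f : nat -> R) (c : I -> R) (K : I -> nat -> R) (t : R) :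
  \sum_(m < N) ((A m - \sum_(j <- l) c j * K j m) / t) * f m =
  (\sum_(m < N) A m * f m - \sum_(j <- l) c j * \sum_(m < N) K j m * f m) / t.
Proof.
rewrite mulrBl mulr_suml.
have -> : (\sum_(j <- l) c j * \sum_(m < N) K j m * f m) / t =
    \sum_(m < N) (\sum_(j <- l) c j * K j m) / t * f m.
  under eq_bigr => j _ do rewrite mulr_sumr.
  rewrite exchange_big /= mulr_suml; apply: eq_bigr => m _.
  rewrite -mulrA [t^-1 * _]mulrC mulrA; congr (_ / t); rewrite mulr_suml.
  by apply: eq_bigr => j _; rewrite mulrA.
rewrite -sumrB; apply: eq_bigr => m _; rewrite !mulrBl; congr (_ - _).
by rewrite mulrAC.
Qed.

(** By induction the earlier [u j] are dual to the powers, so the denominators [[phi_j, u_j]] equal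
    1. Pairing with [tt ^ i], the subtracted terms cancel the contribution of [v k] if [i + 1 < k],
    the division normalises it if [i + 1 = k], and [Lam_eq0] gives 0 beyond. *)
Lemma gram_schmidt k : (1 <= k <= n)%N -> exists kap : nat -> R,
  (\forall x \near at_end s, u k x = (vcomb kap x)%:C) /\
  forall i, (i < n)%N -> pairing kap (2 * i) = (i.+1 == k)%:R.
Proof.
elim/ltn_ind: k => k ih kn.
(* Existence is stated for every [j], with a dummy value outside the range, so that choice yields a
   function on [nat]. *)
have : forall j, exists kap : nat -> R, (1 <= j < k)%N ->
  (\forall x \near at_end s, u j x = (vcomb kap x)%:C) /\
  forall i, (i < n)%N -> pairing kap (2 * i) = (i.+1 == j)%:R.
  move=> j; have [jk|jk] := boolP (1 <= j < k)%N; last by exists (fun=> 0).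
  have [||kap hk] := ih j; [lia|lia|].
  by exists kap.
move=> /choice[K hK].
pose del m : R := (m == n - k)%N%:R.
pose lam i := Lam (2 * i) (2 * (n - k)).+1.
have delE i : pairing del (2 * i) = lam i by apply: pairing_delta; lia.
have lk : lam (k - 1)%N != 0 by apply: Lam_diag => //; lia.
exists (fun m => (del m - \sum_(1 <= j < k) lam (j - 1)%N * K j m) / lam (k - 1)%N); split; last first.
  move=> i iN; rewrite /pairing (@lincomb_sub _ (index_iota 1 k) n del (fun m => Lam (2 * i) (2 * m).+1) (fun j => lam (j - 1)%N) K) -/(pairing del (2 * i)) delE.
  have -> : \sum_(1 <= j < k) lam (j - 1)%N * \sum_(m < n) K j m * Lam (2 * i) (2 * m).+1 =
      \sum_(1 <= j < k) lam (j - 1)%N * (i.+1 == j)%:R.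
    by apply: eq_big_nat => j jk; rewrite -/(pairing (K j) (2 * i)) (hK j jk).2.
  have [ik|ki] := ltnP i.+1 k.
    rewrite (bigD1_seq i.+1) ?iota_uniq ?mem_index_iota//= eqxx mulr1 subn1 /=.
    rewrite big1 ?addr0 ?subrr ?mul0r; last by move=> j /negbTE; rewrite eq_sym => ->; rewrite mulr0.
    by rewrite (_ : (i.+1 == k) = false)//; lia.
  rewrite big_nat big1 ?subr0; last first.
    by move=> j jk; rewrite (_ : (i.+1 == j) = false) ?mulr0//; lia.
  have [ik|ik] := eqVneq i.+1 k; last first.
    by rewrite /lam Lam_eq0 ?mul0r//; lia.
  have -> : lam i = lam (k - 1)%N by congr lam; lia.
  exact: divff.
have near_all : \forall x \near at_end s, forall j : 'I_k, (1 <= j)%N -> u j x = (vcomb (K j) x)%:C.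
  apply: filter_forall => j; have [j1|j1] := leqP 1 j; last by near=> x.
  have jk : (1 <= j < k)%N by rewrite j1 ltn_ord.
  by apply: filterS (hK j jk).1.
apply: filterS3 near_all (v_near kn) (near_end_itv s) => x hx hvx x1.
rewrite (hu kn x1) hvx (bracket_phi kn (v_near kn)) -/del delE.
have -> : \sum_(1 <= j < k) bend (phi j) (v k) / bend (phi j) (u j) * u j x =
    (\sum_(1 <= j < k) lam (j - 1)%N * vcomb (K j) x)%:C.
  rewrite rmorph_sum; apply: eq_big_nat => j jk.
  have jn : (1 <= j <= n)%N by lia.
  have [uj pj] := hK j jk.
  have jk' : (j < k)%N by lia.
  rewrite (bracket_phi jn (v_near kn)) (bracket_phi jn uj) -/del delE pj; last by lia.
  have -> : ((j - 1).+1 == j) = true by apply/eqP; lia.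
  have /andP[j1 _] := jk.
  by rewrite divr1 rmorphM (hx (Ordinal jk') j1).
rewrite -rmorphB -fmorphV -rmorphM /vcomb (@lincomb_sub _ (index_iota 1 k) n del (fun m => tt x `^ expo (2 * m).+1) (fun j => lam (j - 1)%N) K).
by [].
Unshelve. all: by end_near. Qed.

End GramSchmidt.

(** * The functions h_(j,k) *)

Section FallingFactorials.
Context {R : realType}.
Implicit Types (eta e : nat -> R).

Lemma ffr_natE m k : ffr m%:R k = (m ^_ k)%N%:R :> R.
Proof.
elim: k => [|k ih]; first by rewrite /ffr big_ord0 ffactn0.
rewrite ffrS ih ffactnSr natrM; have [km|mk] := leqP k m; first by rewrite natrB.
by rewrite ffact_small ?mul0r.
Qed.

(** [ffr m k] vanishes for [m < k], so natural exponents give a triangular system with the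
    factorials on the diagonal. *)
Lemma sum_ffr_nat eta N m : (m < N)%N -> (forall k, (k < m)%N -> eta k = 0) ->
  \sum_(k < N) eta k * ffr m%:R k = eta m * (m`!)%:R.
Proof.
move=> mN h; rewrite (bigD1 (Ordinal mN)) //= ffr_natE ffactnn big1 ?addr0// => k km.
have [/h ->|mk] := ltnP k m; first by rewrite mul0r.
rewrite ffr_nat_eq0 ?mulr0// ltn_neqAle mk andbT eq_sym.
by move: km; rewrite -val_eqE.
Qed.

Lemma sum_ffr_nat_eq0 eta N m : (m <= N)%N ->
  (forall i, (i < m)%N -> \sum_(k < N) eta k * ffr i%:R k = 0) ->
  forall k, (k < m)%N -> eta k = 0.
Proof.
move=> mN h; elim/ltn_ind=> k ih km.
have : eta k * (k`!)%:R = 0.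
  rewrite -(@sum_ffr_nat eta N) ?h//; first exact: leq_trans mN.
  by move=> l lk; apply: ih => //; exact: ltn_trans km.
by move/eqP; rewrite mulf_eq0 pnatr_eq0 -[(_ `! == 0)%N]negbK -lt0n fact_gt0 orbF => /eqP.
Qed.

Definition ffr_mx N e : 'M[R]_N := \matrix_(k, p) ffr (e p) k.

(** A vector in the left kernel is the coefficient vector of a polynomial of degree below [N] in the
    falling factorial basis, with [N] distinct roots [e p]. The polynomial is zero, and its values
    at 0, 1, 2, ... recover the coefficients by triangularity. *)
Lemma ffr_mx_unit N e : (forall p q, (p < N)%N -> (q < N)%N -> e p = e q -> p = q) ->
  ffr_mx N e \in unitmx.
Proof.
move=> einj; rewrite -row_free_unit; apply: inj_row_free => v vM.
pose Q k : {poly R} := \prod_(0 <= l < k) ('X - (l%:R)%:P).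
pose P : {poly R} := \sum_(k < N) v ord0 k *: Q k.
have PE a : P.[a] = \sum_(k < N) v ord0 k * ffr a k.
  rewrite horner_sum; apply: eq_bigr => k _; rewrite hornerZ; congr (_ * _).
  rewrite /Q /ffr horner_prod big_mkord; apply: eq_bigr => l _.
  by rewrite hornerXsubC.
have P0 : P = 0.
  apply/eqP; apply: contraT => Pn0.
  have rP : all (root P) [seq e p | p <- iota 0 N].
    apply/allP => r /mapP[p]; rewrite mem_iota => /andP[_ pN] -> {r}.
    apply/rootP; rewrite PE; have /rowP/(_ (Ordinal pN)) := vM; rewrite !mxE => h.
    by rewrite -[RHS]h; apply: eq_bigr => k _; rewrite mxE.
  have ue : uniq [seq e p | p <- iota 0 N].
    rewrite map_inj_in_uniq ?iota_uniq// => p q.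
    by rewrite !mem_iota => /andP[_ pN] /andP[_ qN]; exact: einj.
  have := max_poly_roots Pn0 rP ue; rewrite size_map size_iota ltnNge => /negP[].
  apply: (leq_trans (size_sum _ _ _)); apply/bigmax_leqP => k _.
  by rewrite (leq_trans (size_scale_leq _ _))// size_prod_XsubC size_iota subn0.
apply/rowP => i; rewrite [RHS]mxE.
pose eta k : R := if insub k is Some i then v ord0 i else 0.
have etaE (k : 'I_N) : eta k = v ord0 k by rewrite /eta valK.
rewrite -etaE; apply: (@sum_ffr_nat_eq0 eta N N) => // l _.
rewrite -[RHS](horner0 l%:R) -P0 PE; apply: eq_bigr => k _; by rewrite etaE.
Qed.

End FallingFactorials.

(** * A differential expression with prescribed values on powers *)

Section PointwiseFunctional.
Context {R : realType}.
Variables (alpha beta : R) (s : endpoint).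
Notation tt := (@edist R s).
Notation eps := (@endval R s).
Notation gam := (end_exponent alpha beta s).
Notation D k := (iter k (@derive1 R R)).
Notation expo := (expo alpha beta s).
Implicit Types (F : R -> R) (x : R).
Hypothesis gam01 : 0 < gam < 1.

Lemma expo_inj p q : expo p = expo q -> p = q.
Proof.
have key (a b : nat) : a%:R = b%:R - gam -> False.
  move=> h; have : gam = (b%:Z - a%:Z)%:~R by rewrite intrB -!pmulrn h; ring.
  by move=> g; move: gam01; rewrite g ltr0z ltrz1; lia.
rewrite !expoE -{3}(odd_double_half p) -{3}(odd_double_half q).
case: (odd p) (odd q) => [] [].
- by move=> /addIr /eqP; rewrite eqr_nat => /eqP ->.
- by rewrite subr0 => /esym /key.
- by rewrite subr0 => /key.
- by move=> /addIr /eqP; rewrite eqr_nat => /eqP ->.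
Qed.

Lemma expo_lt n p : (p < 2 * n)%N -> expo p <= n%:R - 1.
Proof.
move=> pn; have : (p./2)%:R + 1 <= n%:R :> R by rewrite natr1 ler_nat; lia.
rewrite !expoE; move: (p./2)%:R (n%:R) gam01 => a b g.
by case: (odd p); move: gam g => gg; lra.
Qed.

Variables (n : nat) (Phi : nat -> R).

(* The coefficients are chosen so that [pointwise] takes the value [Phi p] on [tt^(expo p)]. *)
Definition eta k x : R := if insub k is Some k' then
  \sum_(p < 2 * n) tt x `^ (- expo p) * Phi p * invmx (ffr_mx (2 * n) expo) p k' else 0.

(** Near the endpoint the Euler-type operator [(- eps) ^+ k * tt ^+ k * D k] has every power
    [tt ^ a] as eigenfunction, with eigenvalue [ffr a k]. Hence the matrix of the system for [eta]
    does not depend on [x]. *)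
Definition pointwise F x : R :=
  \sum_(k < 2 * n) (- eps) ^+ k * tt x ^+ k * eta k x * D k F x.

Lemma eta_ffr p x : (p < 2 * n)%N ->
  \sum_(k < 2 * n) eta k x * ffr (expo p) k = tt x `^ (- expo p) * Phi p.
Proof.
move=> pn; pose c : 'rV[R]_(2 * n) := \row_p (tt x `^ (- expo p) * Phi p).
have U : ffr_mx (2 * n) expo \in unitmx.
  by apply: ffr_mx_unit => a b _ _; exact: expo_inj.
have := mulmxKV U c => /rowP/(_ (Ordinal pn)); rewrite !mxE /= => <-.
apply: eq_bigr => k _; rewrite /eta valK !mxE; congr (_ * _).
by apply: eq_bigr => q _; rewrite !mxE.
Qed.

Lemma eta_bigO k : bigO s (1 - n%:R) (eta k).
Proof.
rewrite /eta; case: insubP => [k' _ _|_]; last exact: bigO0.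
have : cls s 1 0 (1 - n%:R) (fun x => \sum_(p < 2 * n)
    tt x `^ (- expo p) * Phi p * invmx (ffr_mx (2 * n) expo) p k').
  apply: cls_sum => p; apply: (@cls_le _ _ _ _ _ (- expo p)).
    by have := expo_lt (ltn_ord p); move: (expo p) (n%:R) => a b; lra.
  have h := clsZ (Phi p * invmx (ffr_mx (2 * n) expo) p k') ler01 (cls_tt s 0 (- expo p)).
  have -> : (fun x => tt x `^ (- expo p) * Phi p * invmx (ffr_mx (2 * n) expo) p k') =
      fun x => Phi p * invmx (ffr_mx (2 * n) expo) p k' * tt x `^ (- expo p).
    by apply/funext => x; rewrite [RHS]mulrC mulrA.
  exact: h.
exact: cls_bigO.
Qed.

Lemma near_iter_lincomb M N (c e : nat -> R) b k : (k <= M)%N -> (forall i, b <= e i) ->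
  \forall x \near at_end s, D k (fun y => \sum_(i < N) c i * tt y `^ e i) x =
    \sum_(i < N) c i * D k (fun y => tt y `^ e i) x.
Proof.
move=> kM be; elim: N => [|N ih].
  have z : D k (fun=> 0 : R) = fun=> 0 :> R := iter_derive1_0 k.
  have E : (fun x => \sum_(i < 0) c i * tt x `^ e i) = fun=> 0 by apply/funext => x; rewrite big_ord0.
  by near=> x; rewrite E z big_ord0.
have E : (fun x => \sum_(i < N.+1) c i * tt x `^ e i) =
    fun x => (\sum_(i < N) c i * tt x `^ e i) + c N * tt x `^ e N.
  by apply/funext => x; rewrite big_ord_recr.
rewrite E; apply: filterS2 ih (near_iter_comb (c N) kM (cls_lincomb s M N c be) (cls_tt s M (e N))).
by move=> x e1 ->; rewrite e1 big_ord_recr.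
Unshelve. all: by end_near. Qed.

Lemma pointwise_tt p : (p < 2 * n)%N ->
  \forall x \near at_end s, pointwise (fun y => tt y `^ expo p) x = Phi p.
Proof.
move=> pn.
have h : \forall x \near at_end s, forall k : 'I_(2 * n),
    D k (fun y => tt y `^ expo p) x = (- eps) ^+ k * ffr (expo p) k * tt x `^ (expo p - k%:R).
  by apply: filter_forall => k; exact: near_D_tt.
apply: filterS2 h (near_end_lt s (ltr01 : 0 < 1 :> R)) => x h /andP[t0 _].
have -> : Phi p = tt x `^ expo p * (tt x `^ (- expo p) * Phi p).
  by rewrite mulrA -powRDt// subrr powRr0 mul1r.
rewrite -(eta_ffr _ pn) mulr_sumr; apply: eq_bigr => k _; rewrite h.
have e1 : (- eps) ^+ k * (- eps) ^+ k = 1 by rewrite -exprMn mulrNN endval_sqr expr1n.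
have e2 : tt x ^+ k * tt x `^ (expo p - k%:R) = tt x `^ expo p.
  by rewrite -powR_mulrn ?ltW// -powRDt//; congr powR; ring.
rewrite -e2; move: e1 {e2}.
move: (eta k x) (ffr _ _) (tt x `^ _) (tt x ^+ k) ((- eps) ^+ k) => E f T t e e1.
by transitivity (e * e * (t * T * (E * f))); [ring|rewrite e1 mul1r].
Qed.

Lemma pointwise_cvg F (c : nat -> R) :
  cls s 1 (2 * n).-1 (rho alpha beta s n) (fun x => F x - \sum_(i < 2 * n) c i * tt x `^ expo i) ->
  pointwise F x @[x --> at_end s] --> \sum_(i < 2 * n) c i * Phi i.
Proof.
set F0 := (fun x => _) => cF0.
have be := expo_ge gam01.
(* The exponents [k], [1 - n] and [rho n - k] add up to [(1 - gam) / 2]. *)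
have v : bigO s (1 / 2 - gam / 2) (pointwise F0).
  rewrite /pointwise; under eq_fun do rewrite -(big_mkord xpredT (fun k => (- eps) ^+ k * tt _ ^+ k * eta k _ * D k F0 _)).
  apply: bigO_sum_nat => k kn.
  have h := bigOM (bigO_tt s k%:R) (bigOM (eta_bigO k) (cls_bigO (cls_iter (ltac:(lia) : (k <= (2 * n).-1)%N) cF0))).
  apply: bigO_ext (bigOZ ((- eps) ^+ k) (bigO_le _ h)); last first.
    by rewrite /rho; move: gam (n%:R) (k%:R) => g N K; lra.
  apply: filterS (near_end_lt s (ltr01 : 0 < 1 :> R)) => x /andP[t0 _].
  by rewrite powR_mulrn ?ltW// !mulrA.
have e : \forall x \near at_end s, pointwise F x - \sum_(i < 2 * n) c i * Phi i = pointwise F0 x.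
  have h1 : \forall x \near at_end s, forall k : 'I_(2 * n), D k F x = D k F0 x +
      \sum_(i < 2 * n) c i * D k (fun y => tt y `^ expo i) x.
    apply: filter_forall => k; have kM : (k <= (2 * n).-1)%N by have := ltn_ord k; lia.
    have e1 := near_iter_comb 1 kM cF0 (cls_lincomb s (2 * n).-1 (2 * n) c be).
    have e2 := @near_iter_lincomb _ (2 * n) c expo _ k kM be.
    have e3 : \forall x \near at_end s, F x = F0 x + 1 * \sum_(i < 2 * n) c i * tt x `^ expo i.
      by near=> x; rewrite /F0 mul1r subrK.
    by apply: filterS3 e1 e2 (near_iter k e3) => x e1 e2 ->; rewrite e1 mul1r e2.
  have h2 : \forall x \near at_end s, forall i : 'I_(2 * n), pointwise (fun y => tt y `^ expo i) x = Phi i.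
    by apply: filter_forall => i; exact: pointwise_tt.
  apply: filterS2 h1 h2 => x h1 h2.
  apply/eqP; rewrite subr_eq; apply/eqP.
  have -> : \sum_(i < 2 * n) c i * Phi i = \sum_(k < 2 * n) (- eps) ^+ k * tt x ^+ k * eta k x *
      \sum_(i < 2 * n) c i * D k (fun y => tt y `^ expo i) x.
    under [RHS]eq_bigr => k _ do rewrite mulr_sumr.
    rewrite exchange_big /=; apply: eq_bigr => i _; rewrite -h2 /pointwise mulr_sumr.
    by apply: eq_bigr => k _; rewrite mulrCA.
  by rewrite /pointwise -big_split /=; apply: eq_bigr => k _; rewrite h1 mulrDr.
apply: (bigO_sub_cvg _ (bigO_ext e v)).
by case/andP: gam01; move: gam => g; lra.
Unshelve. all: by end_near. Qed.

Variables (j : nat).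
Hypotheses (jn : (1 <= j <= n)%N)
  (Phi_even : forall i, (i < n)%N -> Phi (2 * i) = (i.+1 == j)%:R).

(** Only the equations at even indices below [2 * (j - 1)] enter: their exponents are the naturals
    below [j - 1] and their right-hand sides are 0. *)
Lemma eta_lt k x : (k < j - 1)%N -> eta k x = 0.
Proof.
apply: (@sum_ffr_nat_eq0 _ (eta ^~ x) (2 * n)); first by lia.
move=> i ij; have /(eta_ffr x) : (2 * i < 2 * n)%N by lia.
rewrite expo_double Phi_even; last by lia.
have -> : (i.+1 == j) = false by apply/eqP; lia.
by rewrite mulr0.
Qed.

Lemma eta_diag x : 0 < tt x -> tt x ^+ (j - 1) * eta (j - 1) x = (((j - 1)`!)%:R)^-1.
Proof.
move=> t0; have /(eta_ffr x) : (2 * (j - 1) < 2 * n)%N by lia.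
rewrite expo_double Phi_even; last by lia.
have -> : (j - 1).+1 == j by apply/eqP; lia.
rewrite (@sum_ffr_nat _ (eta ^~ x)); [|lia|by move=> k; exact: eta_lt].
have f0 : ((j - 1)`!)%:R != 0 :> R by rewrite pnatr_eq0 -lt0n fact_gt0.
rewrite mulr1 => h; apply: (mulIf f0); rewrite mulVf// -mulrA h.
by rewrite -powR_mulrn ?ltW// -powRDt// subrr powRr0.
Qed.

Lemma pointwise_expand F x : 0 < tt x -> pointwise F x =
  (- eps) ^+ (j - 1) * (D (j - 1)%N F x / ((j - 1)`!)%:R) +
  \sum_(j <= k < 2 * n) (- eps) ^+ k * tt x ^+ k * eta k x * D k F x.
Proof.
move=> t0; rewrite /pointwise.
rewrite -(big_mkord xpredT (fun k => (- eps) ^+ k * tt x ^+ k * eta k x * D k F x)).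
rewrite (@big_cat_nat _ _ _ j)//=; last by lia.
congr (_ + _); rewrite (_ : j = (j - 1).+1) ?big_nat_recr//=; last by lia.
rewrite big_nat big1 ?add0r; last by move=> k kj; rewrite eta_lt ?mulr0 ?mul0r//; lia.
rewrite (_ : (_ - 1)%N = (j - 1)%N); last by lia.
by rewrite -!mulrA [eta _ _ * _]mulrC [tt x ^+ _ * _]mulrCA eta_diag.
Qed.

End PointwiseFunctional.

(** * The representation at either endpoint *)

Local Open Scope complex_scope.

Theorem lemma4p12 (R : realType) (alpha beta : R) (n : nat)
    (phi v u : endpoint -> nat -> R -> R[i])
    (halpha : 0 < alpha < 1) (hbeta : 0 < beta < 1) (hn : (0 < n)%N)
    (hphi : forall s j, (1 <= j <= n)%N -> is_phi s j (phi s j))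
    (hv : forall s j, (1 <= j <= n)%N -> is_v alpha beta n s j (v s j))
    (hu : forall s, is_gram_schmidt alpha beta n s (phi s) (v s) (u s)) :
  forall s : endpoint, exists h : nat -> nat -> R -> R[i],
  forall f : R -> R[i], Dmax alpha beta n f ->
  forall j : nat, (1 <= j <= n)%N ->
    ((((- endval s) ^+ (j - 1))%:C * (cderive (j - 1) f x / ((j - 1)`!)%:R)
      + \sum_(j <= k < 2 * n) h j k x * cderive k f x) : R[i]^o)
      @[x --> at_end s] --> (bracket_end alpha beta n s f (u s j) : R[i]^o).
Proof.
move=> s.
have g01 : 0 < end_exponent alpha beta s < 1 by case: s.
have : forall j, exists kap : nat -> R, (1 <= j <= n)%N ->
    (\forall x \near at_end s, u s j x = (vcomb alpha beta s n kap x)%:C) /\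
    forall i, (i < n)%N -> pairing alpha beta s n kap (2 * i) = (i.+1 == j)%:R.
  move=> j; have [jn|jn] := boolP (1 <= j <= n)%N; last by exists (fun=> 0).
  have [kap hk] := gram_schmidt g01 (hphi s) (hv s) (hu s) jn.
  by exists kap.
move=> /choice[K hK].
pose Phi j := pairing alpha beta s n (K j).
pose H j k (x : R) : R := (- endval s) ^+ k * edist s x ^+ k * eta alpha beta s n (Phi j) k x.
exists (fun j k x => (H j k x)%:C) => f fD j jn.
have [aR aI lR lI] := Dmax_real halpha hbeta hn fD.
have [uj pj] := hK j jn.
have [c cR] := structure s halpha hbeta hn aR lR.
have [c' cI] := structure s halpha hbeta hn aI lI.
have bR := @rbr_asym_vcomb _ _ _ _ g01 n c _ (K j) hn cR.
have bI := @rbr_asym_vcomb _ _ _ _ g01 n c' _ (K j) hn cI.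
rewrite (bracket_end_real uj bR bI).
have FF : Filter (at_end s : set_system R) by exact: _.
have pR := @pointwise_cvg _ _ _ _ g01 n (Phi j) _ c cR.
have pI := @pointwise_cvg _ _ _ _ g01 n (Phi j) _ c' cI.
have h := @complex_cvg _ _ _ FF _ _ _ _ pR pI.
(* The form and [pointwise] have the same limit, the combination of the values [Phi j] with the
   coefficients of the expansion; what remains is to match [pointwise] with the displayed
   expression. *)
apply: cvg_trans h; apply: near_eq_cvg.
apply: filterS (near_end_lt s (ltr01 : 0 < 1 :> R)) => x /andP[t0 _].
rewrite !(pointwise_expand g01 jn pj _ t0) !cderiveE.
under [X in _ = _ + X]eq_bigr => k _ do rewrite cderiveE real_complexM.
rewrite complex_sum.
have -> : (((j - 1)`!)%:R : R[i]) = (((j - 1)`!)%:R : R)%:C by rewrite rmorph_nat.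
rewrite -fmorphV [_ * (_^-1)%:C]mulrC !real_complexM /=.
by congr (_ +i* _); rewrite [_ / _]mulrC.
Qed.
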